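(* There exist $\nu_0>0$ and $C>0$, depending only on the shear profile $b$, such that for all $\nu\in(0,\nu_0]$, with $c_0^2=\nu^{-\frac{N+1}{N+3}}$, in each of the periodic, Dirichlet, and Neumann settings, every real-valued $u\in C^\infty(\bar\Omega\times[0,c_0^2])$ (with $u=0$ on $\{y=0,1\}$ in the Dirichlet setting) satisfies $$\nu^{\frac{N+1}{2(N+3)}}\left(\|u-\langle u\rangle\|_{L^2(\Omega\times(0,c_0^2))}+\|u\|_{Q^{1/(N+3)}_{\partial_x}}\right)\le C\left(\|X_0u\|_{\mathbf Y^*}+\|u\|_{\mathbf Y}\right),$$ where $X_0=\partial_t+b(y)\partial_x$ and $\langle u\rangle(y,t)=\int_{\mathbb T}u(x,y,t)\,dx$.
   Context: $\mathbb T=\mathbb R/\mathbb Z$. $\Omega=\mathbb T\times D$, where $D=\mathbb T$ in the periodic setting and $D=(0,1)$ in the Dirichlet and Neumann settings. The shear profile $b\in C^\infty(\bar D)$ is real-valued and has precisely $M\ge 0$ critical points $y_1,\dots,y_M$ in $\bar D$ (finitely many). At each critical point $y_i$ there is an integer $N_i\ge1$ with $b^{(k)}(y_i)=0$ for all $1\le k\le N_i$ and $b^{(N_i+1)}(y_i)\ne0$. Set $N=\max_{1\le i\le M}N_i$ if $M\ge1$, and $N=0$ if $M=0$. Seminorms (on $\Omega\times(0,c_0^2)$): $\|u\|_{\mathbf Y}=\nu^{1/2}\|\partial_yu\|_{L^2(\Omega\times(0,c_0^2))}$. The dual seminorm is $$\|g\|_{\mathbf Y^*}=\sup\Big\{\int_{\Omega\times(0,c_0^2)}g\,v\,dx\,dy\,dt:\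 \|v\|_{\mathbf Y}=1\Big\}\in[0,\infty],$$ where $v$ ranges over $L^2_{t,x}H^1_y(\Omega\times(0,c_0^2))$ in the periodic and Neumann settings and over $L^2_{t,x}(H^1_0)_y(\Omega\times(0,c_0^2))$ in the Dirichlet setting. For $s>0$, $$\|u\|_{Q^s_{\partial_x}}=\sup_{\sigma>0}\sigma^{-1}\|u(x+\sigma^{1/s},y,t)-u(x,y,t)\|_{L^2(\Omega\times(0,c_0^2))}.$$ *)

(* Defs.v *)
From HB Require Import structures.
From mathcomp Require Import all_boot all_order all_algebra.
From mathcomp Require Import all_classical all_reals all_analysis.

Set Implicit Arguments.
Unset Strict Implicit.
Unset Printing Implicit Defensive.
Import Order.TTheory GRing.Theory Num.Theory.
Import numFieldNormedType.Exports.
Local Open Scope classical_set_scope.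
Local Open Scope ring_scope.

(* The range of y is D: the circle T = R/Z in the periodic setting, the interval
   (0, 1) in the Dirichlet and Neumann settings.  Functions on T are 1-periodic
   functions on R, and integrals over T are integrals over ]0, 1[. *)
Inductive ydomain := CircleY | IntervalY.

Inductive setting := Periodic | Dirichlet | Neumann.

Definition ydomain_of (s : setting) : ydomain :=
  if s is Periodic then CircleY else IntervalY.

(* For the circle, a set of representatives. *)
Definition closed_ydomain (R : realType) (D : ydomain) : set R :=
  match D with CircleY => `[0, 1[ | IntervalY => `[0, 1] end.

Definition unit_itv (R : realType) : set R := `]0, 1[.
Arguments unit_itv : clear implicits.

Definition one_periodic (R : realType) (f : R -> R) :=
  forall y, f (y + 1) = f y.

Definition smooth1 (R : realType) (f : R -> R) :=
  forall n y, derivable (derive1n n f) y 1.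

(* b is a smooth function on the closure of D, given on [0, 1] by a smooth
   extension to R; its derivatives at the points of [0, 1] (one-sided ones at the
   endpoints) do not depend on the extension. *)
Definition smooth_profile (R : realType) (D : ydomain) (b : R -> R) :=
  smooth1 b /\ (D = CircleY -> one_periodic b).

Definition is_critical_data (R : realType) (D : ydomain) (b : R -> R) (M : nat)
    (yc : 'I_M -> R) (Nc : 'I_M -> nat) : Prop :=
  [/\ injective yc,
      (forall y, (closed_ydomain D y /\ derive1 b y = 0) <->
                 exists i, y = yc i),
      (forall i, (1 <= Nc i)%N),
      (forall i k, (1 <= k <= Nc i)%N -> derive1n k b (yc i) = 0) &
      (forall i, derive1n (Nc i).+1 b (yc i) != 0)].

(* Points of space-time are triples (x, y, t). *)
Notation point3 R := (R * R * R)%type.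

Notation lebesgue2 R := (@lebesgue_measure R \x @lebesgue_measure R)%E.
Notation lebesgue3 R := (lebesgue2 R \x @lebesgue_measure R)%E.

Definition spacetime (R : realType) (T : R) : set (point3 R) :=
  unit_itv R `*` unit_itv R `*` `]0, T[.

Definition dx (R : realType) (u : point3 R -> R) : point3 R -> R :=
  'D_((1, 0, 0) : point3 R) u.
Definition dy (R : realType) (u : point3 R -> R) : point3 R -> R :=
  'D_((0, 1, 0) : point3 R) u.
Definition dt (R : realType) (u : point3 R -> R) : point3 R -> R :=
  'D_((0, 0, 1) : point3 R) u.

(* Infinite differentiability: every iterated directional derivative is Frechet
   differentiable. *)
Definition smooth3 (R : realType) (u : point3 R -> R) :=
  forall (l : seq (point3 R)) (p : point3 R),
    differentiable (foldr (fun v (f : point3 R -> R) => 'D_v f) u l) p.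

(* The smooth functions on the closure of Omega x (0, T), each given by a smooth
   extension to R^3 (1-periodic in the variables that range over T), with the
   boundary condition of the Dirichlet setting. *)
Definition admissible (R : realType) (s : setting) (T : R)
    (u : point3 R -> R) : Prop :=
  [/\ smooth3 u,
      (forall x y t, u (x + 1, y, t) = u (x, y, t)),
      (s = Periodic -> forall x y t, u (x, y + 1, t) = u (x, y, t)) &
      (s = Dirichlet -> forall x t, 0 <= t <= T ->
         u (x, 0, t) = 0 /\ u (x, 1, t) = 0)].

(* The norm of L^2(A, mu); f is extended by 0 outside A. *)
Definition L2norm d (X : measurableType d) (R : realType)
    (mu : {measure set X -> \bar R}) (A : set X) (f : X -> R) : \bar R :=
  Lnorm mu 2%:E (EFin \o (f \_ A)).

Definition compactly_supported01 (R : realType) (phi : R -> R) :=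
  exists a c : R, [/\ 0 < a, c < 1 & forall y, ~~ (a <= y <= c) -> phi y = 0].

Definition test_function (R : realType) (D : ydomain) (phi : R -> R) :=
  smooth1 phi /\
  match D with
  | CircleY => one_periodic phi
  | IntervalY => compactly_supported01 phi
  end.

Definition weak_derivative (R : realType) (D : ydomain) (f g : R -> R) :=
  forall phi, test_function D phi ->
    \int[@lebesgue_measure R]_(y in unit_itv R) (f y * derive1 phi y) =
    - \int[@lebesgue_measure R]_(y in unit_itv R) (g y * phi y).

(* For f in H^1(0, 1) with weak derivative g: f lies in H^1_0(0, 1), the closure
   of the smooth compactly supported functions in H^1(0, 1). *)
Definition H10_slice (R : realType) (f g : R -> R) :=
  forall e : R, 0 < e -> exists2 phi, test_function IntervalY phi &
    (L2norm (@lebesgue_measure R) (unit_itv R) (fun y => f y - phi y)%R +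
     L2norm (@lebesgue_measure R) (unit_itv R) (fun y => g y - derive1 phi y)%R
       <= e%:E)%E.

(* v lies in L^2_{t,x} H^1_y (L^2_{t,x} (H^1_0)_y in the Dirichlet setting), with
   weak derivative w in y. *)
Definition L2H1y (R : realType) (s : setting) (T : R)
    (v w : point3 R -> R) : Prop :=
  [/\ measurable_fun (spacetime T) v,
      measurable_fun (spacetime T) w,
      (L2norm (lebesgue3 R) (spacetime T) v < +oo)%E,
      (L2norm (lebesgue3 R) (spacetime T) w < +oo)%E &
      {ae lebesgue2 R, forall q : R * R, (unit_itv R `*` `]0, T[) q ->
         let f := fun y => v (q.1, y, q.2) in
         let g := fun y => w (q.1, y, q.2) in
         weak_derivative (ydomain_of s) f g /\
         (s = Dirichlet -> H10_slice f g)}].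

(* The seminorm ||u||_Y as a function of the y-derivative w of u (classical for
   smooth u, weak for u in L^2 H^1_y). *)
Definition Ynorm (R : realType) (nu T : R) (w : point3 R -> R) : \bar R :=
  ((Num.sqrt nu)%:E * L2norm (lebesgue3 R) (spacetime T) w)%E.

Definition Ydual (R : realType) (s : setting) (nu T : R)
    (g : point3 R -> R) : \bar R :=
  ereal_sup [set z | exists v w : point3 R -> R,
    [/\ L2H1y s T v w, Ynorm nu T w = 1%E &
        z = (\int[lebesgue3 R]_(p in spacetime T) (g p * v p)%:E)%E]].

Definition Qnorm (R : realType) (r T : R) (u : point3 R -> R) : \bar R :=
  ereal_sup [set z | exists2 sigma : R, 0 < sigma &
    z = ((sigma^-1)%:E * L2norm (lebesgue3 R) (spacetime T)
           (fun p => u ((p.1.1 + sigma `^ r^-1)%R, p.1.2, p.2) - u p)%R)%E].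

Definition xmean (R : realType) (u : point3 R -> R) (p : point3 R) : R :=
  \int[@lebesgue_measure R]_(x in unit_itv R) u (x, p.1.2, p.2).

Definition X0 (R : realType) (b : R -> R) (u : point3 R -> R) (p : point3 R) : R :=
  dt u p + b p.1.2 * dx u p.

(* Main.v *)
(* The dual norm of [X0 u] is the L^2 norm, divided by [nu^(1/2)], of the primitive
   [H] of [X0 u] in [y] with zero mean.  Fix a scale [sigma <= 1] and cut
   [0, 1] x [0, T] (in [y] and [t]) into boxes of size [delta x tau], with
   [delta ~ nu^(1/(N+3)) sigma] and [tau ~ T sigma^2].  On a box, averaging
   [u_t + b u_x = H_y] in [y] against a bump function [phi] with the weights [1] and
   [B = b - <b>] gives, for [U = <u>] and [P = <B u>],
     [(dt + <b> dx) U + dx P = g0],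
     [(dt + <b> dx) P + <B^2> dx U + dx E = g1],
   where [g0], [g1] are controlled by [H] (the derivative falls on [phi]) and [P], [E]
   by the oscillation of [u] in [y], hence by [u_y].  Pairing the increment of [U] by
   [r = sigma^(N+3)] with the integral of [P] over [x, x + r] bounds
   [<B^2> |U(x + r) - U(x)|^2].  As [b'] vanishes to order at most [N], [B] has size
   [a >= c delta^(N+1)] on every cell, so that [r <= tau a]; summing over the boxes
   gives [||u(x + r) - u||^2 <= C sigma^2 T (||u||_Y^2 + ||X0 u||_Y*^2)].  Averaging
   over [r] in [0, 1] bounds [u - <u>], which in turn controls the scales
   [sigma > 1]. *)

(* Regularity in [x] stems from the commutator [b' dx] of [dy] with [X0]. On a box the weight [B]
   stands in for [dy]: its mean is zero, so [P] is small through [u_y], and a second factor [B],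
   coming from [b dx], produces [<B^2> dx U]. The hierarchy of moments is closed by replacing
   [<B^2 u>] with [<B^2> U], at the price of the error [E].

   The obstacle is time. Nothing is known about [u] at the two ends of a box in [t], so the pairing
   needs a cutoff [chi] vanishing there and bounds only [chi q^2], where [q = U(x + r) - U(x)]. The
   missing part comes from an energy identity: [1 - 6 chi] is the derivative of a function vanishing
   at both ends, and the evolution of the squared increment of [u] involves only [H] once it is
   integrated over the box.

   With [kappa = nu^(1/(N+3))] and [T = kappa^-(N+1)] one has [nu T = kappa^2]. This identity gives
   the contributions of [u_y] and of [H] the same size at every scale [sigma]. *)
Require Import Defs.
From HB Require Import structures.
From mathcomp Require Import all_boot all_order all_algebra.
From mathcomp Require Import all_classical all_reals all_analysis.
From mathcomp Require Import measurable_realfun ring lra.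
Set Implicit Arguments.
Unset Strict Implicit.
Unset Printing Implicit Defensive.
Import Order.TTheory GRing.Theory Num.Theory.
Import numFieldNormedType.Exports.
Local Open Scope classical_set_scope.
Local Open Scope ring_scope.

(** * Continuity, derivatives and oriented integrals *)

(* A named constant, so that tactics can match on it. *)
Definition cts {R : realType} {X : topologicalType} (f : X -> R) : Prop :=
  continuous f.
Definition cts2 {R : realType} (F : R -> R -> R) : Prop :=
  cts (fun p : R * R => F p.1 p.2).
Definition cts3 {R : realType} (F : R -> R -> R -> R) : Prop :=
  cts (fun p : R * R * R => F p.1.1 p.1.2 p.2).

Section Continuity.
Context {R : realType} {X : topologicalType}.
Implicit Types f g h : X -> R.

Lemma cts_comp1 (F : R -> R) f : cts F -> cts f -> cts (fun x => F (f x)).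
Proof. by move=> cF cf x; exact: (continuous_comp (cf x) (cF (f x))). Qed.

Lemma cts_comp2 (F : R -> R -> R) f g : cts2 F -> cts f -> cts g ->
  cts (fun x => F (f x) (g x)).
Proof.
move=> cF cf cg x.
exact: (continuous2_cvg (nbhs_filter x) (cF (f x, g x)) (cf x) (cg x)).
Qed.

Lemma cts_comp3 (F : R -> R -> R -> R) f g h : cts3 F -> cts f -> cts g ->
  cts h -> cts (fun x => F (f x) (g x) (h x)).
Proof.
move=> cF cf cg ch x.
pose F' (p : R * R) z := F p.1 p.2 z.
have := @continuous2_cvg X (R * R)%type R R (nbhs x) (nbhs_filter x)
  (fun x => (f x, g x)) h F' (f x, g x) (h x) (cF (f x, g x, h x)).
by apply; [exact: (cvg_pair (cf x) (cg x))|exact: ch].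
Qed.

Lemma ctsD f g : cts f -> cts g -> cts (fun x => f x + g x).
Proof. by move=> cf cg x; apply: cvgD; [exact: cf|exact: cg]. Qed.

Lemma ctsM f g : cts f -> cts g -> cts (fun x => f x * g x).
Proof. by move=> cf cg x; apply: cvgM; [exact: cf|exact: cg]. Qed.

Lemma ctsN f : cts f -> cts (fun x => - f x).
Proof. by move=> cf x; apply: cvgN; exact: cf. Qed.

Lemma cts_cst (c : R) : cts (fun _ : X => c).
Proof. by move=> x; exact: cvg_cst. Qed.

Lemma ctsX f n : cts f -> cts (fun x => f x ^+ n).
Proof.
move=> cf; elim: n => [|n IH].
  by rewrite (_ : (fun x => _) = fun=> 1); [exact: cts_cst|apply/funext].
rewrite (_ : (fun x => _) = fun x => f x * f x ^+ n); first exact: ctsM.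
by apply/funext => x; rewrite exprS.
Qed.

Lemma cts_norm f : cts f -> cts (fun x => `|f x|).
Proof. by move=> cf x; apply: cvg_norm; exact: cf. Qed.

End Continuity.

Section Projections.
Context {R : realType} {X Y : topologicalType}.

Lemma cts_fst_comp (f : X -> R) : cts f -> cts (fun p : X * Y => f p.1).
Proof.
move=> cf [a b]; apply: (@cvg_comp _ _ _ fst f _ (nbhs a)); last exact: cf.
exact: cvg_fst.
Qed.

Lemma cts_snd_comp (f : Y -> R) : cts f -> cts (fun p : X * Y => f p.2).
Proof.
move=> cf [a b]; apply: (@cvg_comp _ _ _ snd f _ (nbhs b)); last exact: cf.
exact: cvg_snd.
Qed.

Lemma cts_id : cts (fun x : R => x).
Proof. by move=> x; exact: cvg_id. Qed.

End Projections.

Lemma cts_uncurry {R : realType} (X Y : topologicalType) (g : X -> R -> R)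
  (f : Y -> X) (h : Y -> R) : cts (fun p : X * R => g p.1 p.2) ->
  continuous f -> cts h -> cts (fun y => g (f y) (h y)).
Proof.
move=> cg cf ch y.
exact: (continuous2_cvg (nbhs_filter y) (cg (f y, h y)) (cf y) (ch y)).
Qed.

Lemma cts_slice {R : realType} (X : topologicalType) (g : X -> R -> R) x :
  cts (fun p : X * R => g p.1 p.2) -> cts (g x).
Proof.
move=> cg; apply: (@cts_uncurry _ _ _ g (fun=> x) id) => //.
  by move=> y; exact: cvg_cst.
exact: cts_id.
Qed.

Lemma cts_partial1 {R : realType} (F : R -> R -> R) (x : R) : cts2 F -> cts (F x).
Proof.
by move=> cF; apply: (cts_comp2 cF); [exact: cts_cst|exact: cts_id].
Qed.

Arguments cts_partial1 {R F} x _.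

Ltac ctst := repeat
  lazymatch goal with
  | |- forall _, _ => intro
  | |- cts2 ?F => first [ match goal with
      H : cts2 ?G |- _ => constr_eq F G; exact H end | rewrite /cts2 ]
  | |- cts3 ?F => first [ match goal with
      H : cts3 ?G |- _ => constr_eq F G; exact H end | rewrite /cts3 ]
  | |- cts (fun _ => ?c) => apply: cts_cst
  | |- cts (fun x => x) => apply: cts_id
  | |- cts snd => apply: (@cts_snd_comp _ _ _ (fun x => x))
  | |- cts fst => apply: (@cts_fst_comp _ _ _ (fun x => x))
  | |- cts (fun p => p.1) => apply: (@cts_fst_comp _ _ _ (fun x => x))
  | |- cts (fun p => p.2) => apply: (@cts_snd_comp _ _ _ (fun x => x))
  | |- cts (fun p => p.1.1) => apply: (@cts_fst_comp _ _ _ (fun x => x.1))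
  | |- cts (fun p => p.1.2) => apply: (@cts_fst_comp _ _ _ (fun x => x.2))
  | |- cts (fun p => p.1.1.1) => apply: (@cts_fst_comp _ _ _ (fun x => x.1.1))
  | |- cts (fun p => p.1.1.2) => apply: (@cts_fst_comp _ _ _ (fun x => x.1.2))
  | |- cts (fun p => p.1.1.1.1) => apply: (@cts_fst_comp _ _ _ (fun x => x.1.1.1))
  | |- cts (fun p => p.1.1.1.2) => apply: (@cts_fst_comp _ _ _ (fun x => x.1.1.2))
  | |- cts (Algebra.add ?a) => change (cts (fun z => a + z))
  | |- cts (GRing.mul ?a) => change (cts (fun z => a * z))
  | |- cts Algebra.opp => change (cts (fun z => - z))
  | |- cts (fun x => - _) => apply: ctsN
  | |- cts (fun x => _ * _) => apply: ctsM
  | |- cts (fun x => _ + _) => apply: ctsD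
  | |- cts (fun x => _ ^+ _) => apply: ctsX
  | |- cts (fun x => `|_|) => apply: cts_norm
  | |- cts ?F => match goal with
    | H : cts ?G |- _ => constr_eq F G; exact H
    | H : cts3 ?G |- cts (fun x => ?F _ _ _) => constr_eq F G; apply: (cts_comp3 H)
    | H : cts2 ?G |- cts (fun x => ?F _ _) => constr_eq F G; apply: (cts_comp2 H)
    | H : cts ?G |- cts (fun x => ?F _) => constr_eq F G; apply: (cts_comp1 H)
    | H : cts3 ?G |- cts (?F ?a ?b) => constr_eq F G; change (cts (fun z => F a b z))
    | H : cts2 ?G |- cts (?F _) => constr_eq F G; apply: (cts_partial1 _ H)
    end
  end.

Section Calculus.
Context {R : realType}.
Notation mu := (@lebesgue_measure R).
Implicit Types (f g F : R -> R) (a b c : R).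

(* The oriented integral, so that no ordering of the endpoints is needed. *)
Definition rint a b f : R := (b - a) * \int[mu]_(s in `[0, 1]) f (a + s * (b - a)).

Lemma cont_integrable f a b : cts f -> mu.-integrable `[a, b] (EFin \o f).
Proof.
move=> cf; apply: continuous_compact_integrable; first exact: segment_compact.
exact: continuous_subspaceT.
Qed.

Lemma is_derive_cont F f : (forall y : R, is_derive y 1 F (f y)) -> cts F.
Proof.
move=> dF y; apply: differentiable_continuous; apply/derivable1_diffP.
exact: (@ex_derive _ _ _ _ _ _ _ (dF y)).
Qed.

Lemma Rintegral_prim F f a b : a < b -> cts f ->
  (forall y : R, is_derive y 1 F (f y)) -> \int[mu]_(s in `[a, b]) f s = F b - F a.
Proof.
move=> ab cf dF; rewrite /Rintegral (@continuous_FTC2 _ f F)//.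
- exact: continuous_subspaceT.
- have cF := is_derive_cont dF; split.
  + by move=> x _; exact: (@ex_derive _ _ _ _ _ _ _ (dF x)).
  + exact/cvg_at_right_filter/cF.
  + exact/cvg_at_left_filter/cF.
- by move=> x _; rewrite derive1E; exact: (@derive_val _ _ _ _ _ _ _ (dF x)).
Qed.

(** The base point [c y = - |y| - 1] lies below both [y] and [0]. The difference
    [G (c y) y - G (c y) 0] does not depend on the base point, so near [y] it agrees with the same
    expression for the fixed base [c y - 1], to which the one-sided fundamental theorem applies. *)
Lemma exists_prim f : cts f ->
  exists F, forall y : R, is_derive y 1 F (f y).
Proof.
move=> cf.
pose G a y := \int[mu]_(s in `[a, y]) f s.
have dG a y : a < y -> is_derive y 1 (G a) (f y).
  move=> ay; have := @continuous_FTC1_closed _ f a y (y + 1) _ _ ay (cf y).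
  case; first by rewrite ltrDl.
    exact: cont_integrable.
  by move=> d1 d2; apply: (DeriveDef d1); rewrite -derive1E.
have GB a c y : a < c -> c < y -> G a y = G a c + G c y.
  move=> ac cy; rewrite /G.
  have := @Rintegral_itvB _ f (BLeft a) (BRight y) c.
  rewrite !bnd_simp => /(_ (cont_integrable _ _ cf) (ltW ac) (ltW cy)) H.
  apply/eqP; rewrite addrC -subr_eq; apply/eqP; rewrite H.
  rewrite Rintegral_itv_obnd_cbnd//.
  by apply: integrableS (cont_integrable c y cf) => //; exact: subset_itv_oc_cc.
pose c (z : R) := - `|z| - 1.
have cz z : c z < z.
  by rewrite /c; move: (lerNnormlW (lexx `|z|)); lra.
have c0 z : c z < 0 by rewrite /c; have := normr_ge0 z; lra.
exists (fun y => G (c y) y - G (c y) 0) => y.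
pose a := c y - 1.
have ay : a < y by rewrite /a; have := cz y; lra.
have a0 : a < 0 by rewrite /a; have := c0 y; lra.
apply: (@near_eq_is_derive _ _ _ (fun y => G a y - G a 0)).
- near=> z.
  have ac : a < c z.
    rewrite /a /c.
    have : `|z - y| < 1 by near: z; apply: cvgr_distC_lt => //; exact: cvg_id.
    by have := ler_dist_dist z y; have := ler_norm (`|z| - `|y|); lra.
  by rewrite (GB _ _ _ ac (cz z)) (GB _ _ _ ac (c0 z)); lra.
- have := dG _ _ ay => ?.
  by apply: is_derive_eq; rewrite subr0.
Unshelve. all: by end_near. Qed.

Definition hasd F (x d : R) : Prop := is_derive x (1 : R) F d.

Lemma hasd_eq F x d d' : hasd F x d -> d = d' -> hasd F x d'.
Proof. by move=> ? <-. Qed.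

Lemma hasd_cst c x : hasd (fun=> c) x 0.
Proof. exact: is_derive_cst. Qed.

Lemma hasd_id x : hasd (fun y => y) x 1.
Proof. exact: is_derive_id. Qed.

Lemma hasdD F G x d e : hasd F x d -> hasd G x e ->
  hasd (fun y => F y + G y) x (d + e).
Proof. exact: is_deriveD. Qed.

Lemma hasdN F x d : hasd F x d -> hasd (fun y => - F y) x (- d).
Proof. exact: is_deriveN. Qed.

Lemma hasdB F G x d e : hasd F x d -> hasd G x e ->
  hasd (fun y => F y - G y) x (d - e).
Proof. by move=> dF dG; apply: hasdD => //; exact: hasdN. Qed.

Lemma hasdM F G x d e : hasd F x d -> hasd G x e ->
  hasd (fun y => F y * G y) x (d * G x + F x * e).
Proof.
move=> dF dG; apply: (@is_derive_eq _ _ _ _ _ _ _ _ (is_deriveM dF dG)).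
by rewrite addrC [G x *: d]mulrC.
Qed.

Lemma hasdMl c F x d : hasd F x d -> hasd (fun y => c * F y) x (c * d).
Proof.
by move=> dF; apply: hasd_eq (hasdM (hasd_cst c x) dF) _; rewrite mul0r add0r.
Qed.

Lemma hasd_comp F g x d e : hasd F (g x) d -> hasd g x e ->
  hasd (fun s => F (g s)) x (d * e).
Proof. exact: is_derive1_comp. Qed.

Lemma hasd_affine c d s : hasd (fun s => c + s * d) s d.
Proof.
apply: hasd_eq (hasdD (hasd_cst _ _) (hasdM (hasd_id _) (hasd_cst _ _))) _.
by ring.
Qed.

Lemma hasd_cont F f : (forall y, hasd F y (f y)) -> cts F.
Proof. exact: is_derive_cont. Qed.

Lemma rint_prim F f a b : cts f -> (forall y, hasd F y (f y)) ->
  rint a b f = F b - F a.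
Proof.
move=> cf dF; rewrite /rint.
have cc : cts (fun s : R => f (a + s * (b - a))).
  by ctst.
rewrite -RintegralZl//; last exact: cont_integrable.
pose G s := F (a + s * (b - a)).
have dG s : hasd G s ((b - a) * f (a + s * (b - a))).
  by rewrite mulrC; exact: (hasd_comp (dF _) (@hasd_affine _ _ _)).
have cG : cts (fun s : R => (b - a) * f (a + s * (b - a))) by ctst.
by rewrite (Rintegral_prim ltr01 cG dG) /G; congr (F _ - F _); ring.
Qed.

Lemma rintE f a b : a < b -> cts f ->
  rint a b f = \int[mu]_(s in `[a, b]) f s.
Proof.
move=> ab cf; have [F dF] := exists_prim cf.
by rewrite (rint_prim _ _ cf dF) (Rintegral_prim ab cf dF).
Qed.

Lemma rint_chasles f a b c : cts f -> rint a b f + rint b c f = rint a c f.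
Proof.
by move=> cf; have [F dF] := exists_prim cf; rewrite !(rint_prim _ _ cf dF); ring.
Qed.

Lemma rint_xx f a : rint a a f = 0.
Proof. by rewrite /rint subrr mul0r. Qed.

Lemma hasd_rint f a y : cts f -> hasd (fun y => rint a y f) y (f y).
Proof.
move=> cf; have [F dF] := exists_prim cf.
rewrite (_ : (fun y => _) = fun y => F y - F a); last first.
  by apply/funext => z; rewrite (rint_prim _ _ cf dF).
by apply: hasd_eq (hasdB (dF y) (hasd_cst _ _)) _; rewrite subr0.
Qed.

Lemma eq_rint f g a b : (forall y, f y = g y) -> rint a b f = rint a b g.
Proof. by move=> /funext ->. Qed.

Lemma rintD f g a b : cts f -> cts g ->
  rint a b (fun y => f y + g y) = rint a b f + rint a b g.
Proof.
move=> cf cg; have [F dF] := exists_prim cf; have [G dG] := exists_prim cg.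
rewrite (rint_prim _ _ cf dF) (rint_prim _ _ cg dG).
rewrite (@rint_prim (fun y => F y + G y)); first by ring.
  by ctst.
by move=> y; exact: hasdD.
Qed.

Lemma rintZ f c a b : cts f -> rint a b (fun y => c * f y) = c * rint a b f.
Proof.
move=> cf; have [F dF] := exists_prim cf.
rewrite (rint_prim _ _ cf dF) (@rint_prim (fun y => c * F y)); first by ring.
  by ctst.
by move=> y; exact: hasdMl.
Qed.

Lemma rintN f a b : cts f -> rint a b (fun y => - f y) = - rint a b f.
Proof.
move=> cf; rewrite -mulN1r -rintZ//.
by apply: eq_rint => y; rewrite mulN1r.
Qed.

Lemma rintB f g a b : cts f -> cts g ->
  rint a b (fun y => f y - g y) = rint a b f - rint a b g.
Proof.
move=> cf cg; rewrite rintD ?rintN//; ctst.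
Qed.

Lemma rint_cst c a b : rint a b (fun=> c) = c * (b - a).
Proof.
rewrite (@rint_prim (fun y => c * y)); first by ring.
  by ctst.
by move=> y; apply: hasd_eq (hasdMl c (hasd_id y)) _; rewrite mulr1.
Qed.

Lemma le_rint f g a b : a <= b -> cts f -> cts g ->
  (forall y, a <= y <= b -> f y <= g y) -> rint a b f <= rint a b g.
Proof.
rewrite le_eqVlt => /predU1P[->|ab] cf cg fg; first by rewrite !rint_xx.
rewrite !rintE//; apply: le_Rintegral => //; exact: cont_integrable.
Qed.

Lemma rint_ge0 f a b : a <= b -> cts f ->
  (forall y, a <= y <= b -> 0 <= f y) -> 0 <= rint a b f.
Proof.
move=> ab cf f0; rewrite -(mul0r (b - a)) -rint_cst.
by apply: le_rint => //; ctst.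
Qed.

Lemma ler_norm_rint f a b : a <= b -> cts f ->
  `|rint a b f| <= rint a b (fun y => `|f y|).
Proof.
move=> ab cf.
have cn : cts (fun y => `|f y|) by ctst.
rewrite ler_norml -rintN//; apply/andP; split; apply: le_rint => //.
- by ctst.
- by move=> y _; rewrite lerNl; rewrite -normrN; exact: ler_norm.
- by move=> y _; exact: ler_norm.
Qed.

Lemma rint_parts (F f G g : R -> R) a b : cts f -> cts g ->
  (forall y, hasd F y (f y)) -> (forall y, hasd G y (g y)) ->
  rint a b (fun y => F y * g y) =
  F b * G b - F a * G a - rint a b (fun y => f y * G y).
Proof.
move=> cf cg dF dG.
have cF := hasd_cont dF; have cG := hasd_cont dG.
have c1 : cts (fun y => f y * G y).
  by ctst.
have c2 : cts (fun y => F y * g y).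
  by ctst.
have H : rint a b (fun y => f y * G y + F y * g y) = F b * G b - F a * G a.
  by apply: (@rint_prim (fun y => F y * G y)) => [|y]; [ctst|exact: hasdM].
by rewrite -H rintD//; ring.
Qed.

(** Cauchy-Schwarz, read off from the nonnegative integral of [(f - m) ^+ 2] with [m] the average of
    [f]. *)
Lemma rint_sqr_le f a b : a <= b -> cts f ->
  rint a b f ^+ 2 <= (b - a) * rint a b (fun y => f y ^+ 2).
Proof.
move=> ab cf; have [->|ab'] := eqVneq a b; first by rewrite !rint_xx expr0n mulr0.
have {ab'}ab' : 0 < b - a by rewrite subr_gt0 lt_neqAle ab' ab.
pose m := rint a b f / (b - a).
have : 0 <= rint a b (fun y => (f y + - m) ^+ 2).
  by apply: rint_ge0 => //; [ctst|move=> y _; exact: sqr_ge0].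
have -> : rint a b (fun y => (f y + - m) ^+ 2) =
    rint a b (fun y => f y ^+ 2) - m * rint a b f.
  rewrite (@eq_rint _ (fun y => f y ^+ 2 + (- (2 * m) * f y + m ^+ 2))).
    have -> : m * rint a b f = 2 * m * rint a b f - m ^+ 2 * (b - a).
      by rewrite /m; field; rewrite gt_eqF.
    by rewrite rintD ?rintD ?rint_cst ?rintZ; [ring|ctst..].
  by move=> y; ring.
by rewrite /m subr_ge0 mulrAC ler_pdivrMr// -expr2 mulrC.
Qed.

(* Uniformity in [s] of the continuity in [x], by compactness of [0, 1]. *)
Lemma unif_cts (X : topologicalType) (g : X -> R -> R) x (e : R) :
  cts (fun p : X * R => g p.1 p.2) -> 0 < e ->
  \forall x' \near x, forall s, 0 <= s <= 1 -> `|g x' s - g x s| < e.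
Proof.
move=> cg e0.
have /compact_near_coveringP K : compact (`[0, 1] : set R) by exact: segment_compact.
have := K X (nbhs x) (fun x' s => `|g x' s - g x s| < e) _ _.
move=> /(_ _)H; apply: filterS (H _) => [x' Hx' s /= s01|s _].
  by apply: Hx' => /=; rewrite in_itv.
have cx := @cts_slice _ _ _ x cg.
have e2 : 0 < e / 2 by rewrite divr_gt0.
have /cvgrPdist_lt/(_ _ e2)H1 := cg (x, s).
have /cvgrPdist_lt/(_ _ e2)H2 := cx s.
have : \forall z \near (s, x), `|g z.2 z.1 - g x z.1| < e.
  near=> z.
  have h1 : `|g x s - g z.2 z.1| < e / 2.
    near: z; case: H1 => -[A B] /= [nA nB] AB.
    by exists (B, A) => //= z [zB zA]; exact: (AB (z.2, z.1)).
  have h2 : `|g x s - g x z.1| < e / 2.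
    near: z; exists ([set r | `|g x s - g x r| < e / 2], setT) => //=.
      by split=> //; exact: filterT.
    by move=> z [].
  rewrite (_ : _ - _ = (g x s - g x z.1) - (g x s - g z.2 z.1)); last by ring.
  by rewrite (le_lt_trans (ler_normB _ _))// (splitr e) ltrD.
by case=> -[A B] /= [nA nB] AB; exists (A, B) => //= -[r y] [/= rA yB]; exact: (AB (r, y)).
Unshelve. all: by end_near. Qed.

Lemma cts_rint01 (X : topologicalType) (g : X -> R -> R) :
  cts (fun p : X * R => g p.1 p.2) -> cts (fun x => rint 0 1 (g x)).
Proof.
move=> cg x; apply/cvgrPdist_le => e e0.
have cx y := @cts_slice _ _ _ y cg.
near=> y.
have Hy : forall s, 0 <= s <= 1 -> `|g y s - g x s| < e.
  by near: y; exact: unif_cts.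
have cxx := cx x; have cy := cx y.
rewrite -rintB//; apply: le_trans (ler_norm_rint _ _) _ => //; first by ctst.
rewrite -[leRHS]mulr1 -[X in e * X]subr0 -(rint_cst e 0 1).
apply: le_rint => //; [by ctst|by ctst|move=> s s01].
by rewrite distrC ltW// Hy.
Unshelve. all: by end_near. Qed.

Lemma rint01E f a b : cts f ->
  rint a b f = (b - a) * rint 0 1 (fun s => f (a + s * (b - a))).
Proof.
move=> cf; rewrite {1}/rint rintE//.
by ctst.
Qed.

(** Rescaling to [[0, 1]] moves the endpoints into the integrand, which reduces the claim to fixed
    endpoints. *)
Lemma cts_rint (X : topologicalType) (g : X -> R -> R) (a b : X -> R) :
  cts a -> cts b -> cts (fun p : X * R => g p.1 p.2) ->
  cts (fun x => rint (a x) (b x) (g x)).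
Proof.
move=> ca cb cg.
have cx y := @cts_slice _ _ _ y cg.
rewrite (_ : (fun x => _) = fun x => (b x - a x) *
    rint 0 1 (fun s => g x (a x + s * (b x - a x)))); last first.
  by apply/funext => x; exact: rint01E.
apply: ctsM; first by ctst.
apply: (@cts_rint01 _ (fun x s => g x (a x + s * (b x - a x)))).
have ca1 : cts (fun p : X * R => a p.1) by exact: (cts_fst_comp ca).
have cb1 : cts (fun p : X * R => b p.1) by exact: (cts_fst_comp cb).
have c2 : cts (fun p : X * R => a p.1 + p.2 * (b p.1 - a p.1)) by ctst.
apply: (@cts_uncurry _ _ _ g fst _ cg _ c2).
by case=> x s; exact: cvg_fst.
Qed.

Lemma hasd_mvt F f x y : (forall z, hasd F z (f z)) ->
  exists2 t : R, 0 < t < 1 & F y - F x = f (x + t * (y - x)) * (y - x).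
Proof.
move=> dF; have cF := hasd_cont dF.
pose G s := F (x + s * (y - x)).
have dG (s : R) : s \in `]0, 1[ -> is_derive s 1 G (f (x + s * (y - x)) * (y - x)).
  by move=> _; exact: (hasd_comp (dF _) (@hasd_affine _ _ _)).
have [|t t01 H] := MVT ltr01 dG.
  by apply: continuous_subspaceT; rewrite -/(cts G) /G; ctst.
exists t; first by move: t01; rewrite in_itv/= .
move: H; rewrite /G mul1r mul0r addr0 subr0 mulr1 => <-.
by congr (F _ - F _); ring.
Qed.

(** By the mean value theorem the difference quotient is a value of [f] at an intermediate
    parameter; [unif_cts] makes it close to [f t] uniformly over the interval of integration. *)
Lemma hasd_rint_param (F f : R -> R -> R) a b t : cts2 F -> cts2 f ->
  (forall t y, hasd (F ^~ y) t (f t y)) ->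
  hasd (fun t => rint a b (F t)) t (rint a b (f t)).
Proof.
move=> cF cf dF.
have ca1 : cts (fun p : R * R => f p.1 (a + p.2 * (b - a))) by ctst.
suff H : (fun h : R => h^-1 *: (rint a b (F (h *: 1 + t)) - rint a b (F t)))
    @ 0^' --> rint a b (f t).
  split; first by apply/cvg_ex; exists (rint a b (f t)).
  exact: cvg_lim H.
apply/cvgrPdist_le => e e0.
pose e1 := e / (`|b - a| + 1).
have e10 : 0 < e1 by rewrite divr_gt0// ltr_wpDl.
have [d /= d0 Hd] := @unif_cts _ (fun x s => f x (a + s * (b - a))) t e1 ca1 e10.
exists d => //= h; rewrite /ball_ /= sub0r normrN => hd h0.
rewrite /GRing.scale /= mulr1.
have cFt x : cts (F x) by ctst.
have cft x : cts (f x) by ctst.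
have E : h^-1 * (rint a b (F (h + t)) - rint a b (F t)) - rint a b (f t) =
    (b - a) * rint 0 1 (fun s => h^-1 * (F (h + t) (a + s * (b - a)) -
        F t (a + s * (b - a))) - f t (a + s * (b - a))).
  rewrite (rint01E _ _ (cFt _)) (rint01E _ _ (cFt t)) (rint01E _ _ (cft _)).
  by rewrite rintB ?rintZ ?rintB; [ring|ctst..].
rewrite distrC E normrM.
have -> : e = (`|b - a| + 1) * e1 by rewrite /e1; field; rewrite gt_eqF// ltr_wpDl.
rewrite ler_pM//; first by rewrite lerDl.
apply: le_trans (ler_norm_rint _ _) _ => //; first by ctst.
rewrite -[leRHS]mulr1 -[X in e1 * X]subr0 -(rint_cst e1 0 1).
apply: le_rint => //; [by ctst|by ctst|move=> s s01].
have [u u01 ->] := hasd_mvt t (h + t) (dF ^~ (a + s * (b - a))).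
rewrite addrK mulrCA mulVf// mulr1 ltW//.
apply: Hd => //=; rewrite /ball/= opprD addrA subrr sub0r normrN normrM.
case/andP: u01 => /ltW u0 /ltW u1; rewrite ger0_norm//.
by apply: le_lt_trans hd; rewrite ler_piMl.
Qed.

(** Both sides, as functions of the upper endpoint [z] of the first interval, have the same
    derivative, and both vanish at [z = a]. No measure theory on the product is involved. *)
Lemma rint_swap (f : R -> R -> R) a b c d : cts2 f ->
  rint a b (fun x => rint c d (f x)) = rint c d (fun y => rint a b (f ^~ y)).
Proof.
move=> cf.
pose G z := rint a z (fun x => rint c d (f x)) -
  rint c d (fun y => rint a z (f ^~ y)).
have c1 : cts (fun x => rint c d (f x)) by apply: cts_rint; ctst.
have dG z : hasd G z ((fun=> 0) z).
  apply: hasd_eq (hasdB (hasd_rint a z c1) _) _; last exact: subrr.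
  apply: (@hasd_rint_param (fun z y => rint a z (f ^~ y)) f).
  - apply: (@cts_rint _ (fun p x => f x p.2)); [by ctst|by ctst|].
    rewrite (_ : (fun p => _) = fun p : (R * R) * R => f p.2 p.1.2)//.
    by ctst.
  - by ctst.
  - by move=> t y; apply: hasd_rint; ctst.
have [t _] := hasd_mvt a b dG; rewrite mul0r => /eqP; rewrite subr_eq0 => /eqP.
rewrite /G rint_xx (@eq_rint (fun y => rint a a (f ^~ y)) (fun=> 0)) => [|y]; last exact: rint_xx.
by rewrite rint_cst mul0r subrr => /eqP; rewrite subr_eq0 => /eqP.
Qed.

(** For a primitive [F], the function [F (z + 1) - F z] has derivative zero. *)
Lemma periodic_rint_shift f c : cts f -> one_periodic f ->
  rint 0 1 (fun x => f (x + c)) = rint 0 1 f.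
Proof.
move=> cf pf; have [F dF] := exists_prim cf.
have dG z : hasd (fun z => F (z + 1) - F z) z ((fun=> 0) z).
  apply: hasd_eq (hasdB (hasd_comp (dF _) (hasdD (hasd_id z) (hasd_cst 1 z))) (dF z)) _.
  by rewrite pf; ring.
rewrite (@rint_prim (fun x => F (x + c))) ?(rint_prim _ _ cf dF)//.
- have [t _] := hasd_mvt 0 c dG; rewrite mul0r add0r => /eqP.
  by rewrite subr_eq0 !add0r (addrC 1 c) => /eqP.
- by ctst.
- move=> y; apply: hasd_eq (hasd_comp (dF _) (hasdD (hasd_id y) (hasd_cst c y))) _.
  by ring.
Qed.

Lemma periodic_rint_deriv F f : cts f -> (forall y, hasd F y (f y)) ->
  one_periodic F -> rint 0 1 f = 0.
Proof. by move=> cf dF pF; rewrite (rint_prim _ _ cf dF) -{1}(add0r 1) pF subrr. Qed.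

End Calculus.

Global Opaque rint.

(** The same tactic, now also entering [rint] by [cts_rint], hence iterated integrals with varying
    endpoints. *)
Ltac ctst ::= repeat
  lazymatch goal with
  | |- forall _, _ => intro
  | |- cts2 ?F => first [ match goal with
      H : cts2 ?G |- _ => constr_eq F G; exact H end | rewrite /cts2 ]
  | |- cts3 ?F => first [ match goal with
      H : cts3 ?G |- _ => constr_eq F G; exact H end | rewrite /cts3 ]
  | |- cts (fun _ => ?c) => apply: cts_cst
  | |- cts (fun x => x) => apply: cts_id
  | |- cts snd => apply: (@cts_snd_comp _ _ _ (fun x => x))
  | |- cts fst => apply: (@cts_fst_comp _ _ _ (fun x => x))
  | |- cts (fun p => p.1) => apply: (@cts_fst_comp _ _ _ (fun x => x))
  | |- cts (fun p => p.2) => apply: (@cts_snd_comp _ _ _ (fun x => x))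
  | |- cts (fun p => p.1.1) => apply: (@cts_fst_comp _ _ _ (fun x => x.1))
  | |- cts (fun p => p.1.2) => apply: (@cts_fst_comp _ _ _ (fun x => x.2))
  | |- cts (fun p => p.1.1.1) => apply: (@cts_fst_comp _ _ _ (fun x => x.1.1))
  | |- cts (fun p => p.1.1.2) => apply: (@cts_fst_comp _ _ _ (fun x => x.1.2))
  | |- cts (fun p => p.1.1.1.1) => apply: (@cts_fst_comp _ _ _ (fun x => x.1.1.1))
  | |- cts (fun p => p.1.1.1.2) => apply: (@cts_fst_comp _ _ _ (fun x => x.1.1.2))
  | |- cts (Algebra.add ?a) => change (cts (fun z => a + z))
  | |- cts (GRing.mul ?a) => change (cts (fun z => a * z))
  | |- cts Algebra.opp => change (cts (fun z => - z))
  | |- cts (fun x => - _) => apply: ctsN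
  | |- cts (fun x => _ * _) => apply: ctsM
  | |- cts (fun x => _ + _) => apply: ctsD
  | |- cts (fun x => _ ^+ _) => apply: ctsX
  | |- cts (fun x => rint _ _ _) => apply: cts_rint; cbv beta
  | |- cts (fun x => `|_|) => apply: cts_norm
  | |- cts ?F => match goal with
    | H : cts ?G |- _ => constr_eq F G; exact H
    | H : cts3 ?G |- cts (fun x => ?F _ _ _) => constr_eq F G; apply: (cts_comp3 H)
    | H : cts2 ?G |- cts (fun x => ?F _ _) => constr_eq F G; apply: (cts_comp2 H)
    | H : cts ?G |- cts (fun x => ?F _) => constr_eq F G; apply: (cts_comp1 H)
    | H : cts3 ?G |- cts (?F ?a ?b) => constr_eq F G; change (cts (fun z => F a b z))
    | H : cts2 ?G |- cts (?F _) => constr_eq F G; apply: (cts_partial1 _ H)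
    end
  end.

(** * Integrals over one period in x and an interval in t *)

Section TwoD.
Context {R : realType}.
Implicit Types F G f g : R -> R -> R.

Definition int2 (t0 t1 : R) f := rint t0 t1 (fun t => rint 0 1 (f ^~ t)).

Definition periodic2 f := forall x t, f (x + 1) t = f x t.

Variables (t0 t1 : R).
Hypothesis t01 : t0 <= t1.
Notation S2 := (int2 t0 t1).

Lemma eq_int2 f g : (forall x t, f x t = g x t) -> S2 f = S2 g.
Proof. by move=> fg; congr int2; apply/funext => x; apply/funext => t. Qed.

Lemma int2D f g : cts2 f -> cts2 g -> S2 (fun x t => f x t + g x t) = S2 f + S2 g.
Proof.
move=> cf cg; rewrite /int2 -rintD; [|ctst..].
by apply: eq_rint => t; rewrite rintD//; ctst.
Qed.

Lemma int2Z c f : cts2 f -> S2 (fun x t => c * f x t) = c * S2 f.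
Proof.
move=> cf; rewrite /int2 -rintZ; [|ctst..].
by apply: eq_rint => t; rewrite rintZ//; ctst.
Qed.

Lemma le_int2 f g : cts2 f -> cts2 g ->
  (forall x t, t0 <= t <= t1 -> f x t <= g x t) -> S2 f <= S2 g.
Proof.
move=> cf cg fg; apply: le_rint => //; [ctst..|move=> t tt].
by apply: le_rint => //; [ctst..|move=> x _; exact: fg].
Qed.

Lemma int2_ge0 f : cts2 f ->
  (forall x t, t0 <= t <= t1 -> 0 <= f x t) -> 0 <= S2 f.
Proof.
move=> cf f0; apply: rint_ge0 => //; [ctst..|move=> t tt].
by apply: rint_ge0 => //; [ctst..|move=> x _; exact: f0].
Qed.

Lemma int2_swap f : cts2 f -> S2 f = rint 0 1 (fun x => rint t0 t1 (f x)).
Proof.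
by move=> cf; rewrite /int2 (@rint_swap _ (fun t x => f x t))//; ctst.
Qed.

Lemma int2_shift f c : cts2 f -> periodic2 f -> S2 (fun x t => f (x + c) t) = S2 f.
Proof.
move=> cf pf; apply: eq_rint => t.
by apply: (@periodic_rint_shift _ (f ^~ t)); [ctst|move=> x; exact: pf].
Qed.

Lemma int2_dx F f (w : R -> R) : cts2 f -> (forall x t, hasd (F ^~ t) x (f x t)) ->
  periodic2 F -> S2 (fun x t => w t * f x t) = 0.
Proof.
move=> cf dF pF; rewrite /int2 (@eq_rint _ _ (fun=> 0)) ?rint_cst ?mul0r// => t.
rewrite rintZ; last by ctst.
rewrite (@periodic_rint_deriv _ (F ^~ t)) ?mulr0//; ctst.
Qed.

Lemma int2_dt F f (w w' : R -> R) : cts2 f -> cts w' -> (forall x t, hasd (F x) t (f x t)) ->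
  (forall t, hasd w t (w' t)) -> cts2 F -> w t0 = 0 -> w t1 = 0 ->
  S2 (fun x t => w t * f x t) = - S2 (fun x t => w' t * F x t).
Proof.
move=> cf cw dF dw cF w0 w1; have cw0 : cts w := hasd_cont dw.
rewrite !int2_swap; [|ctst..].
rewrite -rintN; last by ctst.
apply: eq_rint => x; rewrite (@rint_parts _ w w' (F x) (f x))//; [|ctst..].
by rewrite w0 w1; ring.
Qed.

Lemma int2_sqrB_le f c : cts2 f -> periodic2 f ->
  S2 (fun x t => (f (x + c) t - f x t) ^+ 2) <= 4 * S2 (fun x t => f x t ^+ 2).
Proof.
move=> cf pf.
have -> : 4 * S2 (fun x t => f x t ^+ 2) =
    S2 (fun x t => 2 * f (x + c) t ^+ 2 + 2 * f x t ^+ 2).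
  rewrite int2D ?int2Z; [|ctst..].
  rewrite (@int2_shift (fun x t => f x t ^+ 2)); [ring|ctst|].
  by move=> x t; rewrite pf.
apply: le_int2; [ctst..|move=> x t _].
rewrite -subr_ge0.
suff -> : 2 * f (x + c) t ^+ 2 + 2 * f x t ^+ 2 - (f (x + c) t - f x t) ^+ 2 =
  (f (x + c) t + f x t) ^+ 2 by exact: sqr_ge0.
by ring.
Qed.

Lemma rint_window (f : R -> R) x r :
  cts f -> rint x (x + r) f = rint 0 r (fun z => f (x + z)).
Proof.
move=> cf; rewrite rint01E// [RHS]rint01E; last by ctst.
rewrite subr0 addrAC subrr add0r; congr (_ * _); by apply: eq_rint => z; rewrite add0r.
Qed.

(** Cauchy-Schwarz on the window gives one factor [r]; exchanging integrals and shifting by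
    periodicity gives the other. *)
Lemma int2_window_sqr_le f r : 0 <= r -> cts2 f -> periodic2 f ->
  S2 (fun x t => rint x (x + r) (f ^~ t) ^+ 2) <= r ^+ 2 * S2 (fun x t => f x t ^+ 2).
Proof.
move=> r0 cf pf.
apply: (@le_trans _ _ (S2 (fun x t => r * rint x (x + r) (fun z => f z t ^+ 2)))).
  apply: le_int2; [ctst..|move=> x t _].
  have -> : r * rint x (x + r) (fun z => f z t ^+ 2) =
    (x + r - x) * rint x (x + r) (fun z => f z t ^+ 2) by congr (_ * _); ring.
  by apply: rint_sqr_le; [rewrite lerDl|ctst].
rewrite int2Z; last by ctst.
rewrite expr2 -mulrA ler_wpM2l//.
rewrite /int2 -rintZ; last by ctst.
rewrite le_eqVlt; apply/orP; left; apply/eqP; apply: eq_rint => t.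
have cft : cts (fun x => f x t ^+ 2) by ctst.
under eq_rint do rewrite rint_window//.
rewrite (@rint_swap _ (fun x z => f (x + z) t ^+ 2)); last by ctst.
under eq_rint do rewrite (periodic_rint_shift _ cft (fun y => congr1 (fun z => z ^+ 2) (pf y t))).
by rewrite rint_cst; ring.
Qed.

End TwoD.

(** * Coupled transport equations *)

Section Moments.
Context {R : realType}.
Variables (t0 t1 : R).
Hypothesis t01 : t0 < t1.
Notation S2 := (int2 t0 t1).
Let tau := t1 - t0.

(** The time cutoff. It vanishes at [t0] and [t1], so that integrating by parts in [t] leaves no
    boundary term; its integral is [tau / 6], which matters when the cutoff is removed. *)
Definition bump (t : R) := (t - t0) * (t1 - t) / tau ^+ 2.
Definition bump' (t : R) := (t0 + t1 - 2 * t) / tau ^+ 2.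

Let tau0 : 0 < tau. Proof. by rewrite subr_gt0. Qed.

Lemma hasd_bump t : hasd bump t (bump' t).
Proof.
apply: hasd_eq (hasdM (hasdM (hasdB (hasd_id t) (hasd_cst t0 t))
  (hasdB (hasd_cst t1 t) (hasd_id t))) (hasd_cst _ t)) _.
by rewrite /bump'; ring.
Qed.

Lemma cts_bump' : cts bump'.
Proof. by rewrite /bump'; ctst. Qed.

Lemma cts_bump : cts bump.
Proof. exact: hasd_cont hasd_bump. Qed.

Lemma bump_itv t : t0 <= t <= t1 -> 0 <= bump t <= 1.
Proof.
move=> /andP[h0 h1]; rewrite /bump ler_pdivrMr ?exprn_gt0// mul1r.
apply/andP; split; first by rewrite divr_ge0 ?exprn_ge0 ?mulr_ge0 ?subr_ge0// ltW.
by rewrite expr2 ler_pM ?subr_ge0//; rewrite /tau; lra.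
Qed.

Lemma bump'_itv t : t0 <= t <= t1 -> `|bump' t| <= tau^-1.
Proof.
move=> /andP[h0 h1]; rewrite /bump' normrM normfV (ger0_norm (sqr_ge0 _)).
rewrite ler_pdivrMr ?exprn_gt0// expr2 mulKf ?gt_eqF//.
by rewrite ler_norml /tau; apply/andP; split; lra.
Qed.

Variables (U Ux Ut P Px Pt E Ex g0 g1 : R -> R -> R).
Hypotheses (cU : cts2 U) (cUx : cts2 Ux) (cUt : cts2 Ut) (cP : cts2 P)
  (cPx : cts2 Px) (cPt : cts2 Pt) (cE : cts2 E) (cEx : cts2 Ex)
  (cg0 : cts2 g0) (cg1 : cts2 g1).
Hypotheses (pU : periodic2 U) (pP : periodic2 P) (pE : periodic2 E)
  (pg0 : periodic2 g0) (pg1 : periodic2 g1).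
Hypotheses (dUx : forall x t, hasd (U ^~ t) x (Ux x t))
  (dUt : forall x t, hasd (U x) t (Ut x t))
  (dPx : forall x t, hasd (P ^~ t) x (Px x t))
  (dPt : forall x t, hasd (P x) t (Pt x t))
  (dEx : forall x t, hasd (E ^~ t) x (Ex x t)).
Variables (bb beta r : R).
Hypotheses (eqnU : forall x t, Ut x t + bb * Ux x t + Px x t = g0 x t)
  (eqnP : forall x t, Pt x t + bb * Px x t + beta * Ux x t + Ex x t = g1 x t).

Let q x t := U (x + r) t - U x t.
Let Pi x t := rint x (x + r) (P ^~ t).
Let N1 x t := rint x (x + r) (g1 ^~ t).
Let DP x t := P (x + r) t - P x t.
Let DE x t := E (x + r) t - E x t.
Let Dg x t := g0 (x + r) t - g0 x t.

Let cq : cts2 q. Proof. by rewrite /q; ctst. Qed.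
Let cPi : cts2 Pi. Proof. by rewrite /Pi; ctst. Qed.
Let cN1 : cts2 N1. Proof. by rewrite /N1; ctst. Qed.
Let cDP : cts2 DP. Proof. by rewrite /DP; ctst. Qed.
Let cDE : cts2 DE. Proof. by rewrite /DE; ctst. Qed.
Let cDg : cts2 Dg. Proof. by rewrite /Dg; ctst. Qed.

Lemma hasd_shift (F : R -> R) d c x : hasd F (x + c) d -> hasd (fun y => F (y + c)) x d.
Proof.
move=> dF; have := @hasd_comp _ F (fun y => y + c) x d _ dF (hasdD (hasd_id x) (hasd_cst c x)).
by rewrite addr0 mulr1.
Qed.

Lemma hasd_window (f : R -> R) c x : cts f ->
  hasd (fun x => rint x (x + c) f) x (f (x + c) - f x).
Proof.
move=> cf; have [F dF] := exists_prim cf.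
rewrite (_ : (fun x => _) = fun x => F (x + c) - F x); last first.
  by apply/funext => y; rewrite (rint_prim _ _ cf dF).
exact: hasdB (hasd_shift (dF _)) (dF x).
Qed.

Let dqx x t : hasd (q ^~ t) x (Ux (x + r) t - Ux x t).
Proof. exact: hasdB (hasd_shift (@dUx _ t)) (dUx x t). Qed.

Let dqt x t : hasd (q x) t (Ut (x + r) t - Ut x t).
Proof. exact: hasdB. Qed.

Let dDPx x t : hasd (DP ^~ t) x (Px (x + r) t - Px x t).
Proof. exact: hasdB (hasd_shift (@dPx _ t)) (dPx x t). Qed.

Let dPix x t : hasd (Pi ^~ t) x (DP x t).
Proof. by apply: hasd_window; ctst. Qed.

(** The reason for the window: integrating [eqnP] over [[x, x + r]] turns the derivatives in [x]
    into increments, and [beta * Ux] into [beta * q]. *)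
Let dPit x t : hasd (Pi x) t (N1 x t - bb * DP x t - beta * q x t - DE x t).
Proof.
have H := @hasd_rint_param _ (fun t z => P z t) (fun t z => Pt z t) x (x + r) t.
apply: (@hasd_eq _ (Pi x) t (rint x (x + r) (Pt ^~ t))).
  by apply: H; [ctst..|move=> ? ?; exact: dPt].
transitivity (rint x (x + r)
  (fun z => g1 z t - (bb * Px z t + (beta * Ux z t + Ex z t)))).
  by apply: eq_rint => z; rewrite -eqnP; ring.
rewrite rintB ?rintD ?rintZ; [|ctst..].
rewrite (@rint_prim _ (P ^~ t) (Px ^~ t)) ?(@rint_prim _ (U ^~ t) (Ux ^~ t))
  ?(@rint_prim _ (E ^~ t) (Ex ^~ t)) /N1 /DP /q /DE//; [ring|ctst..].
Qed.

(** The time derivative of [Pi * q] is completed by [bb] times the [x]-derivative of [Pi * q] and by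
    the [x]-derivative of [Pi * DP], both of integral zero. The factor of [Pi] then becomes the left
    side of the increment of [eqnU], that is [Dg]; the cost is [DP ^+ 2]. *)
Lemma moment_identity : S2 (fun x t => bump t * (beta * q x t ^+ 2)) =
  S2 (fun x t => bump t * (DP x t ^+ 2 - q x t * DE x t + q x t * N1 x t
     + Pi x t * Dg x t)) + S2 (fun x t => bump' t * (Pi x t * q x t)).
Proof.
have cb := cts_bump; have cb' := cts_bump'.
have pq : periodic2 q by move=> x t; rewrite /q addrAC !pU.
have pDP : periodic2 DP by move=> x t; rewrite /DP addrAC !pP.
have pPi : periodic2 Pi.
  move=> x t; rewrite /Pi !rint_window; [|ctst..].
  by apply: eq_rint => z; rewrite addrAC pP.
pose Ft x t := (N1 x t - bb * DP x t - beta * q x t - DE x t) * q x t +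
  Pi x t * (Ut (x + r) t - Ut x t).
pose Fx x t := DP x t * q x t + Pi x t * (Ux (x + r) t - Ux x t).
pose Gx x t := DP x t * DP x t + Pi x t * (Px (x + r) t - Px x t).
have cFt : cts2 Ft by rewrite /Ft; ctst.
have cFx : cts2 Fx by rewrite /Fx; ctst.
have cGx : cts2 Gx by rewrite /Gx; ctst.
have e1 : S2 (fun x t => bump t * Ft x t) = - S2 (fun x t => bump' t * (Pi x t * q x t)).
  apply: int2_dt => //.
  - by move=> x t; exact: hasdM.
  - exact: hasd_bump.
  - by ctst.
  - by rewrite /bump subrr !mul0r.
  - by rewrite /bump subrr mulr0 mul0r.
have e2 : S2 (fun x t => bump t * Fx x t) = 0.
  apply: (@int2_dx _ _ _ (fun x t => Pi x t * q x t)) => //.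
    by move=> x t; exact: hasdM.
  by move=> x t; rewrite pq pPi.
have e3 : S2 (fun x t => bump t * Gx x t) = 0.
  apply: (@int2_dx _ _ _ (fun x t => Pi x t * DP x t)) => //.
    by move=> x t; exact: hasdM.
  by move=> x t; rewrite pDP pPi.
have e4 : S2 (fun x t => bump t * Ft x t + (bb * (bump t * Fx x t) + bump t * Gx x t)) =
    - S2 (fun x t => bump' t * (Pi x t * q x t)).
  by rewrite int2D ?int2D ?int2Z ?e1 ?e2 ?e3; [ring|ctst..].
rewrite -[X in _ + X]opprK -e4.
apply/eqP; rewrite eq_sym subr_eq -int2D; [|ctst..].
apply/eqP/eq_int2 => x t; rewrite /Ft /Fx /Gx /Dg -!eqnU /q /DP; ring.
Qed.

(** Young's inequality on each term of [moment_identity]. Every term scales like [a ^+ 2], which is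
    divided out at the end, so the final constants depend on [c] and [eta] only. *)
Lemma moment_estimate (a c eta K h : R) : 0 < a -> 0 < c -> 0 < eta -> 0 < r ->
  r <= tau * a -> c * a ^+ 2 <= beta ->
  S2 (fun x t => P x t ^+ 2) <= a ^+ 2 * K ->
  S2 (fun x t => E x t ^+ 2) <= a ^+ 4 * K ->
  S2 (fun x t => g0 x t ^+ 2) <= h ->
  S2 (fun x t => g1 x t ^+ 2) <= a ^+ 2 * h -> 0 <= K -> 0 <= h ->
  c / 2 * S2 (fun x t => bump t * q x t ^+ 2) <=
    eta * S2 (fun x t => q x t ^+ 2) + (5 + 4 / c + (4 * eta)^-1) * K +
    (c^-1 + 2) * tau ^+ 2 * h.
Proof.
move=> a0 c0 eta0 r0 rta cb HP HE H0 H1 K0 h0.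
have cbp := cts_bump; have cbp' := cts_bump'.
pose e1 := (c * a ^+ 2)^-1.
have ca0 : 0 < c * a ^+ 2 by rewrite mulr_gt0 ?exprn_gt0.
have e1_ge0 : 0 <= e1 by rewrite invr_ge0 ltW.
pose e2 := (4 * eta * a ^+ 2 * tau ^+ 2)^-1.
have e2d : 0 < 4 * eta * a ^+ 2 * tau ^+ 2 by rewrite !mulr_gt0 ?exprn_gt0.
have e2_ge0 : 0 <= e2 by rewrite invr_ge0 ltW.
have r2_ge0 : 0 <= (2 * r ^+ 2)^-1 by rewrite invr_ge0 mulr_ge0// exprn_ge0// ltW.
have ea_ge0 : 0 <= (4 * eta * a ^+ 2)^-1.
  by rewrite invr_ge0 !mulr_ge0// ?exprn_ge0// ltW.
have bnd : S2 (fun x t => bump t * (beta * q x t ^+ 2)) <=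
  S2 (fun x t => (c * a ^+ 2 / 2) * (bump t * q x t ^+ 2) + (DP x t ^+ 2 +
    (e1 * DE x t ^+ 2 + (e1 * N1 x t ^+ 2 + ((2 * r ^+ 2)^-1 * Pi x t ^+ 2 +
    (r ^+ 2 / 2 * Dg x t ^+ 2 + (eta * a ^+ 2 * q x t ^+ 2 +
    e2 * Pi x t ^+ 2))))))).
  rewrite moment_identity -int2D; [|ctst..].
  apply: le_int2; [exact: ltW|ctst..|move=> x t tt].
  have /andP[b0 b1] := bump_itv tt.
  have b' := bump'_itv tt.
  move: (bump t) (bump' t) (q x t) (DP x t) (DE x t) (N1 x t) (Pi x t) (Dg x t) b0 b1 b'.
  move=> w w' Q p e n1 pi dg w0 w1 w'1.
  (* Used for [DE] and for [N1]: each takes a quarter of [c * a ^+ 2], so half of the left side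
     survives. *)
  have young z : w * (Q * z) <= w * (c * a ^+ 2 / 4 * Q ^+ 2) + e1 * z ^+ 2.
    apply: (@le_trans _ _ (w * (c * a ^+ 2 / 4 * Q ^+ 2 + e1 * z ^+ 2))).
      apply: ler_wpM2l => //; rewrite -subr_ge0.
      rewrite (_ : _ - _ = (c * a ^+ 2 / 2 * Q - z) ^+ 2 * e1).
        by rewrite mulr_ge0 ?sqr_ge0.
      by rewrite /e1; field; rewrite !gt_eqF.
    by rewrite mulrDr lerD2l ler_piMl// mulr_ge0 ?sqr_ge0.
  have y1 := young (- e); have y2 := young n1; rewrite sqrrN in y1.
  (* The weights compensate for [Pi] being of the size of [r] times [P]. *)
  have y3 : w * (pi * dg) <= (2 * r ^+ 2)^-1 * pi ^+ 2 + r ^+ 2 / 2 * dg ^+ 2.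
    have half z : pi * z <= (2 * r ^+ 2)^-1 * pi ^+ 2 + r ^+ 2 / 2 * z ^+ 2.
      rewrite -subr_ge0.
      rewrite (_ : _ - _ = (pi - r ^+ 2 * z) ^+ 2 * (2 * r ^+ 2)^-1).
        by rewrite mulr_ge0 ?sqr_ge0.
      by field; rewrite gt_eqF.
    apply: (@le_trans _ _ `|pi * dg|).
      apply: le_trans (ler_norm _) _; rewrite normrM (ger0_norm w0).
      by rewrite ler_piMl.
    rewrite ler_norml half andbT lerNl -mulrN -[dg ^+ 2]sqrrN; exact: half.
  (* [bump'] is not dominated by [bump], since it does not vanish at the ends. This term therefore
     costs [q ^+ 2] without the cutoff, with the small factor [eta]. *)
  have y4 : w' * (pi * Q) <= eta * a ^+ 2 * Q ^+ 2 + e2 * pi ^+ 2.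
    apply: (@le_trans _ _ (eta * a ^+ 2 * Q ^+ 2 +
        w' ^+ 2 * (4 * eta * a ^+ 2)^-1 * pi ^+ 2)).
      rewrite -subr_ge0.
      rewrite (_ : _ - _ = (2 * eta * a ^+ 2 * Q - w' * pi) ^+ 2 * (4 * eta * a ^+ 2)^-1).
        by rewrite mulr_ge0 ?sqr_ge0.
      by field; rewrite !gt_eqF.
    rewrite lerD2l ler_wpM2r ?sqr_ge0//.
    have -> : e2 = (tau ^-1) ^+ 2 * (4 * eta * a ^+ 2)^-1.
      by rewrite /e2; field; rewrite !gt_eqF.
    rewrite ler_wpM2r//.
    by rewrite -[leLHS]real_normK ?num_real// ler_sqr ?nnegrE// invr_ge0 ltW.
  have y5 : w * p ^+ 2 <= p ^+ 2 by rewrite ler_piMl ?sqr_ge0.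
  have -> : w * (p ^+ 2 - Q * e + Q * n1 + pi * dg) + w' * (pi * Q) =
    w * p ^+ 2 + (w * (Q * - e) + (w * (Q * n1) + (w * (pi * dg) + w' * (pi * Q)))).
    by ring.
  apply: le_trans (lerD y5 (lerD y1 (lerD y2 (lerD y3 y4)))) _.
  by rewrite le_eqVlt; apply/orP; left; apply/eqP; field; rewrite !gt_eqF.
have bnd2 : c * a ^+ 2 * S2 (fun x t => bump t * q x t ^+ 2) <=
    S2 (fun x t => bump t * (beta * q x t ^+ 2)).
  rewrite -int2Z; last by ctst.
  apply: le_int2; [exact: ltW|ctst..|move=> x t tt].
  have /andP[b0 _] := bump_itv tt.
  by rewrite mulrCA ler_wpM2l// ler_wpM2r// sqr_ge0.
move: bnd; do 7 (rewrite int2D; [|ctst..]); do !(rewrite int2Z; [|ctst..]).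
have lt01 := ltW t01.
have := int2_sqrB_le lt01 r cP pP; rewrite -/DP.
have := int2_sqrB_le lt01 r cE pE; rewrite -/DE.
have := int2_sqrB_le lt01 r cg0 pg0; rewrite -/Dg.
have := int2_window_sqr_le lt01 (ltW r0) cP pP.
have := int2_window_sqr_le lt01 (ltW r0) cg1 pg1.
move: bnd2 HP HE H0 H1.
rewrite -[S2 (fun x t => rint _ _ (g1 ^~ t) ^+ 2)]/(S2 (fun x t => N1 x t ^+ 2)).
rewrite -[S2 (fun x t => rint _ _ (P ^~ t) ^+ 2)]/(S2 (fun x t => Pi x t ^+ 2)).
rewrite -[S2 (fun x t => (P _ _ - _) ^+ 2)]/(S2 (fun x t => DP x t ^+ 2)).
rewrite -[S2 (fun x t => (E _ _ - _) ^+ 2)]/(S2 (fun x t => DE x t ^+ 2)).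
rewrite -[S2 (fun x t => (g0 _ _ - _) ^+ 2)]/(S2 (fun x t => Dg x t ^+ 2)).
move: (S2 (fun x t => bump t * q x t ^+ 2)) (S2 (fun x t => q x t ^+ 2)) => X Q.
move: (S2 (fun x t => P x t ^+ 2)) (S2 (fun x t => E x t ^+ 2)) => sP sE.
move: (S2 (fun x t => g0 x t ^+ 2)) (S2 (fun x t => g1 x t ^+ 2)) => s0 s1.
move: (S2 (fun x t => N1 x t ^+ 2)) (S2 (fun x t => Pi x t ^+ 2)) => sN sPi.
move: (S2 (fun x t => DP x t ^+ 2)) (S2 (fun x t => DE x t ^+ 2)) => sDP sDE.
move: (S2 (fun x t => Dg x t ^+ 2)) (S2 (fun x t => bump t * _)) => sDg sL.
move=> hX HP HE H0 H1 HN HPi HDg HDE HDP HL.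
(* The increment [r] can be travelled at speed [a] within the time [tau]; this makes the bounds on
   [Pi], [N1] and [Dg] independent of [r]. *)
have ra : r ^+ 2 <= tau ^+ 2 * a ^+ 2.
  by rewrite -exprMn ler_sqr ?nnegrE ?mulr_ge0// ltW.
have rg0 : 0 <= r ^+ 2 by exact: sqr_ge0.
have k1 : sDP <= 4 * (a ^+ 2 * K) by apply: le_trans HDP _; rewrite ler_wpM2l.
have k2 : e1 * sDE <= 4 / c * (a ^+ 2 * K).
  apply: (@le_trans _ _ (e1 * (4 * (a ^+ 4 * K)))).
    by rewrite ler_wpM2l// (le_trans HDE)// ler_wpM2l.
  by rewrite le_eqVlt; apply/orP; left; apply/eqP; rewrite /e1; field; rewrite !gt_eqF.
have k3 : e1 * sN <= c^-1 * (tau ^+ 2 * a ^+ 2 * h).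
  apply: (@le_trans _ _ (e1 * (r ^+ 2 * (a ^+ 2 * h)))).
    by rewrite ler_wpM2l// (le_trans HN)// ler_wpM2l.
  rewrite (_ : e1 * _ = c^-1 * (r ^+ 2 * h)); last by rewrite /e1; field; rewrite !gt_eqF.
  by rewrite ler_wpM2l ?invr_ge0 ?(ltW c0)// ler_wpM2r.
have HPi' : sPi <= r ^+ 2 * (a ^+ 2 * K) by apply: le_trans HPi _; rewrite ler_wpM2l.
have k4 : (2 * r ^+ 2)^-1 * sPi <= 1 / 2 * (a ^+ 2 * K).
  apply: (@le_trans _ _ ((2 * r ^+ 2)^-1 * (r ^+ 2 * (a ^+ 2 * K)))).
    by rewrite ler_wpM2l.
  by rewrite le_eqVlt; apply/orP; left; apply/eqP; field; rewrite !gt_eqF.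
have k5 : r ^+ 2 / 2 * sDg <= 2 * (tau ^+ 2 * a ^+ 2 * h).
  apply: (@le_trans _ _ (r ^+ 2 / 2 * (4 * h))).
    by rewrite ler_wpM2l ?divr_ge0// (le_trans HDg)// ler_wpM2l.
  rewrite (_ : _ * (4 * h) = 2 * (r ^+ 2 * h)); last by field.
  by rewrite ler_wpM2l// ler_wpM2r.
have k6 : e2 * sPi <= (4 * eta)^-1 * (a ^+ 2 * K).
  apply: (@le_trans _ _ (e2 * (tau ^+ 2 * a ^+ 2 * (a ^+ 2 * K)))).
    rewrite ler_wpM2l// (le_trans HPi')// ler_wpM2r// mulr_ge0// exprn_ge0//.
    exact: ltW.
  by rewrite le_eqVlt; apply/orP; left; apply/eqP; rewrite /e2; field; rewrite !gt_eqF.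
have a20 : 0 < a ^+ 2 by rewrite exprn_gt0.
rewrite -(ler_pM2l a20).
have k7 : 0 <= a ^+ 2 * K by rewrite mulr_ge0// ltW.
move: k7 hX HL k1 k2 k3 k4 k5 k6.
move: (c^-1) (4 / c) ((4 * eta)^-1) (e1 * sDE) (e1 * sN) (e2 * sPi) => i1 i2 i3 z1 z2 z3.
move: (_ * sPi) (_ * sDg) => z4 z5.
by move=> *; lra.
Qed.

End Moments.

(** * Averages on a cell *)

Section Cell.
Context {R : realType}.
Variables (y0 y1 : R).
Hypothesis y01 : y0 < y1.
Let del := y1 - y0.
Let del0 : 0 < del. Proof. by rewrite subr_gt0. Qed.

(** The parabola vanishing at both ends of the cell; the factor [6] gives it integral [1] (see
    [mean_cst]). *)
Definition phi (y : R) := 6 * (y - y0) * (y1 - y) / (y1 - y0) ^+ 3.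
Definition phi' (y : R) := 6 * (y0 + y1 - 2 * y) / (y1 - y0) ^+ 3.

Definition mean (f : R -> R) := rint y0 y1 (fun y => phi y * f y).

Lemma hasd_phi y : hasd phi y (phi' y).
Proof.
apply: hasd_eq (hasdM (hasdM (hasdM (hasd_cst 6 y) (hasdB (hasd_id y) (hasd_cst y0 y)))
  (hasdB (hasd_cst y1 y) (hasd_id y))) (hasd_cst _ y)) _.
by rewrite /phi'; ring.
Qed.

Lemma cts_phi' : cts phi'.
Proof. by rewrite /phi'; ctst. Qed.

Lemma cts_phi : cts phi.
Proof. exact: hasd_cont hasd_phi. Qed.

Let cphi := cts_phi.
Let cphi' := cts_phi'.

Lemma phi_itv y : y0 <= y <= y1 -> 0 <= phi y <= 3 / 2 / del.
Proof.
move=> /andP[h0 h1]; rewrite /phi; apply/andP; split.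
  by rewrite divr_ge0 ?exprn_ge0 ?(ltW del0)// !mulr_ge0// subr_ge0.
rewrite -/del ler_pdivrMr ?exprn_gt0//.
have -> : 3 / 2 / del * del ^+ 3 = 3 / 2 * (y1 - y0) ^+ 2.
  by rewrite -/del; field; rewrite gt_eqF.
rewrite -subr_ge0 (_ : _ - _ = 6 * (y - (y0 + y1) / 2) ^+ 2).
  by rewrite mulr_ge0 ?sqr_ge0.
by field.
Qed.

Lemma phi'_itv y : y0 <= y <= y1 -> `|phi' y| <= 6 / del ^+ 2.
Proof.
move=> /andP[h0 h1]; rewrite /phi' -/del.
have d3 : 0 < del ^+ 3 by rewrite exprn_gt0.
have -> : 6 / del ^+ 2 = 6 * del / del ^+ 3 by field; rewrite gt_eqF.
rewrite normrM normfV (gtr0_norm d3) ler_wpM2r ?invr_ge0 ?(ltW d3)//.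
by rewrite ler_norml /del; apply/andP; split; lra.
Qed.

Lemma meanD f g : cts f -> cts g ->
  mean (fun y => f y + g y) = mean f + mean g.
Proof.
move=> cf cg; rewrite /mean -rintD; [|ctst..].
by apply: eq_rint => y; rewrite mulrDr.
Qed.

Lemma meanZ c f : cts f -> mean (fun y => c * f y) = c * mean f.
Proof.
move=> cf; rewrite /mean -rintZ; [|ctst..].
by apply: eq_rint => y; rewrite mulrCA.
Qed.

Lemma mean_cst c : mean (fun=> c) = c.
Proof.
pose F y : R := c * (6 / del ^+ 3) * ((y - y0) ^+ 2 * (del / 2) - (y - y0) ^+ 3 / 3).
rewrite /mean (@rint_prim _ F).
- by rewrite /F subrr !expr0n/= -/del; field; rewrite gt_eqF.
- by ctst.
- move=> y; have d1 : hasd (fun y => y - y0) y 1.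
    by apply: hasd_eq (hasdB (hasd_id y) (hasd_cst y0 y)) _; rewrite subr0.
  have d2 : hasd (fun y => (y - y0) ^+ 2) y (2 * (y - y0)).
    by apply: hasd_eq (hasdM d1 d1) _; ring.
  have d3 : hasd (fun y => (y - y0) ^+ 3) y (3 * (y - y0) ^+ 2).
    by apply: hasd_eq (hasdM d1 d2) _; ring.
  apply: hasd_eq (hasdMl _ (hasdB (hasdM d2 (hasd_cst (del / 2) y))
    (hasdM d3 (hasd_cst (3^-1) y)))) _.
  rewrite /phi -/del; have -> : y1 - y = del - (y - y0) by rewrite /del; ring.
  by field; rewrite gt_eqF.
Qed.

Lemma eq_mean f g : (forall y, f y = g y) -> mean f = mean g.
Proof. by move=> /funext ->. Qed.

Lemma le_mean f g : cts f -> cts g -> (forall y, y0 <= y <= y1 -> f y <= g y) ->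
  mean f <= mean g.
Proof.
move=> cf cg fg; apply: le_rint; [exact: ltW|ctst..|move=> y yy].
by rewrite ler_wpM2l// ?fg//; case/andP: (phi_itv yy).
Qed.

Lemma mean_ge0 f : cts f -> (forall y, y0 <= y <= y1 -> 0 <= f y) -> 0 <= mean f.
Proof. by move=> cf f0; rewrite -(mean_cst 0); apply: le_mean => //; ctst. Qed.

Lemma mean_sqr_le f : cts f -> mean f ^+ 2 <= mean (fun y => f y ^+ 2).
Proof.
move=> cf; set m := mean f.
have : 0 <= mean (fun y => (f y - m) ^+ 2).
  by apply: mean_ge0; [ctst|move=> y _; exact: sqr_ge0].
rewrite (@eq_mean _ (fun y => f y ^+ 2 + (- (2 * m) * f y + m ^+ 2))).
  rewrite meanD ?meanD ?mean_cst ?meanZ; [|ctst..].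
  by rewrite -/m => h; rewrite -subr_ge0; apply: le_trans h _; rewrite le_eqVlt;
    apply/orP; left; apply/eqP; ring.
by move=> y; ring.
Qed.

Lemma weight_parts (w w' F f : R -> R) : cts w' -> cts f ->
  (forall y, hasd w y (w' y)) -> (forall y, hasd F y (f y)) ->
  w y0 = 0 -> w y1 = 0 ->
  rint y0 y1 (fun y => w y * f y) = - rint y0 y1 (fun y => w' y * F y).
Proof. by move=> cw cf dw dF e0 e1; rewrite (rint_parts _ _ cw cf dw dF) e0 e1; ring. Qed.

Lemma phi_y0 : phi y0 = 0. Proof. by rewrite /phi subrr mulr0 !mul0r. Qed.
Lemma phi_y1 : phi y1 = 0. Proof. by rewrite /phi subrr mulr0 !mul0r. Qed.

Lemma mean_parts (F f : R -> R) : cts f -> (forall y, hasd F y (f y)) ->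
  mean f = - rint y0 y1 (fun y => phi' y * F y).
Proof.
by move=> cf dF; apply: weight_parts => //; [exact: hasd_phi|exact: phi_y0|exact: phi_y1].
Qed.

Lemma hasd_mean (F f : R -> R -> R) s : cts2 F -> cts2 f ->
  (forall s y, hasd (F ^~ y) s (f s y)) ->
  hasd (fun s => mean (F s)) s (mean (f s)).
Proof.
move=> cF cf dF.
apply: (@hasd_rint_param _ (fun s y => phi y * F s y) (fun s y => phi y * f s y)).
- by ctst.
- by ctst.
- by move=> t y; exact: hasdMl.
Qed.

(** The fundamental theorem and Cauchy-Schwarz between [z] and [y], then enlarging the interval to
    the whole cell. *)
Lemma osc_sqr_le (F f : R -> R) y z : cts f -> (forall y, hasd F y (f y)) ->
  y0 <= y <= y1 -> y0 <= z <= y1 ->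
  (F y - F z) ^+ 2 <= del * rint y0 y1 (fun s => f s ^+ 2).
Proof.
move=> cf dF yy zz.
wlog zy : y z yy zz / z <= y.
  move=> W; have [|/ltW] := leP z y; first exact: W.
  by move=> yz; rewrite -sqrrN opprB; exact: W.
have /andP[y0y yy1] := yy; have /andP[y0z zy1] := zz.
have cf2 : cts (fun s => f s ^+ 2) by ctst.
have f20 s : 0 <= f s ^+ 2 by exact: sqr_ge0.
rewrite -(rint_prim _ _ cf dF); apply: le_trans (rint_sqr_le zy cf) _.
have h0 : 0 <= rint z y (fun s => f s ^+ 2) by exact: rint_ge0.
rewrite ler_pM//; [by rewrite subr_ge0|by rewrite /del; lra|].
rewrite -(rint_chasles y0 z y1 cf2) -(rint_chasles z y y1 cf2).
rewrite addrCA lerDl addr_ge0//; exact: rint_ge0.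
Qed.

End Cell.

(** * The estimate on a box *)

Section Box.
Context {R : realType}.
Variables (y0 y1 t0 t1 : R).
Hypotheses (y01 : y0 < y1) (t01 : t0 < t1).
Let del := y1 - y0.
Let tau := t1 - t0.
Let del0 : 0 < del. Proof. by rewrite subr_gt0. Qed.
Let tau0 : 0 < tau. Proof. by rewrite subr_gt0. Qed.
Notation S2 := (int2 t0 t1).
Notation J := (rint y0 y1).
Notation phi := (phi y0 y1).
Notation phi' := (phi' y0 y1).
Notation mean := (mean y0 y1).
Notation chi := (bump t0 t1).

Variables (u ux uy ut H : R -> R -> R -> R) (b b1 : R -> R).
Hypotheses (cu : cts3 u) (cux : cts3 ux) (cuy : cts3 uy) (cut : cts3 ut)
  (cH : cts3 H) (cb : cts b) (cb1 : cts b1).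
Hypotheses (pu : forall x y t, u (x + 1) y t = u x y t)
  (puy : forall x y t, uy (x + 1) y t = uy x y t)
  (pH : forall x y t, H (x + 1) y t = H x y t).
Hypotheses (dux : forall x y t, hasd (fun x => u x y t) x (ux x y t))
  (duy : forall x y t, hasd (fun y => u x y t) y (uy x y t))
  (dut : forall x y t, hasd (fun t => u x y t) t (ut x y t))
  (dH : forall x y t, hasd (fun y => H x y t) y (ut x y t + b y * ux x y t))
  (db : forall y, hasd b y (b1 y)).
Variables (r a c : R).
Hypotheses (r0 : 0 < r) (a0 : 0 < a) (c0 : 0 < c).
Let B y := b y - mean b.
Hypotheses (Ba : forall y, y0 <= y <= y1 -> `|B y| <= a)
  (b1a : forall y, y0 <= y <= y1 -> `|b1 y| <= a / del)
  (Bc : c * a ^+ 2 <= mean (fun y => B y ^+ 2))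
  (rta : r <= tau * a).

Let cphi : cts phi := @cts_phi R y0 y1.
Let cphi' : cts phi' := @cts_phi' R y0 y1.
Let cB : cts B. Proof. by rewrite /B; ctst. Qed.
Let beta := mean (fun y => B y ^+ 2).

Let U x t := mean (fun y => u x y t).
Let Ux x t := mean (fun y => ux x y t).
Let Ut x t := mean (fun y => ut x y t).
Let P x t := mean (fun y => B y * u x y t).
Let Px x t := mean (fun y => B y * ux x y t).
Let Pt x t := mean (fun y => B y * ut x y t).
Let Q x t := mean (fun y => B y ^+ 2 * u x y t).
Let Qx x t := mean (fun y => B y ^+ 2 * ux x y t).
Let E x t := Q x t - beta * U x t.
Let Ex x t := Qx x t - beta * Ux x t.
Let g0 x t := - J (fun y => phi' y * H x y t).
Let g1 x t := - J (fun y => (phi' y * B y + phi y * b1 y) * H x y t).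
Let k x t := del * J (fun y => uy x y t ^+ 2).
(** Here [64] is [8 ^+ 2], and [8] exceeds both [6], from [phi'], and [6 + 3 / 2], from
    [phi' * B + phi * b1]. With this normalisation [g0] and [g1] obey bounds without constants. *)
Let h x t := 64 / del ^+ 3 * J (fun y => H x y t ^+ 2).
Let q x t := U (x + r) t - U x t.

Let cU : cts2 U. Proof. by rewrite /U /mean; ctst. Qed.
Let cUx : cts2 Ux. Proof. by rewrite /Ux /mean; ctst. Qed.
Let cUt : cts2 Ut. Proof. by rewrite /Ut /mean; ctst. Qed.
Let cP : cts2 P. Proof. by rewrite /P /mean; ctst. Qed.
Let cPx : cts2 Px. Proof. by rewrite /Px /mean; ctst. Qed.
Let cPt : cts2 Pt. Proof. by rewrite /Pt /mean; ctst. Qed.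
Let cQ : cts2 Q. Proof. by rewrite /Q /mean; ctst. Qed.
Let cQx : cts2 Qx. Proof. by rewrite /Qx /mean; ctst. Qed.
Let cE : cts2 E. Proof. by rewrite /E; ctst. Qed.
Let cEx : cts2 Ex. Proof. by rewrite /Ex; ctst. Qed.
Let cg0 : cts2 g0. Proof. by rewrite /g0; ctst. Qed.
Let cg1 : cts2 g1. Proof. by rewrite /g1; ctst. Qed.
Let ck : cts2 k. Proof. by rewrite /k; ctst. Qed.
Let ch : cts2 h. Proof. by rewrite /h; ctst. Qed.
Let cq : cts2 q. Proof. by rewrite /q; ctst. Qed.

Let mB : mean B = 0.
Proof.
have -> : mean B = mean (fun y => b y + - mean b) by [].
by rewrite meanD ?mean_cst ?subrr//; ctst.
Qed.

Let eqnU x t : Ut x t + mean b * Ux x t + Px x t = g0 x t.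
Proof.
rewrite /g0 -(@mean_parts _ y0 y1 _ _ _ (fun y => dH x y t)); last by ctst.
rewrite /Ut /Ux /Px -meanZ -?meanD; [|ctst..].
by apply: eq_mean => y; rewrite /B; ring.
Qed.

(** With [b = mean b + B], multiplying by [B] leaves [mean b * Px] and the second moment [Qx], which
    is split as [beta * Ux + Ex]. The right side integrates by parts against [phi * B]. *)
Let eqnP x t : Pt x t + mean b * Px x t + beta * Ux x t + Ex x t = g1 x t.
Proof.
have dB y : hasd (fun y => phi y * B y) y (phi' y * B y + phi y * b1 y).
  apply: hasdM; first exact: hasd_phi.
  by apply: hasd_eq (hasdB (db y) (hasd_cst _ y)) _; rewrite subr0.
rewrite /g1 -(weight_parts _ _ dB (fun y => dH x y t)); [|ctst..| |]; last 2 first.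
- by rewrite phi_y0 mul0r.
- by rewrite phi_y1 mul0r.
transitivity (mean (fun y => B y * (ut x y t + b y * ux x y t))); last first.
  by apply: eq_rint => y; rewrite mulrA.
rewrite (_ : _ + _ = Pt x t + (mean b * Px x t + Qx x t)); last first.
  by rewrite /Ex; ring.
rewrite /Pt /Px /Qx -meanZ -?meanD; [|ctst..].
by apply: eq_mean => y; rewrite /B; ring.
Qed.

Let shift_eq (f : R -> R -> R -> R) : (forall x y t, f (x + 1) y t = f x y t) ->
  forall x t, f (x + 1) ^~ t = f x ^~ t.
Proof. by move=> pf x t; apply/funext => y; exact: pf. Qed.

Let pU : periodic2 U.
Proof. by move=> x t; rewrite /U (shift_eq pu). Qed.
Let pP : periodic2 P.
Proof. by move=> x t; apply: eq_mean => y; rewrite pu. Qed.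
Let pE : periodic2 E.
Proof. by move=> x t; rewrite /E pU; congr (_ - _); apply: eq_mean => y; rewrite pu. Qed.
Let pg0 : periodic2 g0.
Proof. by move=> x t; congr (- _); apply: eq_rint => y; rewrite pH. Qed.
Let pg1 : periodic2 g1.
Proof. by move=> x t; congr (- _); apply: eq_rint => y; rewrite pH. Qed.
Let dmean (w : R -> R) (f fx : R -> R -> R -> R) : cts w -> cts3 f -> cts3 fx ->
  (forall x y t, hasd (fun x => f x y t) x (fx x y t)) ->
  forall x t, hasd (fun x => mean (fun y => w y * f x y t)) x
    (mean (fun y => w y * fx x y t)).
Proof.
move=> cw cf cfx df x t.
apply: (@hasd_mean _ _ _ (fun x y => w y * f x y t) (fun x y => w y * fx x y t)); [ctst..|].
by move=> s y; exact: hasdMl.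
Qed.

Let dmeant (w : R -> R) (f ft : R -> R -> R -> R) : cts w -> cts3 f -> cts3 ft ->
  (forall x y t, hasd (fun t => f x y t) t (ft x y t)) ->
  forall x t, hasd (fun t => mean (fun y => w y * f x y t)) t
    (mean (fun y => w y * ft x y t)).
Proof.
move=> cw cf cft df x t.
apply: (@hasd_mean _ _ _ (fun t y => w y * f x y t) (fun t y => w y * ft x y t)); [ctst..|].
by move=> s y; exact: hasdMl.
Qed.

Let mean1 f : mean f = mean (fun y => 1 * f y).
Proof. by apply: eq_mean => y; rewrite mul1r. Qed.

Let dUx x t : hasd (U ^~ t) x (Ux x t).
Proof.
rewrite /U /Ux mean1 (_ : (fun x => _) = fun x => mean (fun y => 1 * u x y t)).
  by apply: dmean => //; ctst.
by apply/funext => z; exact: mean1.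
Qed.

Let dUt x t : hasd (U x) t (Ut x t).
Proof.
rewrite /Ut mean1 (_ : U x = fun t => mean (fun y => 1 * u x y t)).
  by apply: dmeant => //; ctst.
by apply/funext => z; exact: mean1.
Qed.

Let dPx x t : hasd (P ^~ t) x (Px x t).
Proof. exact: dmean. Qed.

Let dPt x t : hasd (P x) t (Pt x t).
Proof. exact: dmeant. Qed.

Let dEx x t : hasd (E ^~ t) x (Ex x t).
Proof.
apply: hasdB; first by apply: dmean => //; ctst.
by apply: hasdMl; exact: dUx.
Qed.

Let beta_a : beta <= a ^+ 2.
Proof.
rewrite -(mean_cst y01 (a ^+ 2)); apply: le_mean => //; [ctst..|move=> y yy].
by rewrite -[leLHS]real_normK ?num_real// ler_sqr ?nnegrE// ?Ba// ltW.
Qed.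

Let beta0 : 0 <= beta.
Proof. by apply: mean_ge0 => //; [ctst|move=> y _; exact: sqr_ge0]. Qed.

(* A mean against a weight with zero average only sees the oscillation of [u]. *)
Let weighted_osc w A x t : cts w -> 0 <= A -> mean w = 0 ->
  (forall y, y0 <= y <= y1 -> `|w y| <= A) ->
  mean (fun y => w y * u x y t) ^+ 2 <= A ^+ 2 * k x t.
Proof.
move=> cw A0 mw wA.
have -> : mean (fun y => w y * u x y t) = mean (fun y => w y * (u x y t - u x y0 t)).
  transitivity (mean (fun y => w y * u x y t) + (- u x y0 t) * mean w).
    by rewrite mw mulr0 addr0.
  rewrite -meanZ// -meanD; [|ctst..].
  by apply: eq_mean => y; ring.
apply: le_trans (mean_sqr_le y01 _) _; first by ctst.
rewrite -[leRHS](mean_cst y01); apply: le_mean => //; [ctst..|move=> y yy].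
rewrite exprMn ler_pM ?sqr_ge0//.
  by rewrite -[leLHS]real_normK ?num_real// ler_sqr ?nnegrE// wA.
apply: (@osc_sqr_le _ y0 y1 (fun y => u x y t) (fun y => uy x y t)) => //; first by ctst.
by rewrite lexx ltW.
Qed.

Let P_le x t : P x t ^+ 2 <= a ^+ 2 * k x t.
Proof. by apply: (@weighted_osc B) => //; exact: ltW. Qed.

(** [E] is the mean of [u] against [B ^+ 2 - beta], which has mean zero and is bounded by [a ^+ 2]
    because [0 <= beta <= a ^+ 2]. *)
Let E_le x t : E x t ^+ 2 <= a ^+ 4 * k x t.
Proof.
have -> : E x t = mean (fun y => (B y ^+ 2 - beta) * u x y t).
  rewrite /E /Q /U -mulNr -meanZ -?meanD; [|ctst..].
  by apply: eq_mean => y; ring.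
have -> : a ^+ 4 = (a ^+ 2) ^+ 2 by ring.
apply: (@weighted_osc (fun y => B y ^+ 2 - beta)); [ctst|exact: sqr_ge0| |].
  by rewrite meanD ?mean_cst; [rewrite subrr|ctst..].
move=> y yy; rewrite ler_norml; apply/andP; split.
  by rewrite lerBrDr (le_trans _ (sqr_ge0 (B y)))// addrC subr_le0.
rewrite lerBlDr; apply: (@le_trans _ _ (a ^+ 2)); last by rewrite lerDl.
by rewrite -[leLHS]real_normK ?num_real// ler_sqr ?nnegrE// ?Ba// ltW.
Qed.

Let weighted_H w A x t : cts w -> (forall y, y0 <= y <= y1 -> `|w y| <= A * (8 / del ^+ 2)) ->
  0 <= A -> (- J (fun y => w y * H x y t)) ^+ 2 <= A ^+ 2 * h x t.
Proof.
move=> cw wA A0; rewrite sqrrN.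
have y01' := ltW y01.
apply: le_trans (rint_sqr_le y01' _) _; first by ctst.
have -> : A ^+ 2 * h x t =
    del * J (fun y => (A * (8 / del ^+ 2)) ^+ 2 * H x y t ^+ 2).
  by rewrite rintZ; [rewrite /h; field; rewrite gt_eqF|ctst].
rewrite -/del ler_wpM2l//; first exact: ltW.
apply: le_rint => //; [ctst..|move=> y yy].
rewrite exprMn ler_wpM2r ?sqr_ge0//.
rewrite -[leLHS]real_normK ?num_real// ler_sqr ?nnegrE// ?wA//.
by rewrite mulr_ge0// divr_ge0// exprn_ge0// ltW.
Qed.

Let g0_le x t : g0 x t ^+ 2 <= h x t.
Proof.
rewrite -[leRHS]mul1r -(expr1n _ 2); apply: weighted_H => // y yy.
rewrite mul1r (le_trans (phi'_itv y01 yy))// ler_wpM2r// ?invr_ge0 ?exprn_ge0 ?(ltW del0)//.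
by lra.
Qed.

Let g1_le x t : g1 x t ^+ 2 <= a ^+ 2 * h x t.
Proof.
apply: weighted_H; [ctst| |exact: ltW] => y yy.
have d2 : 0 <= 6 / del ^+ 2 by rewrite divr_ge0// exprn_ge0// ltW.
have /andP[p0 p1] := phi_itv y01 yy.
have da : 0 <= a / del ^+ 2 by rewrite divr_ge0 ?exprn_ge0// ltW.
apply: (@le_trans _ _ (6 / del ^+ 2 * a + 3 / 2 / del * (a / del))); last first.
  by have -> : 3 / 2 / del * (a / del) = 3 / 2 * (a / del ^+ 2);
    [field; rewrite gt_eqF|lra].
apply: le_trans (ler_normD _ _) _; rewrite (normrM (phi' y)) (normrM (phi y)); apply: lerD; apply: ler_pM => //.
- exact: phi'_itv.
- exact: Ba.
- by rewrite ger0_norm.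
- exact: b1a.
Qed.

Let k_ge0 x t : 0 <= k x t.
Proof.
rewrite mulr_ge0 ?(ltW del0)//; apply: rint_ge0; [exact: ltW|ctst|].
by move=> y _; exact: sqr_ge0.
Qed.

Let h_ge0 x t : 0 <= h x t.
Proof.
rewrite mulr_ge0 ?divr_ge0 ?exprn_ge0 ?(ltW del0)//; apply: rint_ge0; [exact: ltW|ctst|].
by move=> y _; exact: sqr_ge0.
Qed.

Let K := S2 k.
Let Hh := S2 h.
Let lt01 := ltW t01.

Let K_ge0 : 0 <= K. Proof. by apply: int2_ge0. Qed.
Let Hh_ge0 : 0 <= Hh. Proof. by apply: int2_ge0. Qed.

(** The choice [eta = c / 96] looks ahead to [q_energy]: multiplying by [48 / c] produces the [24]
    needed there and leaves exactly half of the integral of [q ^+ 2], which is absorbed. *)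
Lemma box_moment : c / 2 * S2 (fun x t => chi t * q x t ^+ 2) <=
  c / 96 * S2 (fun x t => q x t ^+ 2) + (5 + 28 / c) * K + (c^-1 + 2) * tau ^+ 2 * Hh.
Proof.
have eta0 : 0 < c / 96 by rewrite divr_gt0.
have := @moment_estimate _ t0 t1 t01 U Ux Ut P Px Pt E Ex g0 g1
  cU cUx cUt cP cPx cPt cE cEx cg0 cg1 pU pP pE pg0 pg1 dUx dUt dPx dPt dEx
  (mean b) beta r eqnU eqnP a c (c / 96) K Hh a0 c0 eta0 r0 rta Bc.
have -> : 5 + 4 / c + (4 * (c / 96))^-1 = 5 + 28 / c by field; rewrite gt_eqF.
apply.
- rewrite -int2Z; last exact: ck.
  by apply: le_int2 => [|||x t _]; [exact: lt01|ctst|ctst|exact: P_le].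
- rewrite -int2Z; last exact: ck.
  by apply: le_int2 => [|||x t _]; [exact: lt01|ctst|ctst|exact: E_le].
- by apply: le_int2 => [|||x t _]; [exact: lt01|ctst|ctst|exact: g0_le].
- rewrite -int2Z; last exact: ch.
  by apply: le_int2 => [|||x t _]; [exact: lt01|ctst|ctst|exact: g1_le].
- exact: K_ge0.
- exact: Hh_ge0.
Qed.

Let Du x y t := u (x + r) y t - u x y t.
Let Dux x y t := ux (x + r) y t - ux x y t.
Let Duy x y t := uy (x + r) y t - uy x y t.
Let Dut x y t := ut (x + r) y t - ut x y t.
Let DH x y t := H (x + r) y t - H x y t.
Let M x t := mean (fun y => Du x y t ^+ 2).
Let kD x t := del * J (fun y => Duy x y t ^+ 2).
Let hD x t := J (fun y => DH x y t ^+ 2).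

Let cDu : cts3 Du. Proof. by rewrite /Du; ctst. Qed.
Let cDux : cts3 Dux. Proof. by rewrite /Dux; ctst. Qed.
Let cDuy : cts3 Duy. Proof. by rewrite /Duy; ctst. Qed.
Let cDut : cts3 Dut. Proof. by rewrite /Dut; ctst. Qed.
Let cDH : cts3 DH. Proof. by rewrite /DH; ctst. Qed.
Let cM : cts2 M. Proof. by rewrite /M /mean; ctst. Qed.
Let ckD : cts2 kD. Proof. by rewrite /kD; ctst. Qed.
Let chD : cts2 hD. Proof. by rewrite /hD; ctst. Qed.

Let dDux x y t : hasd (fun x => Du x y t) x (Dux x y t).
Proof. exact: (hasdB (@hasd_shift _ (fun x => u x y t) _ r x (dux _ y t)) (dux x y t)). Qed.
Let dDuy x y t : hasd (fun y => Du x y t) y (Duy x y t).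
Proof. exact: hasdB. Qed.
Let dDut x y t : hasd (fun t => Du x y t) t (Dut x y t).
Proof. exact: hasdB. Qed.
Let dDH x y t : hasd (fun y => DH x y t) y (Dut x y t + b y * Dux x y t).
Proof.
by apply: hasd_eq (hasdB (dH (x + r) y t) (dH x y t)) _; rewrite /Dut /Dux; ring.
Qed.

Let qE x t : q x t = mean (fun y => Du x y t).
Proof.
rewrite /q /U -[X in _ - X]mul1r -mulNr -meanZ -?meanD; [|ctst..].
by apply: eq_mean => y; rewrite /Du; ring.
Qed.

Let q_le_M x t : q x t ^+ 2 <= M x t.
Proof. by rewrite qE; apply: mean_sqr_le => //; ctst. Qed.

Let Du_le x y t : y0 <= y <= y1 -> Du x y t ^+ 2 <= 2 * q x t ^+ 2 + 2 * kD x t.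
Proof.
move=> yy; apply: (@le_trans _ _ (2 * q x t ^+ 2 + 2 * (Du x y t - q x t) ^+ 2)).
  rewrite -subr_ge0 (_ : _ - _ = (2 * q x t - Du x y t) ^+ 2); first exact: sqr_ge0.
  by ring.
rewrite lerD2l ler_wpM2l//.
have -> : Du x y t - q x t = mean (fun z => Du x y t + -1 * Du x z t).
  by rewrite qE meanD ?meanZ ?(mean_cst y01); [rewrite mulN1r|ctst..].
apply: le_trans (mean_sqr_le y01 _) _; first by ctst.
rewrite -[leRHS](mean_cst y01); apply: le_mean => //; [ctst..|move=> z zz].
rewrite mulN1r.
by apply: (@osc_sqr_le _ y0 y1 (fun y => Du x y t) (fun y => Duy x y t)) => //; ctst.
Qed.

Let M_le x t : M x t <= 2 * q x t ^+ 2 + 2 * kD x t.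
Proof.
rewrite -[leRHS](mean_cst y01); apply: le_mean => //; [ctst..|move=> y yy].
exact: Du_le.
Qed.

Let JDu_le x t : J (fun y => Du x y t ^+ 2) <= del * (2 * q x t ^+ 2 + 2 * kD x t).
Proof.
rewrite mulrC -rint_cst; apply: le_rint; [exact: ltW|ctst..|move=> y yy].
exact: Du_le.
Qed.

Let int_J_sqrB_le (f : R -> R -> R -> R) : cts3 f ->
  (forall x y t, f (x + 1) y t = f x y t) ->
  S2 (fun x t => J (fun y => (f (x + r) y t - f x y t) ^+ 2)) <=
  4 * S2 (fun x t => J (fun y => f x y t ^+ 2)).
Proof.
move=> cf pf; pose F x t := J (fun y => f x y t ^+ 2).
have cF : cts2 F by rewrite /F; ctst.
have pF : periodic2 F by move=> x t; apply: eq_rint => y; rewrite pf.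
have -> : 4 * S2 F = S2 (fun x t => 2 * F (x + r) t + 2 * F x t).
  rewrite [RHS]int2D; [|ctst..].
  rewrite (@int2Z _ t0 t1 2 (fun x t => F (x + r) t)); last by ctst.
  rewrite (@int2Z _ t0 t1 2 F)// (@int2_shift _ t0 t1 F r cF pF).
  by ring.
apply: le_int2; [exact: lt01|ctst..|move=> x t _].
rewrite /F -!rintZ -?rintD; [|ctst..].
apply: le_rint; [exact: ltW|ctst..|move=> y _].
rewrite -subr_ge0 (_ : _ - _ = (f (x + r) y t + f x y t) ^+ 2); first exact: sqr_ge0.
by ring.
Qed.

Let kD_le : S2 kD <= 4 * K.
Proof.
have -> : K = del * S2 (fun x t => J (fun y => uy x y t ^+ 2)) by apply: int2Z; ctst.
have -> : S2 kD = del * S2 (fun x t => J (fun y => Duy x y t ^+ 2)).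
  by apply: int2Z; ctst.
have := int_J_sqrB_le cuy puy.
move: (S2 (fun x t => J (fun y => uy x y t ^+ 2)))
  (S2 (fun x t => J (fun y => Duy x y t ^+ 2))) => s1 s2 s12.
by rewrite mulrCA ler_wpM2l// ltW.
Qed.

Let hD_le : S2 hD <= del ^+ 3 / 16 * Hh.
Proof.
apply: le_trans (int_J_sqrB_le cH pH) _.
have -> : Hh = 64 / del ^+ 3 * S2 (fun x t => J (fun y => H x y t ^+ 2)).
  by apply: int2Z; ctst.
by rewrite le_eqVlt; apply/orP; left; apply/eqP; field; rewrite gt_eqF.
Qed.

(** The primitive of [1 - 6 * chi] that vanishes at [t0]. It also vanishes at [t1], because [chi]
    has integral [tau / 6]. *)
Let Z t := (t - t0) * (1 - (t - t0) / tau) * (1 - 2 * ((t - t0) / tau)).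

Let dZ t : hasd Z t (1 - 6 * chi t).
Proof.
have d1 : hasd (fun t => t - t0) t 1.
  by apply: hasd_eq (hasdB (hasd_id t) (hasd_cst t0 t)) _; rewrite subr0.
have d2 := hasdM d1 (hasd_cst (tau^-1) t).
apply: hasd_eq (hasdM (hasdM d1 (hasdB (hasd_cst 1 t) d2))
  (hasdB (hasd_cst 1 t) (hasdMl 2 d2))) _.
rewrite /bump -/tau; have -> : t1 - t = tau - (t - t0) by rewrite /tau; ring.
by field; rewrite gt_eqF.
Qed.

Let cZ : cts Z. Proof. exact: hasd_cont dZ. Qed.

Let Z_le t : t0 <= t <= t1 -> `|Z t| <= tau.
Proof.
move=> /andP[h0 h1].
have s0 : 0 <= (t - t0) / tau by rewrite divr_ge0 ?subr_ge0// ltW.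
have s1 : (t - t0) / tau <= 1 by rewrite ler_pdivrMr// mul1r /tau; lra.
rewrite /Z normrM -[leRHS]mulr1 ler_pM//.
  rewrite normrM -[leRHS]mulr1 ler_pM//.
    by rewrite ger0_norm /tau; lra.
  by rewrite ler_norml; apply/andP; split; lra.
by rewrite ler_norml; apply/andP; split; lra.
Qed.

Let V x t := J (fun y => (phi' y * Du x y t + phi y * Duy x y t) * DH x y t).
Let cV : cts2 V. Proof. by rewrite /V; ctst. Qed.

(* [u^2] is transported by [X0]: its time derivative only involves [H]. *)
Let energy_identity :
  S2 (fun x t => (1 - 6 * chi t) * M x t) = 2 * S2 (fun x t => Z t * V x t).
Proof.
have cchi := @cts_bump _ t0 t1.
pose Mt x t := mean (fun y => Dut x y t * Du x y t + Du x y t * Dut x y t).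
pose G x t := mean (fun y => b y * (Du x y t * Du x y t)).
pose Gx x t := mean (fun y => b y * (Dux x y t * Du x y t + Du x y t * Dux x y t)).
have cMt : cts2 Mt by rewrite /Mt /mean; ctst.
have cGx : cts2 Gx by rewrite /Gx /mean; ctst.
have e1 : S2 (fun x t => Z t * Mt x t) = - S2 (fun x t => (1 - 6 * chi t) * M x t).
  apply: int2_dt; [exact: cMt|ctst| |exact: dZ|exact: cM| |].
  - move=> x t; apply: (@hasd_mean _ _ _ (fun t y => Du x y t ^+ 2)
      (fun t y => Dut x y t * Du x y t + Du x y t * Dut x y t)); [ctst..|].
    by move=> s y; exact: hasdM.
  - by rewrite /Z subrr !mul0r.
  - by rewrite /Z -/tau divff ?gt_eqF// subrr mulr0 mul0r.
(* As [b] depends on [y] only, the transport term is an exact [x]-derivative. *)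
have e2 : S2 (fun x t => Z t * Gx x t) = 0.
  apply: (@int2_dx _ _ _ G); [exact: cGx| |].
    move=> x t; apply: (@hasd_mean _ _ _ (fun x y => b y * (Du x y t * Du x y t))
      (fun x y => b y * (Dux x y t * Du x y t + Du x y t * Dux x y t))); [ctst..|].
    by move=> s y; apply: hasdMl; exact: hasdM.
  move=> x t; apply: eq_mean => y.
  by rewrite /Du pu (_ : x + 1 + r = x + r + 1) ?pu//; ring.
(* The transport derivative of [Du ^+ 2] is [2 * Du] times the [y]-derivative of [DH]; by parts,
   that derivative falls on [phi * Du]. *)
have e3 x t : Mt x t + Gx x t = - 2 * V x t.
  rewrite /Mt /Gx -meanD; [|ctst..].
  have dw y : hasd (fun y => phi y * Du x y t) y (phi' y * Du x y t + phi y * Duy x y t).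
    by apply: hasdM; [exact: hasd_phi|exact: dDuy].
  have e : J (fun y => phi y * Du x y t * (Dut x y t + b y * Dux x y t)) = - V x t.
    apply: (weight_parts _ _ dw (fun y => dDH x y t)); [ctst..| |].
      by rewrite phi_y0 mul0r.
    by rewrite phi_y1 mul0r.
  rewrite mulNr -mulrN -e.
  rewrite -rintZ; last by ctst.
  by apply: eq_rint => y; ring.
have e4 : S2 (fun x t => Z t * Mt x t + Z t * Gx x t) = - 2 * S2 (fun x t => Z t * V x t).
  rewrite -int2Z; last by ctst.
  by apply: eq_int2 => x t; rewrite -mulrDr e3; ring.
move: e4; rewrite int2D; [|ctst..].
by rewrite e1 e2 addr0 mulNr => /oppr_inj.
Qed.

(** The weight [(4 * del)^-1] in Young's inequality makes [Du] cost only half of [q ^+ 2], which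
    [q_energy] absorbs; [160] rounds up [144 + 9 / 4]. *)
Let V_le x t : t0 <= t <= t1 -> 2 * (Z t * V x t) <=
  1 / 2 * q x t ^+ 2 + (3 / 2 * kD x t + 160 * (tau ^+ 2 / del ^+ 3 * hD x t)).
Proof.
move=> tt.
have Zt := Z_le tt.
have E1 : 2 * (Z t * V x t) <= J (fun y => (4 * del)^-1 * Du x y t ^+ 2 +
    (del * Duy x y t ^+ 2 + 160 * (tau ^+ 2 / del ^+ 3) * DH x y t ^+ 2)).
  rewrite mulrA /V -rintZ; last by ctst.
  apply: le_rint; [exact: ltW|ctst..|move=> y yy].
  have p'1 := phi'_itv y01 yy; have /andP[p0 p1] := phi_itv y01 yy.
  move: (phi' y) (phi y) (Z t) (Du x y t) (Duy x y t) (DH x y t) p'1 p0 p1 Zt.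
  move=> f' f z d dy g f'1 f0 f1 z1.
  have zf' : `|z * f'| <= tau * (6 / del ^+ 2) by rewrite normrM ler_pM.
  have zf : `|z * f| <= tau * (3 / 2 / del) by rewrite normrM ler_pM// ger0_norm.
  have young (w A e v v' : R) : 0 < e -> `|w| <= A ->
      2 * (w * v * v') <= e * v ^+ 2 + A ^+ 2 / e * v' ^+ 2.
    move=> e0 wA; apply: (@le_trans _ _ (e * v ^+ 2 + w ^+ 2 / e * v' ^+ 2)).
      rewrite -subr_ge0 (_ : _ - _ = (e * v - w * v') ^+ 2 / e).
        by rewrite divr_ge0 ?sqr_ge0// ltW.
      by field; rewrite gt_eqF.
    rewrite lerD2l ler_wpM2r ?sqr_ge0// ler_wpM2r ?invr_ge0 ?(ltW e0)//.
    by rewrite -[leLHS]real_normK ?num_real// ler_sqr ?nnegrE// (le_trans _ wA).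
  have d40 : 0 < (4 * del)^-1 by rewrite invr_gt0 mulr_gt0.
  have y1' := young _ _ _ d g d40 zf'; have y2 := young _ _ _ dy g del0 zf.
  have -> : 2 * z * ((f' * d + f * dy) * g) =
    2 * (z * f' * d * g) + 2 * (z * f * dy * g) by ring.
  apply: le_trans (lerD y1' y2) _; rewrite -addrA lerD2l addrCA lerD2l -mulrDl.
  rewrite ler_wpM2r ?sqr_ge0//.
  have -> : (tau * (6 / del ^+ 2)) ^+ 2 / (4 * del)^-1 + (tau * (3 / 2 / del)) ^+ 2 / del
     = (144 + 9 / 4) * (tau ^+ 2 / del ^+ 3) by field; rewrite gt_eqF.
  rewrite ler_wpM2r//; last by lra.
  by rewrite divr_ge0 ?exprn_ge0// ltW.
apply: le_trans E1 _; rewrite rintD; [|ctst..].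
rewrite rintZ; last by ctst.
rewrite rintD; [|ctst..].
rewrite rintZ; last by ctst.
rewrite rintZ; last by ctst.
rewrite -/(kD x t) -/(hD x t) -mulrA.
have j : (4 * del)^-1 * J (fun y => Du x y t ^+ 2) <=
    1 / 2 * q x t ^+ 2 + 1 / 2 * kD x t.
  apply: (@le_trans _ _ ((4 * del)^-1 * (del * (2 * q x t ^+ 2 + 2 * kD x t)))).
    by rewrite ler_wpM2l ?JDu_le// invr_ge0 mulr_ge0// ltW.
  by rewrite le_eqVlt; apply/orP; left; apply/eqP; field; rewrite gt_eqF.
move: j; move: (J (fun y => Du x y t ^+ 2)) (kD x t) (hD x t) (q x t ^+ 2) (tau ^+ 2 / del ^+ 3).
move: ((4 * del)^-1) => i jj kk hh qq td.
move: (i * jj) (td * hh) => ij th H'; lra.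
Qed.

(** Removal of the time cutoff. By Jensen [q ^+ 2 <= M], and [1 = 6 * chi + (1 - 6 * chi)]: the
    first part of [M] returns to [chi * q ^+ 2] by the Poincare bound [M_le], the second is given by
    [energy_identity] and [V_le]. Absorbing half of [q ^+ 2] doubles the remaining constants. *)
Let q_energy : S2 (fun x t => q x t ^+ 2) <=
  24 * S2 (fun x t => chi t * q x t ^+ 2) + 108 * K + 20 * (tau ^+ 2 * Hh).
Proof.
have cchi := @cts_bump _ t0 t1.
have s3 : S2 (fun x t => 6 * (chi t * M x t)) <=
    S2 (fun x t => 12 * (chi t * q x t ^+ 2) + 12 * kD x t).
  apply: le_int2; [exact: lt01|ctst|ctst|move=> x t tt].
  have /andP[c0' c1'] := bump_itv t01 tt.
  have k0 : 0 <= kD x t.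
    rewrite mulr_ge0 ?(ltW del0)//; apply: rint_ge0; [exact: ltW|ctst|].
    by move=> y _; exact: sqr_ge0.
  have m1 : chi t * M x t <= 2 * (chi t * q x t ^+ 2) + 2 * (chi t * kD x t).
    have -> : 2 * (chi t * q x t ^+ 2) + 2 * (chi t * kD x t) =
      chi t * (2 * q x t ^+ 2 + 2 * kD x t) by ring.
    by rewrite ler_wpM2l// M_le.
  have m2 : chi t * kD x t <= kD x t by rewrite ler_piMl.
  move: m1 m2.
  move: (chi t * M x t) (kD x t) (chi t * q x t ^+ 2) (chi t * kD x t) => v1 v2 v3 v4 m1 m2.
  lra.
have s1 : S2 (fun x t => q x t ^+ 2) <= S2 M.
  by apply: le_int2; [exact: lt01|ctst|ctst|move=> x t _; exact: q_le_M].
have s2 : S2 M = S2 (fun x t => 6 * (chi t * M x t)) +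
    S2 (fun x t => (1 - 6 * chi t) * M x t).
  rewrite -int2D; [|ctst..].
  by apply: eq_int2 => x t; ring.
have s4 : 2 * S2 (fun x t => Z t * V x t) <=
    S2 (fun x t => 1 / 2 * q x t ^+ 2 + (3 / 2 * kD x t +
      160 * (tau ^+ 2 / del ^+ 3 * hD x t))).
  rewrite -int2Z; last by ctst.
  by apply: le_int2; [exact: lt01|ctst|ctst|move=> x t tt; exact: V_le].
move: s3 s4; rewrite int2D; [|ctst..].
rewrite (@int2Z _ t0 t1 12 (fun x t => chi t * q x t ^+ 2)); last by ctst.
rewrite (@int2Z _ t0 t1 12 kD) => [s3|]; last by ctst.
rewrite int2D; [|ctst..].
rewrite int2D; [|ctst..].
rewrite (@int2Z _ t0 t1 (1 / 2) (fun x t => q x t ^+ 2)); last by ctst.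
rewrite (@int2Z _ t0 t1 (3 / 2) kD); last by ctst.
rewrite (@int2Z _ t0 t1 160); last by ctst.
rewrite (@int2Z _ t0 t1 _ hD); last by ctst.
rewrite -energy_identity => s4.
have s5 : tau ^+ 2 / del ^+ 3 * S2 hD <= 1 / 16 * (tau ^+ 2 * Hh).
  apply: (@le_trans _ _ (tau ^+ 2 / del ^+ 3 * (del ^+ 3 / 16 * Hh))).
    by apply: ler_wpM2l; [rewrite divr_ge0 ?exprn_ge0// ltW|exact: hD_le].
  by rewrite le_eqVlt; apply/orP; left; apply/eqP; field; rewrite gt_eqF.
have s6 := kD_le.
move: s1 s2 s3 s4 s5 s6.
move: (S2 M) (S2 kD) (S2 hD) K Hh (S2 (fun x t => q x t ^+ 2)) => mm kk hh K' H' qq.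
move: (S2 (fun x t => chi t * q x t ^+ 2)) => X.
move: (S2 (fun x t => 6 * _)) (S2 (fun x t => (1 - 6 * chi t) * _)) => z1 z2.
move: (tau ^+ 2 / del ^+ 3 * hh) (tau ^+ 2 * H') => z3 z4 *; lra.
Qed.

(** The inner sum [216 + 96 / c * (5 + 28 / c)] bounds the integral of [q ^+ 2] after absorption;
    [2 * _ + 8] passes from [q] to [Du] by [JDu_le] and [kD_le]; [64] is the factor contained in
    [h]. *)
Definition Cbox := 64 * (2 * (216 + 96 / c * (5 + 28 / c)) + 8).

(** [box_moment] and [q_energy] together control the increment of the average [U]; the oscillation
    of [Du] in [y] adds only [kD]. *)
Lemma box_estimate : S2 (fun x t => J (fun y => Du x y t ^+ 2)) <=
  Cbox * (del ^+ 2 * S2 (fun x t => J (fun y => uy x y t ^+ 2)) +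
    tau ^+ 2 / del ^+ 2 * S2 (fun x t => J (fun y => H x y t ^+ 2))).
Proof.
have bm := box_moment; have qe := q_energy.
have s1 : S2 (fun x t => J (fun y => Du x y t ^+ 2)) <=
    S2 (fun x t => del * (2 * q x t ^+ 2 + 2 * kD x t)).
  by apply: le_int2; [exact: lt01|ctst|ctst|move=> x t _; exact: JDu_le].
move: s1; rewrite (@int2Z _ t0 t1 del); last by ctst.
rewrite int2D; [|ctst..].
rewrite (@int2Z _ t0 t1 2 kD); last by ctst.
rewrite (@int2Z _ t0 t1 2) => [s1|]; last by ctst.
have kd := kD_le.
have eK : K = del * S2 (fun x t => J (fun y => uy x y t ^+ 2)) by apply: int2Z; ctst.
have eH : Hh = 64 / del ^+ 3 * S2 (fun x t => J (fun y => H x y t ^+ 2)).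
  by apply: int2Z; ctst.
have K0 := K_ge0; have H0 := Hh_ge0.
move: (K) (Hh) eK eH K0 H0 bm qe s1 kd => K' H' eK eH K0 H0.
move: (S2 (fun x t => q x t ^+ 2)) (S2 (fun x t => chi t * q x t ^+ 2)) (S2 kD) eK eH.
move: (S2 (fun x t => J (fun y => Du x y t ^+ 2))) (S2 (fun x t => J (fun y => uy x y t ^+ 2))).
move: (S2 (fun x t => J (fun y => H x y t ^+ 2))) => sH sD sU qq X kk eK eH bm qe s1 kd.
have i0 : 0 < c^-1 by rewrite invr_gt0.
have Xle : 24 * X <= 1 / 2 * qq + 48 / c * ((5 + 28 / c) * K' + (c^-1 + 2) * tau ^+ 2 * H').
  have c48 : 0 <= 48 / c by rewrite divr_ge0// ltW.
  have := ler_wpM2l c48 bm.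
  have -> : 48 / c * (c / 2 * X) = 24 * X by field; rewrite gt_eqF.
  move=> h1; apply: le_trans h1 _.
  by rewrite le_eqVlt; apply/orP; left; apply/eqP; field; rewrite gt_eqF.
have t2H : 0 <= tau ^+ 2 * H' by rewrite mulr_ge0 ?sqr_ge0.
set C0 := 216 + 96 / c * (5 + 28 / c).
have Cq : qq <= C0 * (K' + tau ^+ 2 * H').
  rewrite /C0; have iK : 0 <= c^-1 * (tau ^+ 2 * H') by rewrite mulr_ge0// ltW.
  have iK2 : 0 <= c^-1 * (c^-1 * (tau ^+ 2 * H')) by rewrite mulr_ge0// ltW.
  move: Xle; move: c^-1 iK iK2 => ii iK iK2 Xle; lra.
have Clast : sD <= del * ((2 * C0 + 8) * (K' + tau ^+ 2 * H')).
  apply: le_trans s1 _; apply: ler_wpM2l; first exact: ltW.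
  by move: C0 Cq => C0 Cq; lra.
apply: le_trans Clast _.
have C00 : 0 <= C0.
  have e0 : 0 <= 28 / c by rewrite divr_ge0// ltW.
  have e1 : 0 <= 96 / c by rewrite divr_ge0// ltW.
  exact: (addr_ge0 (ler0n _ _) (mulr_ge0 e1 (addr_ge0 (ler0n _ _) e0))).
have sU0 : 0 <= sU by move: K0; rewrite eK pmulr_rge0.
have -> : del * ((2 * C0 + 8) * (K' + tau ^+ 2 * H')) =
    (2 * C0 + 8) * (del ^+ 2 * sU + 64 * (tau ^+ 2 / del ^+ 2 * sH)).
  by rewrite eK eH; field; rewrite gt_eqF.
have -> : Cbox = (2 * C0 + 8) * 64 by rewrite mulrC.
rewrite -[leRHS]mulrA; apply: ler_wpM2l; first by rewrite addr_ge0// mulr_ge0.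
rewrite [leRHS]mulrDr lerD2r; apply: ler_peMl; last by rewrite ler1n.
by rewrite mulr_ge0// sqr_ge0.
Qed.
End Box.

(** * Cells adapted to the profile *)

Section Taylor.
Context {R : realType}.

Lemma hasd_exp (p y : R) n :
  hasd (fun y => (y - p) ^+ n.+1) y (n.+1%:R * (y - p) ^+ n).
Proof.
have d1 : hasd (fun y => y - p) y 1.
  by apply: hasd_eq (hasdB (hasd_id y) (hasd_cst p y)) _; rewrite subr0.
elim: n => [|n IH]; first by apply: hasd_eq d1 _; rewrite expr0 mulr1.
rewrite (_ : (fun y => _) = fun y => (y - p) * (y - p) ^+ n.+1); last first.
  by apply/funext => z; rewrite exprS.
by apply: hasd_eq (hasdM d1 IH) _; rewrite -[n.+2%:R]natr1 exprS; ring.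
Qed.

(* Iterating Cauchy's mean value theorem on [f / (y - p) ^ n]. *)
Lemma vanishing_order_bounds n (f : nat -> R -> R) (p rho m M : R) :
  (forall k y, hasd (f k) y (f k.+1 y)) -> (forall k, (k < n)%N -> f k p = 0) ->
  (forall y, `|y - p| < rho -> m <= `|f n y| <= M) ->
  forall y, `|y - p| < rho ->
    m * `|y - p| ^+ n <= n`!%:R * `|f 0 y| <= M * `|y - p| ^+ n.
Proof.
elim: n f => [|n IH] f df f0 fn y yp.
  by rewrite expr0 !mulr1 fact0 mul1r; exact: fn.
have [->|yNp] := eqVneq y p.
  by rewrite f0// subrr normr0 expr0n !mulr0 lexx.
pose h x := f 0%N x * (y - p) ^+ n.+1 - f 0%N y * (x - p) ^+ n.+1.
have dh x : hasd h x (f 1%N x * (y - p) ^+ n.+1 -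
    f 0%N y * (n.+1%:R * (x - p) ^+ n)).
  apply: hasdB; last by apply: hasdMl; exact: hasd_exp.
  by apply: hasd_eq (hasdM (df 0%N x) (hasd_cst _ x)) _; rewrite mulr0 addr0.
have [t /andP[t0 t1]] := hasd_mvt p y dh.
set z := p + _.
have zp : z - p = t * (y - p) by rewrite /z addrC addKr.
rewrite /h (subrr p) expr0n /= f0// mulr0 mul0r !subrr.
move=> /esym/eqP; rewrite mulf_eq0 (subr_eq0 y p) (negPf yNp) orbF.
rewrite subr_eq0 => /eqP E.
have zn : 0 < `|z - p| by rewrite normr_gt0 zp mulf_neq0 ?subr_eq0// gt_eqF.
have zr : `|z - p| < rho.
  by rewrite zp normrM gtr0_norm//; apply: le_lt_trans yp; rewrite ler_piMl// ltW.
have /andP[lo hi] := IH (fun k => f k.+1) (fun k => df k.+1)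
  (fun k kn => f0 k.+1 kn) fn z zr.
have {}E : n.+1`!%:R * `|f 0%N y| * `|z - p| ^+ n =
    n`!%:R * `|f 1%N z| * `|y - p| ^+ n.+1.
  have /(congr1 (fun x => n`!%:R * `|x|)) := E; rewrite !normrM !normrX normr_nat.
  move=> e; rewrite -[RHS]mulrA e factS natrM.
  move: (n`!%:R) (n.+1%:R) (`|z - p| ^+ n) (`|f 0%N y|) => k1 k2 k3 k4.
  by ring.
have zn' : 0 < `|z - p| ^+ n by rewrite exprn_gt0.
apply/andP; split; rewrite -(ler_pM2r zn') E.
  by rewrite [leLHS]mulrAC; apply: ler_wpM2r; [exact: exprn_ge0|exact: lo].
by rewrite [leRHS]mulrAC; apply: ler_wpM2r; [exact: exprn_ge0|exact: hi].
Qed.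

End Taylor.

Section Geometry.
Context {R : realType}.
Implicit Types b : R -> R.

(** The midpoint value [b (p + 2 * l)] lies on one side of [k]. On the last quarter, or else on the
    first one, [b] has moved further away from [k] by at least [l * m]. *)
Lemma steep_subinterval_pos b (b1 : R -> R) p l m k : (forall y, hasd b y (b1 y)) ->
  0 < l -> 0 < m -> (forall y, p <= y <= p + 4 * l -> m <= b1 y) ->
  exists2 s, p <= s <= p + 3 * l &
    forall y, s <= y <= s + l -> l * m <= `|b y - k|.
Proof.
move=> db l0 m0 mb.
have mono y z : p <= y -> y <= z -> z <= p + 4 * l -> m * (z - y) <= b z - b y.
  move=> py yz zp; have [t /andP[t0 t1] ->] := hasd_mvt y z db.
  have yz0 : 0 <= z - y by rewrite subr_ge0.
  apply: ler_wpM2r => //; apply: mb.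
  have h1 : 0 <= t * (z - y) by rewrite mulr_ge0// ltW.
  have h2 : t * (z - y) <= z - y by rewrite ler_piMl// ltW.
  by apply/andP; split; lra.
have lm : l * m = m * l by rewrite mulrC.
have [kb|bk] := leP k (b (p + 2 * l)).
  exists (p + 3 * l) => [|y /andP[y0 y1]]; first by apply/andP; split; lra.
  have h : m * l <= b y - b (p + 2 * l).
    apply: le_trans (mono _ _ _ _ _); [|lra|lra|lra].
    by apply: ler_wpM2l; [exact: ltW|lra].
  by rewrite lm; apply: le_trans (ler_norm _); lra.
exists p => [|y /andP[y0 y1]]; first by apply/andP; split; lra.
have h : m * l <= b (p + 2 * l) - b y.
  apply: le_trans (mono _ _ _ _ _); [|lra|lra|lra].
  by apply: ler_wpM2l; [exact: ltW|lra].
by rewrite lm distrC; apply: le_trans (ler_norm _); lra.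
Qed.

(** Being nonzero, [b1] keeps its sign by the intermediate value theorem, so the previous lemma
    applies to [b] or to [- b]. *)
Lemma steep_subinterval b (b1 : R -> R) p l m k : cts b1 -> (forall y, hasd b y (b1 y)) ->
  0 < l -> 0 < m -> (forall y, p <= y <= p + 4 * l -> m <= `|b1 y|) ->
  exists2 s, p <= s <= p + 3 * l &
    forall y, s <= y <= s + l -> l * m <= `|b y - k|.
Proof.
move=> cb1 db l0 m0 mb.
have pp : p <= p <= p + 4 * l by rewrite lexx lerDl mulr_ge0// ltW.
have nz y : p <= y <= p + 4 * l -> b1 y != 0.
  by move=> /mb h; rewrite -normr_gt0; exact: lt_le_trans h.
have ivt y : p <= y <= p + 4 * l -> ~ (Num.min (b1 p) (b1 y) <= 0 <= Num.max (b1 p) (b1 y)).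
  move=> /andP[py yp] h.
  have [|c /[!in_itv]/= /andP[c0 c1] bc] := IVT py _ h.
    exact: continuous_subspaceT.
  by have := nz c; rewrite c0 (le_trans c1 yp) bc eqxx => /(_ isT).
have [bp|bp|bp] := ltgtP (b1 p) 0; last by move: (nz p pp); rewrite bp eqxx.
- have neg y : p <= y <= p + 4 * l -> m <= - b1 y.
    move=> yy; have : b1 y < 0.
      rewrite ltNge; apply/negP => h; apply: (ivt y yy).
      by rewrite ge_min le_max (ltW bp) h orbT.
    by move=> h; rewrite -ltr0_norm// mb.
  have dNb y : hasd (fun y => - b y) y (- b1 y) by exact: hasdN.
  have [s sp H] := steep_subinterval_pos (- k) dNb l0 m0 neg.
  by exists s => // y /H; rewrite -opprD normrN.
- have pos y : p <= y <= p + 4 * l -> m <= b1 y.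
    move=> yy; have : 0 < b1 y.
      rewrite ltNge; apply/negP => h; apply: (ivt y yy).
      by rewrite ge_min le_max (ltW bp) h orbT.
    by move=> h; rewrite -[b1 y]gtr0_norm// mb.
  exact: steep_subinterval_pos.
Qed.

(** At distance [(y1 - y0) / 4] from the midpoint, [phi] equals [9 / 8] divided by the length of the
    cell, and it is larger inside. *)
Lemma phi_mid (y0 y1 y : R) : y0 < y1 ->
  (y0 + y1) / 2 - (y1 - y0) / 4 <= y <= (y0 + y1) / 2 + (y1 - y0) / 4 ->
  (y1 - y0)^-1 <= phi y0 y1 y.
Proof.
move=> y01 /andP[h0 h1]; have d0 : 0 < y1 - y0 by rewrite subr_gt0.
rewrite /phi ler_pdivlMr ?exprn_gt0//.
have -> : (y1 - y0)^-1 * (y1 - y0) ^+ 3 = (y1 - y0) ^+ 2 by field; rewrite gt_eqF.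
nra.
Qed.

(** Here [a] is the size of the oscillation of [b] on the cell. The first bounds say that it is not
    exceeded, the variance bound that it is attained up to a constant, and the last one that it is
    no smaller than at a critical point of order [N]. *)
Definition good_cell b (b1 : R -> R) N (c y0 y1 : R) := exists a : R,
  [/\ 0 < a,
    (forall y, y0 <= y <= y1 -> `|b y - mean y0 y1 b| <= a),
    (forall y, y0 <= y <= y1 -> `|b1 y| <= a / (y1 - y0)),
    c * a ^+ 2 <= mean y0 y1 (fun y => (b y - mean y0 y1 b) ^+ 2) &
    c * (y1 - y0) ^+ N.+1 <= a].

(** On the half of the cell away from [p], [|y - p|] is comparable to its maximum [D], so [|b1|] is
    comparable to [D ^+ n] there. Upper and lower bounds then carry the same power of [D], which
    cancels: the constant depends neither on the cell nor on its distance to [p]. *)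
Lemma cell_near_critical b (b1 : R -> R) (N n : nat) (p rho m M : R) : cts b1 ->
  (forall y, hasd b y (b1 y)) -> (n <= N)%N -> 0 < m -> 0 < M ->
  (forall y, `|y - p| < rho -> m * `|y - p| ^+ n <= `|b1 y| <= M * `|y - p| ^+ n) ->
  exists2 c : R, 0 < c & forall y0 y1, y0 < y1 -> y1 - y0 <= 1 ->
    (forall y, y0 <= y <= y1 -> `|y - p| < rho) ->
    good_cell b b1 N c y0 y1.
Proof.
move=> cb1 db nN m0 M0 bnd; have cb : cts b by exact: hasd_cont db.
(* One factor [32] is the length of the steep piece relative to the cell, the other two and
   [16 ^+ n] come from squaring [d / 32 * (m * (D / 4) ^+ n)]. In [c2], [2 ^+ n] comes from
   [d / 2 <= D]. *)
pose c1 := (m / M) ^+ 2 / (32 ^+ 3 * 16 ^+ n).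
pose c2 := M / 2 ^+ n.
have c10 : 0 < c1.
  by apply: divr_gt0; [rewrite exprn_gt0// divr_gt0|rewrite mulr_gt0// exprn_gt0].
have c20 : 0 < c2 by apply: divr_gt0 => //; exact: exprn_gt0.
exists (Num.min c1 c2); first by rewrite lt_min c10.
move=> y0 y1 y01 d1 Jrho; have d0 : 0 < y1 - y0 by rewrite subr_gt0.
set d := y1 - y0 in d0 d1 *.
pose mid := (y0 + y1) / 2.
pose D := Num.max (y1 - p) (p - y0).
have D1 : y1 - p <= D by rewrite le_max lexx.
have D2 : p - y0 <= D by rewrite le_max lexx orbT.
have Dd : d / 2 <= D by rewrite /d; lra.
have D0 : 0 < D by apply: lt_le_trans Dd; rewrite divr_gt0.
have JD y : y0 <= y <= y1 -> `|y - p| <= D.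
  by move=> /andP[h0 h1]; rewrite ler_norml; apply/andP; split; lra.
pose a := d * (M * D ^+ n).
have a0 : 0 < a by rewrite !mulr_gt0 ?exprn_gt0.
have b1M y : y0 <= y <= y1 -> `|b1 y| <= M * D ^+ n.
  move=> yy; have /andP[_ h] := bnd y (Jrho y yy); apply: le_trans h _.
  by rewrite ler_wpM2l ?(ltW M0)// lerXn2r ?nnegrE ?JD// ltW.
have osc y z : y0 <= y <= y1 -> y0 <= z <= y1 -> `|b y - b z| <= a.
  move=> /andP[h0 h1] /andP[k0 k1].
  have [t /andP[t0 t1] ->] := hasd_mvt z y db.
  rewrite normrM mulrC; apply: ler_pM => //.
    by rewrite ler_norml /d; apply/andP; split; lra.
  apply: b1M; apply/andP; split; nra.
(* A piece of length [d / 32] inside the middle half of the cell, where [phi] is bounded below, on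
   the side of [mid] opposite to [p]. *)
have [s [sm sM] sB] : exists2 s, mid - d / 4 <= s /\ s + d / 32 <= mid + d / 4 &
    forall y, s <= y <= s + d / 32 ->
      d / 32 * (m * (D / 4) ^+ n) <= `|b y - mean y0 y1 b|.
  have l0 : 0 < d / 32 by rewrite divr_gt0.
  have mm0 : 0 < m * (D / 4) ^+ n by rewrite mulr_gt0// exprn_gt0// divr_gt0.
  have lower y : y0 <= y <= y1 -> D / 4 <= `|y - p| -> m * (D / 4) ^+ n <= `|b1 y|.
    move=> yy h; have /andP[lo _] := bnd y (Jrho y yy); apply: le_trans lo.
    by rewrite ler_wpM2l ?(ltW m0)// lerXn2r ?nnegrE// divr_ge0// ltW.
  have [pm|pm] := leP p mid.
    have [|s sp H] := @steep_subinterval b b1 (mid + d / 8) (d / 32) _ (mean y0 y1 b) cb1 db l0 mm0.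
      move=> y /andP[h0 h1]; apply: lower.
        by apply/andP; split; move: h0 h1; rewrite /mid /d; lra.
      apply: le_trans (ler_norm _).
      have : D <= d / 2 + (mid - p).
        by rewrite /D ge_max; apply/andP; split; move: pm; rewrite /mid /d; lra.
      by move: h0 d0 pm; clear; lra.
    exists s => //; move: sp => /andP[]; clear -d0; split; lra.
  have [|s sp H] := @steep_subinterval b b1 (mid - d / 4) (d / 32) _ (mean y0 y1 b) cb1 db l0 mm0.
    move=> y /andP[h0 h1]; apply: lower.
      by apply/andP; split; move: h0 h1; rewrite /mid /d; lra.
    rewrite distrC; apply: le_trans (ler_norm _).
    have : D <= d / 2 + (p - mid).
      by rewrite /D ge_max; apply/andP; split; move: pm; rewrite /mid /d; lra.
    by move: h1 d0 pm; clear; lra.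
  exists s => //; move: sp => /andP[]; clear -d0; split; lra.
exists a; split=> //.
- move=> y yy.
  have -> : b y - mean y0 y1 b = mean y0 y1 (fun z => b y + -1 * b z).
    by rewrite meanD ?meanZ ?(mean_cst y01); [rewrite mulN1r|ctst..].
  rewrite ler_norml; apply/andP; split.
    rewrite -(mean_cst y01 (- a)); apply: le_mean => //; [ctst..|move=> z zz].
    by have := osc y z yy zz; rewrite ler_norml mulN1r => /andP[].
  rewrite -(mean_cst y01 a); apply: le_mean => //; [ctst..|move=> z zz].
  by have := osc y z yy zz; rewrite ler_norml mulN1r => /andP[].
- by move=> y /b1M h; rewrite /a mulrC mulKf// gt_eqF.
- have y0s : y0 <= s by move: sm; rewrite /mid /d; lra.
  have sy1 : s + d / 32 <= y1 by move: sM; rewrite /mid /d; lra.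
  have cw : cts (fun y => phi y0 y1 y * (b y - mean y0 y1 b) ^+ 2).
    by have := @cts_phi R y0 y1; ctst.
  have w0 y : y0 <= y <= y1 -> 0 <= phi y0 y1 y * (b y - mean y0 y1 b) ^+ 2.
    by move=> yy; rewrite mulr_ge0 ?sqr_ge0//; case/andP: (phi_itv y01 yy).
  have ss : s <= s + d / 32 by rewrite lerDl divr_ge0// ltW.
  apply: (@le_trans _ _ (rint s (s + d / 32)
      (fun y => phi y0 y1 y * (b y - mean y0 y1 b) ^+ 2))); last first.
    rewrite /mean -(rint_chasles y0 s y1 cw) -(rint_chasles s (s + d / 32) y1 cw).
    rewrite addrCA lerDl addr_ge0//.
      by apply: rint_ge0 => // y /andP[h0 h1]; apply: w0; rewrite h0 (le_trans h1)// (le_trans ss).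
    by apply: rint_ge0 => // y /andP[h0 h1]; apply: w0; rewrite h1 (le_trans _ h0)// (le_trans y0s).
  apply: (@le_trans _ _ (rint s (s + d / 32)
      (fun=> d^-1 * (d / 32 * (m * (D / 4) ^+ n)) ^+ 2))); last first.
    apply: le_rint => //; [ctst|move=> y yy].
    have dlow : 0 <= d / 32 * (m * (D / 4) ^+ n).
      by rewrite !mulr_ge0 ?exprn_ge0 ?mulr_ge0// ltW.
    apply: ler_pM; [by rewrite invr_ge0 ltW|exact: sqr_ge0| |].
      apply: phi_mid => //; case/andP: yy => h0 h1.
      by apply/andP; split; [exact: le_trans h0|exact: le_trans sM].
    rewrite -[leRHS]real_normK ?num_real// lerXn2r ?nnegrE//.
    exact: sB.
  rewrite rint_cst; apply: (@le_trans _ _ (c1 * a ^+ 2)).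
    by rewrite ler_wpM2r ?sqr_ge0// ge_min lexx.
  rewrite le_eqVlt; apply/orP; left; apply/eqP; rewrite /c1 /a.
  have -> : (16 : R) ^+ n = (4 ^+ n) ^+ 2 by rewrite -exprM mulnC exprM; congr (_ ^+ n); ring.
  rewrite (expr_div_n D 4 n).
  have : (4 : R) ^+ n != 0 by rewrite expf_neq0.
  have : D ^+ n != 0 by rewrite expf_neq0// gt_eqF.
  move: (D ^+ n) (4 ^+ n) => A B A0 B0.
  by field; rewrite B0 !gt_eqF.
- apply: (@le_trans _ _ (c2 * d ^+ n.+1)).
    apply: ler_pM; [by rewrite le_min !ltW|by rewrite exprn_ge0// ltW| |].
      by rewrite ge_min lexx orbT.
    by apply: ler_wiXn2l => //; exact: ltW.
  rewrite /c2 /a exprS.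
  have -> : M / 2 ^+ n * (d * d ^+ n) = d * (M * (d / 2) ^+ n).
    by rewrite (expr_div_n d 2 n); ring.
  rewrite ler_wpM2l ?(ltW d0)// ler_wpM2l ?(ltW M0)// lerXn2r ?nnegrE//.
  + by rewrite divr_ge0// ltW.
  + exact: ltW.
Qed.

(** Compactness of [[0, 1]], run along the filter [+oo] for a parameter [C] whose inverse is at once
    the mesh bound and the constant; shrinking the constant keeps a cell good. *)
Lemma cells_good b (b1 : R -> R) N : cts b1 -> (forall y, hasd b y (b1 y)) ->
  (forall p, 0 <= p <= 1 -> exists n rho m M, [/\ (n <= N)%N, 0 < rho, 0 < m, 0 < M &
    forall y, `|y - p| < rho -> m * `|y - p| ^+ n <= `|b1 y| <= M * `|y - p| ^+ n]) ->
  exists2 c : R, 0 < c & forall y0 y1, 0 <= y0 -> y0 < y1 -> y1 <= 1 ->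
    y1 - y0 <= c -> good_cell b b1 N c y0 y1.
Proof.
move=> cb1 db H.
have weaken c c' y0 y1 : 0 <= c' <= c -> y0 < y1 -> good_cell b b1 N c y0 y1 ->
    good_cell b b1 N c' y0 y1.
  move=> /andP[c'0 c'c] y01 [a [a0 h1 h2 h3 h4]]; exists a; split=> //.
    by apply: le_trans h3; rewrite ler_wpM2r// sqr_ge0.
  by apply: le_trans h4; rewrite ler_wpM2r// exprn_ge0// subr_ge0 ltW.
have /compact_near_coveringP K : compact (`[0, 1] : set R) by exact: segment_compact.
have := K R (+oo : set_system R) (fun C y => forall y0 y1, y0 <= y <= y1 ->
  y0 < y1 -> y1 - y0 <= C^-1 -> good_cell b b1 N C^-1 y0 y1) _ _.
case=> [p|C [_ HC]].
  rewrite /= in_itv/= => /H[n [rho [m [M [nN rho0 m0 M0 bnd]]]]].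
  have [c c0 Hc] := cell_near_critical cb1 db nN m0 M0 bnd.
  exists ([set y | `|p - y| < rho / 2], [set C | Num.max 1 (Num.max c^-1 (2 / rho)) < C]).
    split=> /=; first by exists (rho / 2) => //=; rewrite divr_gt0.
    exists (Num.max 1 (Num.max c^-1 (2 / rho))); split => //; exact: num_real.
  move=> [y C] /= [yp]; rewrite !gt_max => /and3P[C1 Cc Cr] y0 y1 /andP[y0y yy1] y01 yC.
  have C0 : 0 < C by apply: lt_trans C1.
  have iC : C^-1 <= c by rewrite -[c]invrK lef_pV2 ?posrE ?invr_gt0// ltW.
  have iC1 : C^-1 <= 1 by rewrite invf_le1// ltW.
  have iC2 : C^-1 < rho / 2.
    by rewrite -[rho / 2]invrK invf_div ltf_pV2 ?posrE ?divr_gt0.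
  apply: (weaken c) => //; first by rewrite invr_ge0 ltW.
  apply: Hc => // [|z /andP[z0 z1]]; first exact: le_trans iC1.
  move: yp; rewrite !ltr_norml => /andP[q1 q2]; apply/andP; split; lra.
(* The threshold [C] given by the filter may be negative; this value is positive and beyond it. *)
have C10 : 0 < C + `|C| + 1 by have := ler_norm (- C); rewrite normrN; lra.
have CC : C < C + `|C| + 1 by have := normr_ge0 C; lra.
exists (C + `|C| + 1)^-1; first by rewrite invr_gt0.
move=> y0 y1 h0 h1 h2 h3; apply: (HC _ CC y0) => //=.
  by rewrite in_itv/= h0 (le_trans (ltW h1)).
by rewrite lexx ltW.
Qed.

End Geometry.

(** * Vanishing order of the derivative of the profile *)

Section Profile.
Context {R : realType}.

Lemma smooth1_hasd (f : R -> R) n y : smooth1 f -> hasd (derive1n n f) y (derive1n n.+1 f y).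
Proof. by move=> sf; split; [exact: sf|rewrite derive1nS derive1E]. Qed.

Lemma smooth1_cts (f : R -> R) n : smooth1 f -> cts (derive1n n f).
Proof. by move=> sf; apply: hasd_cont => y; exact: smooth1_hasd. Qed.

Lemma derive1n_periodic (f : R -> R) n : smooth1 f -> one_periodic f ->
  one_periodic (derive1n n f).
Proof.
move=> sf pf; elim: n => [//|n IH] y.
have d1 := hasd_shift (@smooth1_hasd f n (y + 1) sf).
have e : (fun y => derive1n n f (y + 1)) = derive1n n f by apply/funext => z; exact: IH.
rewrite e in d1.
have [_ <-] := d1; have [_ <-] := @smooth1_hasd f n y sf; by [].
Qed.

(** The exponent is [Nc i] at a critical point and [0] elsewhere. By continuity the derivative of
    [b] of order [n.+1] stays between half and twice its size at [p], and [vanishing_order_bounds]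
    is applied to [derive1 b]. *)
Lemma profile_nondegenerate (D : ydomain) (b : R -> R) (M : nat)
    (yc : 'I_M -> R) (Nc : 'I_M -> nat) :
  smooth_profile D b -> is_critical_data D b yc Nc ->
  forall p, 0 <= p <= 1 -> exists n rho m K,
    [/\ (n <= \max_(i < M) Nc i)%N, 0 < rho, 0 < m, 0 < K &
    forall y, `|y - p| < rho ->
      m * `|y - p| ^+ n <= `|derive1 b y| <= K * `|y - p| ^+ n].
Proof.
move=> [sb pb] [_ crit _ van nvan] p p01.
have [n [nN f0 fn]] : exists n, [/\ (n <= \max_(i < M) Nc i)%N,
    forall k, (k < n)%N -> derive1n k.+1 b p = 0 & derive1n n.+1 b p != 0].
  have [b0|b0] := eqVneq (derive1 b p) 0; last by exists 0%N; split => //; rewrite derive1n1.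
  (* On the circle the representatives are [[0, 1[], so [p = 1] is replaced by [0], where all
     derivatives agree by periodicity. *)
  have [q [qD qp]] : exists q, closed_ydomain D q /\ forall k, derive1n k b q = derive1n k b p.
    have [Dp|nDp] := pselect (closed_ydomain D p); first by exists p.
    move: nDp pb; case: {crit} D => /=; rewrite in_itv/=; last by rewrite p01.
    move/andP: p01 => [p0 p1]; rewrite p0 /= => /negP; rewrite -leNgt => p1' /(_ erefl) pb.
    have -> : p = 0 + 1 by apply/eqP; rewrite add0r eq_le p1 p1'.
    exists 0; split; first by rewrite in_itv/= lexx ltr01.
    by move=> k; rewrite derive1n_periodic.
  have [i qi] : exists i, q = yc i.
    by apply/crit; split => //; rewrite -derive1n1 qp derive1n1.
  exists (Nc i); split.
  - exact: leq_bigmax.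
  - by move=> k kn; rewrite -qp qi van.
  - by rewrite -qp qi nvan.
have cn := @smooth1_cts b n.+1 sb.
have e0 : 0 < `|derive1n n.+1 b p| / 2 by rewrite divr_gt0// normr_gt0.
have /cvgrPdist_lt/(_ _ e0)[rho /= rho0 Hrho] := cn p.
set A := `|derive1n n.+1 b p| in e0 Hrho.
exists n, rho, (A / 2 / n`!%:R), (2 * A / n`!%:R).
have nf : 0 < n`!%:R :> R by rewrite ltr0n fact_gt0.
have A0 : 0 < A by rewrite normr_gt0.
split=> //; [by rewrite !divr_gt0|by rewrite divr_gt0// mulr_gt0|move=> y yp].
have bnd z : `|z - p| < rho -> A / 2 <= `|derive1n n.+1 b z| <= 2 * A.
  move=> zp; have := Hrho z; rewrite /ball_/= distrC => /(_ zp) h.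
  have h1 := ler_dist_dist (derive1n n.+1 b p) (derive1n n.+1 b z).
  have := le_lt_trans h1 h; rewrite -/A ltr_norml => /andP[h2 h3].
  by apply/andP; split; lra.
have := vanishing_order_bounds (f := fun k => derive1n k.+1 b)
  (fun k y => smooth1_hasd k.+1 y sb) f0 bnd yp.
rewrite derive1n1 => /andP[lo hi].
apply/andP; split.
  by rewrite mulrAC ler_pdivrMr// [leRHS]mulrC.
by rewrite [leRHS]mulrAC ler_pdivlMr// mulrC.
Qed.

End Profile.

(** * Integrals over space-time *)

Section Measurability.
Context {R : realType}.
Notation mu := (@lebesgue_measure R).

(* Caratheodory: [f x] is the limit of [f x] at the grid points below [y]. *)
Lemma measurable_caratheodory d (X : measurableType d) (f : X -> R -> R) :
  (forall y, measurable_fun setT (f ^~ y)) -> (forall x, cts (f x)) ->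
  measurable_fun setT (fun p : X * R => f p.1 p.2).
Proof.
move=> mf cf.
pose g n (y : R) : R := (Num.floor (y * n.+1%:R))%:~R / n.+1%:R.
have n0 n : 0 < n.+1%:R :> R by [].
have gy n y : y - n.+1%:R^-1 <= g n y <= y.
  have /andP[h0 h1] := floor_itv (y * n.+1%:R).
  rewrite /g ler_pdivrMr// h0 andbT lerBlDr -{2}[n.+1%:R^-1]mul1r -mulrDl ler_pdivlMr//.
  by apply: ltW; rewrite intrD in h1.
apply: (@measurable_fun_cvg _ _ _ _ (fun n (p : X * R) => f p.1 (g n p.2))).
- move=> n _ A mA; rewrite setTI.
  rewrite (_ : _ @^-1` _ = \bigcup_(k : int) ([set x | A (f x (k%:~R / n.+1%:R))] `*`
      `[k%:~R / n.+1%:R, (k + 1)%:~R / n.+1%:R[)).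
    apply: countable_bigcupT_measurable => [|k]; first exact: countableP.
    apply: measurableX => //.
    by have := mf (k%:~R / n.+1%:R) measurableT A mA; rewrite setTI.
  apply/seteqP; split => [[x y] /= Axy|[x y] [k _ [/= Ax]]].
    exists (Num.floor (y * n.+1%:R)) => //=; split => //=.
    have /andP[h0 h1] := floor_itv (y * n.+1%:R).
    by rewrite in_itv/= ler_pdivrMr// h0 ltr_pdivlMr.
  rewrite in_itv/= ler_pdivrMr// ltr_pdivlMr// => h.
  by rewrite /g (floor_def h).
- move=> [x y] _ /=.
  have gc : g ^~ y @ \oo --> y.
    apply: (@squeeze_cvgr _ _ _ _ (fun n => y - n.+1%:R^-1) (fun=> y)).
    + by apply: nearW => n; exact: gy.
    + rewrite -[X in _ --> X]subr0; apply: cvgB; first exact: cvg_cst.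
      exact: cvg_harmonic.
    + exact: cvg_cst.
  exact: (@continuous_cvg _ _ _ _ _ _ (f x) _ (cf x y) gc).
Qed.

Lemma measurable_cts (f : R -> R) : cts f -> measurable_fun setT f.
Proof. by move=> cf; exact: continuous_measurable_fun. Qed.

Lemma measurable_cts2 (f : R -> R -> R) : cts2 f ->
  measurable_fun setT (fun p : R * R => f p.1 p.2).
Proof.
move=> cf; apply: measurable_caratheodory => x; last by ctst.
by apply: measurable_cts; ctst.
Qed.

Lemma measurable_cts3 (f : R -> R -> R -> R) : cts3 f ->
  measurable_fun setT (fun p : R * R * R => f p.1.1 p.1.2 p.2).
Proof.
move=> cf; apply: (@measurable_caratheodory _ _ (fun (q : R * R) t => f q.1 q.2 t)) => [y|x].
  by apply: (@measurable_cts2 (fun x z => f x z y)); ctst.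
by ctst.
Qed.

Lemma integral_oo_rint (f : R -> R) a b : a < b -> cts f ->
  (\int[mu]_(x in `]a, b[) (f x)%:E = (rint a b f)%:E)%E.
Proof.
move=> ab cf; rewrite rintE// /Rintegral fineK; last first.
  by apply: integrable_fin_num => //; exact: cont_integrable.
rewrite -(@integral_itv_bndoo _ a b _ true false)//.
by apply/measurable_EFinP/measurable_funTS; exact: measurable_cts.
Qed.

Lemma Rintegral_oo_rint (f : R -> R) a b : a < b -> cts f ->
  \int[mu]_(x in `]a, b[) f x = rint a b f.
Proof. by move=> ab cf; rewrite /Rintegral integral_oo_rint. Qed.

(** Tonelli for integrands restricted to a product set; it peels off [t], then [y], in
    [integral_spacetime_ge0]. *)
Lemma integral_prod_oo d (X : measurableType d) (m : {sigma_finite_measure set X -> \bar R})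
  (A : set X) (f : X * R -> R) a b : measurable A -> measurable_fun setT f ->
  (forall p, 0 <= f p) ->
  (\int[m \x mu]_(p in A `*` `]a, b[) (f p)%:E =
   \int[m]_(x in A) \int[mu]_(t in `]a, b[) (f (x, t))%:E)%E.
Proof.
move=> mA mf f0.
have mAB : measurable (A `*` `]a, b[%classic) by exact: measurableX.
pose F := (fun p => (f p)%:E) \_ (A `*` `]a, b[%classic).
have mF : measurable_fun setT F.
  apply/(measurable_restrictT _ mAB)/measurable_EFinP.
  exact: measurable_funTS.
have F0 p : (0 <= F p)%E by rewrite /F patchE; case: ifP => // _; rewrite lee_fin.
transitivity (\int[m \x mu]_z F z)%E; first exact: integral_mkcond.
transitivity (\int[m]_x fubini_F mu F x)%E.
  exact: (@fubini_tonelli1 _ _ _ _ _ m (@lebesgue_measure R) F mF F0).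
rewrite [RHS]integral_mkcond; apply: eq_integral => x _.
rewrite /fubini_F patchE; case: ifPn => xA.
  rewrite [RHS]integral_mkcond; apply: eq_integral => t _.
  rewrite !patchE; congr (if _ then _ else _).
  by apply/idP/idP; rewrite !inE /=; [case|move=> ?; split => //; exact/set_mem].
apply: integral0_eq => t _; rewrite /F patchE ifF//.
by apply/negP; rewrite inE /= => -[xA' _]; move/negP: xA; apply; rewrite inE.
Qed.

(* [mu \x mu] only carries a canonical sigma-finite structure for probabilities. *)
Definition leb2 : set (measurableTypeR R * measurableTypeR R) -> \bar R := (mu \x mu)%E.

HB.instance Definition _ := Measure.on leb2.

Lemma leb2_sigma_finite : sigma_finite setT leb2.
Proof.
exists (fun n => `]- n%:R, n%:R[ `*` `]- n%:R, n%:R[)%classic => [|n].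
  apply/seteqP; split => // -[x y] _; pose n := Num.bound (Num.max `|x| `|y|).
  have [hx hy] : `|x| < n%:R /\ `|y| < n%:R.
    have := archi_boundP (_ : 0 <= Num.max `|x| `|y|); rewrite le_max normr_ge0.
    by move=> /(_ isT); rewrite gt_max => /andP[].
  by exists n => //; split => /=; rewrite in_itv/= -ltr_norml.
split; first by apply: measurableX; exact: measurable_itv.
rewrite /leb2 product_measure1E; [|exact: measurable_itv..].
have fin : (mu [set` `](- n%:R)%R, (n%:R : R)[] < +oo)%E.
  by rewrite lebesgue_measure_itv/=; case: ifP => _; rewrite -?EFinB ltry.
by apply: lte_mul_pinfty => //; rewrite ge0_fin_numE.
Qed.

HB.instance Definition _ := Measure_isSigmaFinite.Build _ _ _ leb2 leb2_sigma_finite.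

(** The integral in [y] is innermost, so that the restriction to a cell of the grid has the shape of
    [box_estimate]. *)
Definition int3 T (f : R -> R -> R -> R) :=
  int2 0 T (fun x t => rint 0 1 (fun y => f x y t)).

Lemma integral_spacetime_ge0 T (f : R -> R -> R -> R) : 0 < T -> cts3 f ->
  (forall x y t, 0 <= f x y t) ->
  (\int[lebesgue3 R]_(p in spacetime T) (f p.1.1 p.1.2 p.2)%:E = (int3 T f)%:E)%E.
Proof.
move=> T0 cf f0.
have mU : measurable (unit_itv R) by exact: measurable_itv.
have c1 : cts2 (fun x y => rint 0 T (f x y)) by ctst.
have c2 : cts (fun x => rint 0 1 (fun y => rint 0 T (f x y))) by ctst.
have r0 x y : 0 <= rint 0 T (f x y).
  by apply: rint_ge0; [exact: ltW|ctst|move=> t _; exact: f0].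
have -> : int3 T f = rint 0 1 (fun x => rint 0 1 (fun y => rint 0 T (f x y))).
  rewrite /int3 int2_swap; last by ctst.
  by apply: eq_rint => x; rewrite (@rint_swap _ (fun t y => f x y t)); ctst.
transitivity (\int[(lebesgue2 R)%E]_(q in unit_itv R `*` unit_itv R)
    \int[mu]_(t in `]0%R, T[) (f q.1 q.2 t)%:E)%E.
  apply: (@integral_prod_oo _ _ leb2 (unit_itv R `*` unit_itv R)
    (fun p => f p.1.1 p.1.2 p.2) 0 T).
  - exact: measurableX.
  - exact: measurable_cts3.
  - by move=> p; exact: f0.
transitivity (\int[(lebesgue2 R)%E]_(q in unit_itv R `*` unit_itv R)
    (rint 0 T (f q.1 q.2))%:E)%E.
  by apply: eq_integral => q _; apply: integral_oo_rint => //; ctst.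
transitivity (\int[mu]_(x in unit_itv R) \int[mu]_(y in `]0%R, 1%R[)
    (rint 0 T (f x y))%:E)%E.
  apply: (@integral_prod_oo _ _ mu (unit_itv R) (fun q => rint 0 T (f q.1 q.2)) 0 1) => //.
  exact: (measurable_cts2 c1).
transitivity (\int[mu]_(x in unit_itv R) (rint 0 1 (fun y => rint 0 T (f x y)))%:E)%E.
  by apply: eq_integral => x _; apply: integral_oo_rint => //; ctst.
by apply: integral_oo_rint.
Qed.

End Measurability.

(** * Smooth cutoffs and the dual norm *)

Section Smooth.
Context {R : realType}.
Notation mu := (@lebesgue_measure R).
Implicit Types f g : R -> R.

Lemma hasd_derive1 f f' : (forall y, hasd f y (f' y)) -> derive1 f = f'.
Proof. by move=> df; apply/funext => y; rewrite derive1E; case: (df y). Qed.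

(** A single derivative that stays in the class suffices; no formula for higher derivatives of
    products or composites is needed. *)
Lemma smooth1_coind (P : (R -> R) -> Prop) :
  (forall f, P f -> exists2 f', (forall y, hasd f y (f' y)) & P f') ->
  forall f, P f -> smooth1 f.
Proof.
move=> HP f Pf n y.
have Pn m : P (derive1n m f).
  elim: m => [//|m IH]; have [f' df Pf'] := HP _ IH.
  by rewrite derive1nS (hasd_derive1 df).
by have [f' df _] := HP _ (Pn n); case: (df y).
Qed.

Lemma hasd_smooth1 f f' : (forall y, hasd f y (f' y)) -> smooth1 f' -> smooth1 f.
Proof.
move=> df sf' [|n] y; first by case: (df y).
by rewrite derive1Sn (hasd_derive1 df).
Qed.

Lemma smooth1_deriv f : smooth1 f -> smooth1 (derive1 f).
Proof. by move=> sf n y; rewrite -derive1Sn; exact: sf. Qed.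

Lemma smooth1_hasd1 f : smooth1 f -> forall y, hasd f y (derive1 f y).
Proof. by move=> sf y; split; [exact: (sf 0%N)|rewrite derive1E]. Qed.

Lemma near_hasd f g y d : (\forall z \near y, f z = g z) -> hasd f y d -> hasd g y d.
Proof. exact: near_eq_is_derive. Qed.

(* The function [y^(-k) exp(-1/y)] extended by [0] to [y <= 0]. *)
Definition flat k (y : R) : R := if 0 < y then y ^- k * expR (- y^-1) else 0.

(** The exponential series gives [exp(1/y) >= y^-(k+2) / (k+2)!]. A quadratic bound is what makes
    the derivative at [0] vanish. *)
Lemma flat_small k (y : R) : `|flat k y| <= k.+2`!%:R * `|y| ^+ 2.
Proof.
rewrite /flat; case: ifPn => [y0|_]; last by rewrite normr0 mulr_ge0.
rewrite gtr0_norm ?mulr_gt0 ?expR_gt0 ?invr_gt0 ?exprn_gt0// gtr0_norm//.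
have h : y^-1 ^+ k.+2 / k.+2`!%:R <= expR y^-1.
  have yi : 0 <= y^-1 by rewrite invr_ge0 ltW.
  apply: le_trans (expR_ge1Dxn k.+1 yi); rewrite lerDr; exact: ler01.
rewrite expRN -exprVn ler_pdivrMr ?expR_gt0//.
have f0 : 0 < k.+2`!%:R :> R by rewrite ltr0n fact_gt0.
apply: (@le_trans _ _ (k.+2`!%:R * y ^+ 2 * (y^-1 ^+ k.+2 / k.+2`!%:R))).
  rewrite le_eqVlt; apply/orP; left; apply/eqP.
  rewrite -[k.+2]addn2 exprD mulrACA [_ * (_ / _)]mulrC.
  by field; rewrite !gt_eqF.
by rewrite ler_wpM2l// mulr_ge0 ?sqr_ge0// ltW.
Qed.

Lemma hasd_flat k y : hasd (flat k) y (- k%:R * flat k.+1 y + flat k.+2 y).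
Proof.
have [y0|y0|->] := ltgtP y 0.
- have -> : - k%:R * flat k.+1 y + flat k.+2 y = 0.
    by rewrite /flat !ifN ?mulr0 ?addr0// -leNgt ltW.
  apply: (near_hasd (f := fun=> 0)); last exact: hasd_cst.
  near=> z; rewrite /flat ifN// -leNgt; apply: ltW.
  by near: z; exact: lt_nbhsl.
- apply: (near_hasd (f := fun z => z ^- k * expR (- z^-1))).
    near=> z; rewrite /flat ifT//.
    by near: z; exact: lt_nbhsr.
  have yn : y != 0 by rewrite gt_eqF.
  have d1 : hasd (fun z => z^-1) y (- y ^- 2).
    have h : hasd (fun z => z^-1) y (- y ^- 2 * 1) := is_deriveV yn (hasd_id y).
    by rewrite mulr1 in h.
  have d2 n : hasd (fun z => z^-1 ^+ n) y (- (n%:R * y ^- n.+1)).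
    elim: n => [|n IH].
      by rewrite mul0r oppr0; apply: hasd_eq (hasd_cst 1 y) _.
    rewrite (_ : (fun z => _) = fun z => z^-1 * z^-1 ^+ n); last first.
      by apply/funext => z; rewrite exprS.
    apply: hasd_eq (hasdM d1 IH) _; rewrite -natr1 -!exprVn !exprS; ring.
  have d3 : hasd (fun z => expR (- z^-1)) y (expR (- y^-1) * y ^- 2).
    apply: hasd_eq (hasd_comp (F := expR) (is_derive_expR _) (hasdN d1)) _.
    by rewrite opprK.
  have := hasdM (d2 k) d3; rewrite (_ : (fun z => _) = fun z => z ^- k * expR (- z^-1)).
    move=> h; apply: hasd_eq h _; rewrite /flat y0 -!exprVn !exprS; ring.
  by apply/funext => z; rewrite exprVn.
- have -> : - k%:R * flat k.+1 0 + flat k.+2 0 = 0.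
    by rewrite /flat ltxx mulr0 addr0.
  suff H : (fun h : R => h^-1 *: (flat k (h *: 1 + 0) - flat k 0)) @ 0^' --> (0 : R).
    split; first by apply/cvg_ex; exists 0.
    exact: cvg_lim H.
  apply/cvgrPdist_le => e e0.
  have f0 : 0 < k.+2`!%:R :> R by rewrite ltr0n fact_gt0.
  exists (e / k.+2`!%:R) => /=; first by rewrite divr_gt0.
  move=> h; rewrite /ball_/= sub0r normrN => hd h0.
  have -> : flat k 0 = 0 by rewrite /flat ltxx.
  rewrite subr0 sub0r normrN /GRing.scale/= mulr1 addr0 normrM normfV.
  rewrite ler_pdivrMl ?normr_gt0//; apply: le_trans (flat_small k h) _.
  rewrite expr2 mulrA mulrC ler_wpM2l// mulrC -ler_pdivlMr//.
  exact: ltW.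
Unshelve. all: by end_near. Qed.

(** A class generated so as to be stable under differentiation, to which [smooth1_coind] applies. *)
Inductive smooth_gen : (R -> R) -> Prop :=
| SG_smooth f : smooth1 f -> smooth_gen f
| SG_flat k : smooth_gen (flat k)
| SG_cst c : smooth_gen (fun=> c)
| SG_add f g : smooth_gen f -> smooth_gen g -> smooth_gen (fun y => f y + g y)
| SG_mul f g : smooth_gen f -> smooth_gen g -> smooth_gen (fun y => f y * g y)
| SG_aff f a c : smooth_gen f -> smooth_gen (fun y => f (a + y * c)).

Lemma smooth_gen_smooth f : smooth_gen f -> smooth1 f.
Proof.
apply: (smooth1_coind (P := smooth_gen)) => {}f; elim.
- move=> {}f sf; exists (derive1 f); first exact: smooth1_hasd1.
  by apply: SG_smooth; exact: smooth1_deriv.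
- move=> k; exists (fun y => - k%:R * flat k.+1 y + flat k.+2 y).
    exact: hasd_flat.
  by apply: SG_add (SG_flat _); apply: SG_mul (SG_cst _) (SG_flat _).
- by move=> c; exists (fun=> 0); [move=> y; exact: hasd_cst|exact: SG_cst].
- move=> {}f g _ [f' df sf'] _ [g' dg sg']; exists (fun y => f' y + g' y).
    by move=> y; exact: hasdD.
  exact: SG_add.
- move=> {}f g sf [f' df sf'] sg [g' dg sg']; exists (fun y => f' y * g y + f y * g' y).
    by move=> y; exact: hasdM.
  by apply: SG_add; exact: SG_mul.
- move=> {}f a c sf [f' df sf']; exists (fun y => f' (a + y * c) * c).
    by move=> y; apply: (hasd_comp (df _) (@hasd_affine _ _ _ _)).
  by apply: SG_mul (SG_cst _); exact: SG_aff.
Qed.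

(** A product of two copies of [flat 0], rescaled by [e ^+ 2]. On [[2e, 1 - 2e]] both arguments are
    at least [1 / e], so each factor is within [e] of [1]; this costs at most [2e], and the
    remaining set has length [4e]. The cutoff need not equal [1] anywhere. *)
Lemma smooth_cutoff (e : R) : 0 < e -> e <= 1 / 6 -> exists chi : R -> R,
  [/\ smooth1 chi, (forall y, 0 <= chi y <= 1),
    (forall y, ~~ (e <= y <= 1 - e) -> chi y = 0) &
    rint 0 1 (fun y => 1 - chi y) <= 6 * e].
Proof.
move=> e0 e6; have e2 : 0 < e ^+ 2 by rewrite exprn_gt0.
have ord : [/\ 0 <= 2 * e, 2 * e <= 1 - 2 * e & 1 - 2 * e <= 1] by split; lra.
have sum : 2 * e - 0 + (2 * e * (1 - 2 * e - 2 * e) + (1 - (1 - 2 * e))) <= 6 * e.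
  by nra.
have mul2 (A A' : R) : 0 <= A <= 1 -> 0 <= A' <= 1 -> 1 - A <= e -> 1 - A' <= e ->
    1 - A * A' <= 2 * e.
  by move=> /andP[? ?] /andP[? ?] ? ?; nra.
have low y : 2 * e <= y -> e <= - e + y by lra.
have upp y : y <= 1 - 2 * e -> e <= 1 - e - y by lra.
have out1 y : y < e -> - e + y <= 0 by lra.
have out2 y : 1 - e < y -> 1 - e - y <= 0 by lra.
have compl (A : R) : 0 <= A -> 1 - A <= 1 by lra.
pose chi y := flat 0 (- e / e ^+ 2 + y * (e ^+ 2)^-1) *
              flat 0 ((1 - e) / e ^+ 2 + y * - (e ^+ 2)^-1).
have schi : smooth1 chi.
  by apply: smooth_gen_smooth; apply: SG_mul; apply: SG_aff; exact: SG_flat.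
have flat01 y : 0 <= flat 0 y <= 1.
  rewrite /flat; case: ifPn => [y0|_]; last by rewrite lexx ler01.
  rewrite expr0 invr1 mul1r expR_ge0/= -[leRHS]expR0 ler_expR.
  by rewrite oppr_le0 invr_ge0 ltW.
have flat1 y : 1 / e <= y -> 1 - flat 0 y <= e.
  move=> ey; have y0 : 0 < y by apply: lt_le_trans ey; rewrite divr_gt0.
  rewrite /flat y0 expr0 invr1 mul1r.
  have := expR_ge1Dx (- y^-1).
  have : y^-1 <= e by rewrite -[e]invrK lef_pV2 ?posrE ?invr_gt0// -[e^-1]mul1r.
  lra.
have chi01 y : 0 <= chi y <= 1.
  have /andP[a0 a1] := flat01 (- e / e ^+ 2 + y * (e ^+ 2)^-1).
  have /andP[b0 b1] := flat01 ((1 - e) / e ^+ 2 + y * - (e ^+ 2)^-1).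
  by rewrite mulr_ge0//= mulr_ile1.
exists chi; split => //.
- move=> y; rewrite negb_and -!ltNge => /orP[ye|ye].
    rewrite /chi {1}/flat ifN ?mul0r// -leNgt -mulrDl pmulr_lle0 ?invr_gt0//.
    exact: out1.
  rewrite /chi {2}/flat ifN ?mulr0// -leNgt mulrN -mulrBl pmulr_lle0 ?invr_gt0//.
  exact: out2.
- have cchi : cts chi := @smooth1_cts _ _ 0 schi.
  have c1 : cts (fun y => 1 - chi y) by ctst.
  have [w1 w2 w3] := ord.
  rewrite -(rint_chasles 0 (2 * e) 1 c1) -(rint_chasles (2 * e) (1 - 2 * e) 1 c1).
  have triv p q : p <= q -> rint p q (fun y => 1 - chi y) <= q - p.
    move=> pq; rewrite -[leRHS]mul1r -rint_cst; apply: le_rint => //; first by ctst.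
    by move=> y _; apply: compl; case/andP: (chi01 y).
  have h1 := triv 0 (2 * e) w1; have h3 := triv (1 - 2 * e) 1 w3.
  have ee : 1 / e * e ^+ 2 = e by field; rewrite gt_eqF.
  have h2 : rint (2 * e) (1 - 2 * e) (fun y => 1 - chi y) <= 2 * e * (1 - 2 * e - 2 * e).
    rewrite -rint_cst; apply: le_rint => //; [ctst|move=> y /andP[y0 y1]].
    apply: mul2 => //; apply: flat1.
      by rewrite -mulrDl ler_pdivlMr// ee low.
    by rewrite mulrN -mulrBl ler_pdivlMr// ee upp.
  exact: le_trans (lerD h1 (lerD h2 h3)) sum.
Qed.

End Smooth.

(** * Norms and signed integrals of continuous functions *)

Section L2.
Context {R : realType}.
Notation mu := (@lebesgue_measure R).

Lemma L2normE d (X : measurableType d) (m : {measure set X -> \bar R}) (A : set X)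
    (f : X -> R) :
  L2norm m A f = poweR (\int[m]_(x in A) (f x ^+ 2)%:E)%E 2^-1.
Proof.
rewrite /L2norm unlock; congr poweR; rewrite [RHS]integral_mkcond.
apply: eq_integral => x _ /=; rewrite !patchE; case: ifP => _ /=.
  by rewrite (@powR_mulrn _ _ 2)// real_normK// num_real.
by rewrite -[LHS]/((`|0 : R| `^ 2)%:E) normr0 powR0.
Qed.

Lemma L2norm_unit_itv (f : R -> R) : cts f ->
  L2norm mu (unit_itv R) f = (Num.sqrt (rint 0 1 (fun y => f y ^+ 2)))%:E.
Proof.
move=> cf; rewrite L2normE integral_oo_rint//; last by ctst.
rewrite poweR_EFin powR12_sqrt//; apply: rint_ge0 => //; first by ctst.
by move=> y _; exact: sqr_ge0.
Qed.

Lemma int3_ge0 T (f : R -> R -> R -> R) : 0 < T -> cts3 f ->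
  (forall x y t, 0 <= f x y t) -> 0 <= int3 T f.
Proof.
move=> T0 cf f0; apply: int2_ge0; [exact: ltW|ctst|move=> x t _].
by apply: rint_ge0 => //; ctst.
Qed.

Lemma L2norm_spacetime T (f : R * R * R -> R) : 0 < T ->
  cts3 (fun x y t => f (x, y, t)) ->
  L2norm (lebesgue3 R) (spacetime T) f =
  (Num.sqrt (int3 T (fun x y t => f (x, y, t) ^+ 2)))%:E.
Proof.
move=> T0 cf.
have E := @integral_spacetime_ge0 _ T (fun x y t => f (x, y, t) ^+ 2) T0 _
  (fun x y t => sqr_ge0 _).
rewrite L2normE; transitivity (poweR (int3 T (fun x y t => f (x, y, t) ^+ 2))%:E 2^-1).
  congr (poweR _ _); rewrite -E; last by ctst.
  by apply: eq_integral => -[[x y] t] _.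
rewrite poweR_EFin powR12_sqrt//; apply: int3_ge0 => //; first by ctst.
by move=> x y t; exact: sqr_ge0.
Qed.

Lemma int3D T (f g : R -> R -> R -> R) : cts3 f -> cts3 g ->
  int3 T (fun x y t => f x y t + g x y t) = int3 T f + int3 T g.
Proof.
move=> cf cg; rewrite /int3 -int2D; [|ctst..].
by apply: eq_int2 => x t; rewrite rintD//; ctst.
Qed.

Lemma int3Z T c (f : R -> R -> R -> R) : cts3 f ->
  int3 T (fun x y t => c * f x y t) = c * int3 T f.
Proof.
move=> cf; rewrite /int3 -int2Z; [|ctst..].
by apply: eq_int2 => x t; rewrite rintZ//; ctst.
Qed.

Lemma eq_int3 T (f g : R -> R -> R -> R) : (forall x y t, f x y t = g x y t) ->
  int3 T f = int3 T g.
Proof. by move=> fg; apply: eq_int2 => x t; exact: eq_rint. Qed.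

(** Reduction to the nonnegative case by [f = (f + |f|) - |f|], which keeps both parts
    continuous. *)
Lemma integral_spacetime T (f : R * R * R -> R) : 0 < T ->
  cts3 (fun x y t => f (x, y, t)) ->
  (\int[lebesgue3 R]_(p in spacetime T) (f p)%:E =
   (int3 T (fun x y t => f (x, y, t)))%:E)%E.
Proof.
move=> T0 cf; pose g x y t := `|f (x, y, t)|.
pose h x y t := f (x, y, t) + `|f (x, y, t)|.
have cg : cts3 g by rewrite /g; ctst.
have ch : cts3 h by rewrite /h; ctst.
have Eg := integral_spacetime_ge0 T0 cg (fun x y t => normr_ge0 _).
have h0 x y t : 0 <= h x y t.
  by rewrite /h; have := ler_norm (- f (x, y, t)); rewrite normrN; lra.
have Eh := integral_spacetime_ge0 T0 ch h0.
have mA : measurable (spacetime T).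
  by apply: measurableX; [apply: measurableX|]; exact: measurable_itv.
have int_ge0 (k : R -> R -> R -> R) : cts3 k -> (forall x y t, 0 <= k x y t) ->
    (lebesgue3 R).-integrable (spacetime T) (EFin \o (fun p => k p.1.1 p.1.2 p.2)).
  move=> ck k0; apply/integrableP; split.
    by apply/measurable_EFinP/measurable_funTS; exact: measurable_cts3.
  under eq_integral do rewrite /= ger0_norm//.
  by rewrite integral_spacetime_ge0// ltry.
transitivity (\int[lebesgue3 R]_(p in spacetime T)
   ((h p.1.1 p.1.2 p.2)%:E - (g p.1.1 p.1.2 p.2)%:E))%E.
  by apply: eq_integral => -[[x y] t] _; rewrite /h /g -EFinB addrK.
transitivity (\int[lebesgue3 R]_(p in spacetime T) (h p.1.1 p.1.2 p.2)%:E -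
    \int[lebesgue3 R]_(p in spacetime T) (g p.1.1 p.1.2 p.2)%:E)%E.
  apply: integralB_EFin; [exact: mA|exact: (int_ge0 h)|].
  by apply: (int_ge0 g) => // x y t; exact: normr_ge0.
transitivity ((int3 T h)%:E - (int3 T g)%:E)%E; first exact: (congr2 _ Eh (congr1 _ Eg)).
have -> : int3 T (fun x y t => f (x, y, t)) = int3 T (fun x y t => h x y t + -1 * g x y t).
  by apply: eq_int3 => x y t; rewrite mulN1r /h /g addrK.
by rewrite int3D ?int3Z ?mulN1r//; ctst.
Qed.

End L2.

(** * Primitives vanishing at both ends lie in the closure of the test functions *)

Section TestFunctions.
Context {R : realType}.
Notation mu := (@lebesgue_measure R).

Lemma cts_bounded01 (g : R -> R) : cts g ->
  exists2 K, 0 < K & forall y, 0 <= y <= 1 -> `|g y| <= K.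
Proof.
move=> cg; have cn : cts (fun y => `|g y|) by ctst.
have [c _ H] := EVT_max (ler01 : 0 <= 1 :> R) (continuous_subspaceT cn).
exists (`|g c| + 1) => [|y y01]; first by rewrite ltr_wpDl.
by apply: (@le_trans _ _ `|g c|); [apply: H; rewrite in_itv|rewrite lerDl].
Qed.

(** Multiplying [f] by a cutoff would differentiate the cutoff; instead [g] is cut off and
    integrated. The constant [c] restores a zero total integral, so that the primitive of
    [chi * (g - c)] has compact support, and [c] is small because [g] itself integrates to zero. *)
Lemma H10_primitive (f g : R -> R) : (forall y, hasd f y (g y)) -> smooth1 g ->
  f 0 = 0 -> f 1 = 0 -> H10_slice f g.
Proof.
move=> df sg f0 f1 e e0.
have cg : cts g := @smooth1_cts _ g 0 sg.
have [K K0 gK] := cts_bounded01 cg; have K0w := ltW K0.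
(* The bound [1 / 12] keeps the lost mass [eta <= 6 * eps] below one half; the other bound makes the
   final error [36 * K ^+ 2 * eps] at most [(e / 2) ^+ 2]. *)
pose eps := Num.min (1 / 12) (e ^+ 2 / (144 * K ^+ 2)).
have den0 : 0 < 144 * K ^+ 2 by rewrite mulr_gt0// exprn_gt0.
have eps0 : 0 < eps by rewrite /eps lt_min !divr_gt0// exprn_gt0.
have epsE : 36 * K ^+ 2 * eps <= (e / 2) ^+ 2.
  apply: (@le_trans _ _ (36 * K ^+ 2 * (e ^+ 2 / (144 * K ^+ 2)))).
    by apply: ler_wpM2l; [rewrite mulr_ge0 ?sqr_ge0|rewrite /eps ge_min lexx orbT].
  by rewrite le_eqVlt; apply/orP; left; apply/eqP; field; rewrite gt_eqF.
have eps12 : eps <= 1 / 12 by rewrite /eps ge_min lexx.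
have {den0} [chi [schi chi01 chi0 chiI]] : exists chi : R -> R,
  [/\ smooth1 chi, (forall y, 0 <= chi y <= 1),
    (forall y, ~~ (eps <= y <= 1 - eps) -> chi y = 0) &
    rint 0 1 (fun y => 1 - chi y) <= 6 * eps].
  by apply: smooth_cutoff => //; lra.
have cchi : cts chi := @smooth1_cts _ chi 0 schi.
pose eta := rint 0 1 (fun y => 1 - chi y).
have eta0 : 0 <= eta.
  by apply: rint_ge0; [exact: ler01|ctst|move=> y _; rewrite subr_ge0; case/andP: (chi01 y)].
have eta2 : eta <= 1 / 2 by apply: le_trans chiI _; lra.
pose m := rint 0 1 chi.
have mE : m = 1 - eta by rewrite /eta rintB ?rint_cst; [rewrite /m; ring|ctst..].
have m0 : 1 / 2 <= m by rewrite mE; lra.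
pose n := rint 0 1 (fun y => chi y * g y).
have nE : n = - rint 0 1 (fun y => (1 - chi y) * g y).
  have : rint 0 1 g = 0 by rewrite (rint_prim _ _ cg df) f0 f1 subrr.
  rewrite (@eq_rint _ g (fun y => chi y * g y + (1 - chi y) * g y)) => [|y]; last by ring.
  by rewrite rintD -/n; [move/eqP; rewrite addr_eq0 => /eqP|ctst..].
have nK : `|n| <= K * eta.
  rewrite nE normrN; apply: le_trans (ler_norm_rint ler01 _) _; first by ctst.
  rewrite /eta -rintZ; last by ctst.
  apply: le_rint; [exact: ler01|ctst..|move=> y y01].
  have c1 : 0 <= 1 - chi y by rewrite subr_ge0; case/andP: (chi01 y).
  by rewrite normrM ger0_norm// mulrC ler_wpM2r// gK.
pose c := n / m.
have mp : 0 < m by lra.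
have cK : c ^+ 2 <= 4 * K ^+ 2 * eta ^+ 2.
  have -> : 4 * K ^+ 2 * eta ^+ 2 = (2 * (K * eta)) ^+ 2 by ring.
  have Ke : 0 <= K * eta by rewrite mulr_ge0// ltW.
  rewrite -[leLHS]real_normK ?num_real//.
  rewrite ler_sqr ?nnegrE; [|exact: normr_ge0|exact: (mulr_ge0 (ler0n _ 2) Ke)].
  rewrite /c normrM normfV (gtr0_norm mp) ler_pdivrMr//.
  apply: le_trans nK _; rewrite mulrAC ler_peMl//; lra.
pose w y := chi y * (g y - c).
have cw : cts w by rewrite /w; ctst.
pose phi y := rint 0 y w.
have dphi y : hasd phi y (w y) by exact: hasd_rint.
have phi0 : phi 0 = 0 by exact: rint_xx.
have phi1 : phi 1 = 0.
  rewrite /phi /w (@eq_rint _ _ (fun y => chi y * g y - c * chi y)) => [|y]; last by ring.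
  by rewrite rintB ?rintZ; [rewrite -/n -/m /c divfK ?subrr// gt_eqF|ctst..].
have wo y : ~~ (eps <= y <= 1 - eps) -> w y = 0 by move=> /chi0; rewrite /w => ->; rewrite mul0r.
have d1 : derive1 phi = w := hasd_derive1 dphi.
exists phi.
  split.
    apply: (hasd_smooth1 dphi); apply: smooth_gen_smooth.
    apply: SG_mul (SG_smooth schi) _.
    exact: SG_add (SG_smooth sg) (SG_cst _).
  (* Outside [[eps, 1 - eps]] the mean value theorem from the nearer endpoint evaluates [w] at a
     point where it vanishes. *)
  exists eps, (1 - eps); split=> //; first by rewrite ltrBlDr ltrDl.
  move=> y; rewrite negb_and -!ltNge => /orP[ye|ye].
    have [t /andP[t0 t1]] := hasd_mvt 0 y dphi.
    rewrite phi0 subr0 => ->; rewrite wo ?mul0r// negb_and -ltNge add0r subr0.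
    apply/orP; left; have [y0|y0] := leP 0 y.
      by apply: le_lt_trans ye; rewrite ler_piMl// ltW.
    by apply: lt_trans eps0; rewrite pmulr_rlt0.
  have [t /andP[t0 t1]] := hasd_mvt 1 y dphi.
  rewrite phi1 subr0 => ->; rewrite wo ?mul0r// negb_and -!ltNge.
  apply/orP; right; have [y1|y1] := leP 1 y.
    apply: (@lt_le_trans _ _ 1); first by rewrite ltrBlDr ltrDl.
    by rewrite lerDl; apply: mulr_ge0; [exact: ltW|rewrite subr_ge0].
  have y1w : 0 <= 1 - y by rewrite subr_ge0; exact: ltW.
  have t1w : t <= 1 by exact: ltW.
  have ty : t * (1 - y) <= 1 - y by rewrite ler_piMl.
  by apply: lt_le_trans ye _; rewrite -lerBlDl -lerN2 opprB -mulrN opprB.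
pose D := rint 0 1 (fun y => (g y - w y) ^+ 2).
have DE : D <= (e / 2) ^+ 2.
  apply: (@le_trans _ _ (rint 0 1 (fun y => 2 * K ^+ 2 * (1 - chi y) + 8 * K ^+ 2 * eta ^+ 2))).
    apply: le_rint; [exact: ler01|ctst..|move=> y y01].
    have /andP[a0 a1] := chi01 y; have gy := gK y y01.
    have g2 : g y ^+ 2 <= K ^+ 2.
      by rewrite -[leLHS]real_normK ?num_real// lerXn2r ?nnegrE// ltW.
    have -> : g y - w y = (1 - chi y) * g y + chi y * c by rewrite /w; ring.
    apply: (@le_trans _ _ (2 * ((1 - chi y) ^+ 2 * g y ^+ 2) + 2 * (chi y ^+ 2 * c ^+ 2))).
      rewrite -subr_ge0 (_ : _ - _ = ((1 - chi y) * g y - chi y * c) ^+ 2).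
        exact: sqr_ge0.
      by ring.
    have q1 : (1 - chi y) ^+ 2 * g y ^+ 2 <= (1 - chi y) * K ^+ 2.
      have b0 : 0 <= 1 - chi y by rewrite subr_ge0.
      by apply: ler_pM => //; rewrite ?sqr_ge0// expr2 ler_piMl// gerBl.
    have q2 : chi y ^+ 2 * c ^+ 2 <= 4 * K ^+ 2 * eta ^+ 2.
      by apply: le_trans cK; rewrite ler_piMl ?sqr_ge0// expr_le1.
    rewrite (_ : 2 * K ^+ 2 * (1 - chi y) + _ =
      2 * ((1 - chi y) * K ^+ 2) + 2 * (4 * K ^+ 2 * eta ^+ 2)); last by ring.
    by apply: lerD; rewrite ler_wpM2l.
  rewrite rintD ?rint_cst ?rintZ; [|ctst..]; rewrite subr0 mulr1 -/eta.
  apply: le_trans epsE.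
  apply: (@le_trans _ _ (6 * K ^+ 2 * eta)).
    rewrite -mulrA expr2 -subr_ge0.
    rewrite (_ : _ - _ = 8 * K ^+ 2 * (eta * (1 / 2 - eta))); last by field.
    apply: mulr_ge0; first by apply: mulr_ge0; rewrite ?sqr_ge0.
    by apply: mulr_ge0; [exact: eta0|rewrite subr_ge0].
  rewrite (_ : 36 * K ^+ 2 * eps = 6 * K ^+ 2 * (6 * eps)); last by ring.
  by rewrite ler_wpM2l// mulr_ge0 ?sqr_ge0.
have D0 : 0 <= D.
  by apply: rint_ge0; [exact: ler01|ctst|move=> y _; exact: sqr_ge0].
have cf : cts f := hasd_cont df.
have cphi : cts phi := hasd_cont dphi.
have sD : Num.sqrt D <= e / 2.
  have eh : 0 <= e / 2 by apply: divr_ge0 => //; exact: ltW.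
  by rewrite -[leRHS](ger0_norm eh) -sqrtr_sqr; exact: ler_wsqrtr.
rewrite d1 !L2norm_unit_itv; [|ctst..].
rewrite -EFinD lee_fin (splitr e); apply: lerD => //.
apply: le_trans sD; apply: ler_wsqrtr.
rewrite -[leRHS]mulr1 -[X in D * X]subr0 -rint_cst.
apply: le_rint; [exact: ler01|ctst..|move=> y y01].
(* Since [f - phi] vanishes at [0], it is bounded by the norm of its derivative, so each of the two
   norms is at most [e / 2]. *)
have dF z : hasd (fun z => f z - phi z) z (g z - w z) by exact: hasdB.
have := @osc_sqr_le _ 0 1 _ _ y 0 _ dF y01.
by rewrite f0 phi0 subrr subr0 subr0 mul1r; apply; [ctst|rewrite lexx ler01].
Qed.

End TestFunctions.

(** * Lower bound of the dual norm *)

Section Dual.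
Context {R : realType}.
Notation mu := (@lebesgue_measure R).

Lemma weak_derivative_primitive (D : ydomain) (f g : R -> R) : cts g ->
  (forall y, hasd f y (g y)) -> f 0 = 0 -> f 1 = 0 -> weak_derivative D f g.
Proof.
move=> cg df f0 f1 phi [sphi _].
have cf : cts f := hasd_cont df.
have dphi := smooth1_hasd1 sphi.
have cphi : cts phi := hasd_cont dphi.
have cphi' : cts (derive1 phi) := @smooth1_cts _ _ 0 (smooth1_deriv sphi).
rewrite !Rintegral_oo_rint//; [|ctst..].
by rewrite (rint_parts 0 1 cg cphi' df dphi) f0 f1; ring.
Qed.

(** The primitive of a mean-zero [K] vanishes at [y = 0] and [y = 1], so the same test function is
    admissible in all three settings. *)
Lemma Ydual_ge s (nu T : R) (g : R * R * R -> R) (K : R -> R -> R -> R) :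
  0 < nu -> 0 < T -> cts3 (fun x y t => g (x, y, t)) -> cts3 K ->
  (forall x t, smooth1 (K x ^~ t)) -> (forall x t, rint 0 1 (K x ^~ t) = 0) ->
  nu * int3 T (fun x y t => K x y t ^+ 2) = 1 ->
  ((int3 T (fun x y t => g (x, y, t) * rint 0 y (K x ^~ t)))%:E <= Ydual s nu T g)%E.
Proof.
move=> nu0 T0 cg cK sK mK nK.
pose V x y t := rint 0 y (K x ^~ t).
have cV : cts3 V by rewrite /V; ctst.
pose v (p : R * R * R) := V p.1.1 p.1.2 p.2.
pose w (p : R * R * R) := K p.1.1 p.1.2 p.2.
have cK' x t : cts (K x ^~ t) by ctst.
apply: ereal_sup_ubound; exists v, w; split.
- split.
  + by apply: measurable_funTS; exact: (measurable_cts3 cV).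
  + by apply: measurable_funTS; exact: (measurable_cts3 cK).
  + by rewrite (@L2norm_spacetime _ T v)// ltry.
  + by rewrite (@L2norm_spacetime _ T w)// ltry.
  + apply: aeW => -[x t] _ /=.
    have dV y : hasd (fun y => V x y t) y (K x y t) by exact: hasd_rint.
    have V0 : V x 0 t = 0 by exact: rint_xx.
    have V1 : V x 1 t = 0 by exact: mK.
    have cKxt := cK' x t.
    split; first exact: (@weak_derivative_primitive _ (V x ^~ t) (K x ^~ t)).
    by move=> _; exact: (@H10_primitive _ (V x ^~ t) (K x ^~ t)).
- rewrite /Ynorm (@L2norm_spacetime _ T w)//= -EFinM -sqrtrM; last exact: ltW.
  by rewrite -[X in _ * X]/(int3 T (fun x y t => K x y t ^+ 2)) nK sqrtr1.
- have cgv : cts3 (fun x y t => g (x, y, t) * v (x, y, t)) by rewrite /v /=; ctst.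
  by rewrite (@integral_spacetime _ T (fun p => g p * v p)).
Qed.

(* The dual norm is the norm of the primitive [H] of [g] with zero mean:
   it is tested on the primitive of [- H]. *)
Lemma primitive_le_Ydual s (nu T G : R) (g : R * R * R -> R) (H : R -> R -> R -> R) :
  0 < nu -> 0 < T -> cts3 (fun x y t => g (x, y, t)) -> cts3 H ->
  (forall x t, smooth1 (H x ^~ t)) -> (forall x t, rint 0 1 (H x ^~ t) = 0) ->
  (forall x y t, hasd (fun y => H x y t) y (g (x, y, t))) ->
  (Ydual s nu T g <= G%:E)%E ->
  0 <= G /\ int3 T (fun x y t => H x y t ^+ 2) <= nu * G ^+ 2.
Proof.
move=> nu0 T0 cg cH sH mH dH YG.
pose g3 x y t := g (x, y, t); have cg3 : cts3 g3 := cg.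
(* A test function and its opposite are both admissible, so the supremum is nonnegative. The fixed
   mean-zero profile [y - 1 / 2], with squared norm [1 / 12], provides one even if [H] vanishes. *)
have G0 : 0 <= G.
  pose k (y : R) := y - 1 / 2.
  have ck : cts k by rewrite /k; ctst.
  have sk : smooth1 k.
    apply: smooth_gen_smooth; apply: (@SG_add _ (fun y => y) (fun=> _) _ (SG_cst _)).
    apply: SG_smooth; apply: (hasd_smooth1 (f' := fun=> 1)) => [y|]; first exact: hasd_id.
    exact: smooth_gen_smooth (SG_cst 1).
  have dk (n : nat) y : hasd (fun y => n.+1%:R^-1 * k y ^+ n.+1) y (k y ^+ n).
    apply: hasd_eq (hasdMl _ (hasd_exp _ _ _)) _.
    by rewrite mulKf// pnatr_eq0.
  have mk : rint 0 1 k = 0.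
    rewrite (@eq_rint _ _ (fun y => k y ^+ 1)) => [|y]; last by rewrite expr1.
    by rewrite (rint_prim _ _ _ (dk 1%N)); [rewrite /k; field|ctst].
  have k2 : rint 0 1 (fun y => k y ^+ 2) = 1 / 12.
    by rewrite (rint_prim _ _ _ (dk 2%N)); [rewrite /k; field|ctst].
  pose W := nu * (T / 12).
  have W0 : 0 < W by rewrite mulr_gt0// divr_gt0.
  pose V := int3 T (fun x y t => g3 x y t * rint 0 y k).
  have test c : c ^+ 2 = W^-1 -> c * V <= G.
    move=> c2; rewrite -lee_fin; apply: le_trans YG.
    have -> : c * V = int3 T (fun x y t => g (x, y, t) * rint 0 y (fun z => c * k z)).
      rewrite /V -int3Z; last by ctst.
      by apply: eq_int3 => x y t; rewrite rintZ//; rewrite /g3; ring.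
    apply: (@Ydual_ge s nu T g (fun _ y _ => c * k y) nu0 T0 cg).
    - by ctst.
    - by move=> x t; apply: smooth_gen_smooth; apply: SG_mul (SG_cst _) (SG_smooth sk).
    - by move=> x t; rewrite rintZ// mk mulr0.
    - rewrite (@eq_int3 _ _ _ (fun x y t => c ^+ 2 * k y ^+ 2)); last first.
        by move=> x y t; ring.
      rewrite int3Z; last by ctst.
      rewrite /int3 /int2 k2 !rint_cst c2 /W !subr0.
      by field; rewrite !gt_eqF.
  have s2 : (Num.sqrt W)^-1 ^+ 2 = W^-1 by rewrite exprVn sqr_sqrtr// ltW.
  have h1 := test _ s2; have h2 : - (Num.sqrt W)^-1 * V <= G.
    by apply: test; rewrite sqrrN.
  by move: h1 h2; rewrite mulNr; move: (_^-1 * V) => z; lra.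
split => //.
set W := int3 T _.
have [W0|W0] := ltP 0 W; last first.
  by apply: le_trans W0 _; apply: mulr_ge0; [exact: ltW|exact: sqr_ge0].
(* This normalises [- l * H]. Pairing its primitive with [g], the [y]-derivative of [H], gives
   [l * W] by parts, without boundary terms. *)
pose l := (Num.sqrt nu * Num.sqrt W)^-1.
have l0 : 0 < l by rewrite invr_gt0 mulr_gt0// sqrtr_gt0.
have l2 : l ^+ 2 = (nu * W)^-1.
  by rewrite /l exprVn exprMn !sqr_sqrtr// ltW.
have cH2 : cts3 (fun x y t => H x y t ^+ 2) by ctst.
have lW : l * W <= G.
  rewrite -lee_fin; apply: le_trans YG.
  have -> : l * W = int3 T (fun x y t => g (x, y, t) * rint 0 y (fun z => - l * H x z t)).
    transitivity (int3 T (fun x y t => l * H x y t ^+ 2)); first exact/esym/int3Z.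
    apply: eq_int2 => x t.
    have cHx : cts (H x ^~ t) by ctst.
    have cgx : cts (fun y => g3 x y t) by ctst.
    have dV y : hasd (fun y => rint 0 y (fun z => - l * H x z t)) y (- l * H x y t).
      by apply: hasd_rint; ctst.
    rewrite (@eq_rint _ (fun y => g (x, y, t) * _)
      (fun y => rint 0 y (fun z => - l * H x z t) * g3 x y t)); last first.
      by move=> y; rewrite mulrC.
    rewrite (@rint_parts _ _ (fun y => - l * H x y t) (H x ^~ t)) => //; [|ctst].
    have e1 : rint 0 1 (fun z => - l * H x z t) = 0.
      by rewrite (rintZ _ _ _ cHx) mH mulr0.
    rewrite rint_xx e1 !mul0r subrr sub0r -rintN; last by ctst.
    by apply: eq_rint => y; ring.
  apply: (@Ydual_ge s nu T g (fun x y t => - l * H x y t) nu0 T0 cg).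
  - by ctst.
  - by move=> x t; apply: smooth_gen_smooth; apply: SG_mul (SG_cst _) (SG_smooth _).
  - by move=> x t; rewrite rintZ ?mH ?mulr0//; ctst.
  - rewrite (@eq_int3 _ _ _ (fun x y t => l ^+ 2 * H x y t ^+ 2)); last first.
      by move=> x y t; ring.
    have -> : int3 T (fun x y t => l ^+ 2 * H x y t ^+ 2) = l ^+ 2 * W by exact: int3Z.
    by rewrite l2; field; rewrite !gt_eqF.
have : (l * W) ^+ 2 <= G ^+ 2 by rewrite ler_sqr ?nnegrE// mulr_ge0// ltW.
rewrite exprMn l2 (_ : _ * W ^+ 2 = W / nu); last by field; rewrite !gt_eqF.
by rewrite ler_pdivrMr// mulrC.
Qed.

End Dual.

(** * From boxes to the whole domain *)

Section Grid.
Context {R : realType}.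

Lemma rint_grid (f : R -> R) h n : cts f ->
  rint 0 (n%:R * h) f = \sum_(i < n) rint (i%:R * h) (i.+1%:R * h) f.
Proof.
move=> cf; elim: n => [|n IH]; first by rewrite big_ord0 mul0r rint_xx.
by rewrite big_ord_recr /= -IH rint_chasles.
Qed.

Lemma int3_grid T (f : R -> R -> R -> R) (h k : R) n m : cts3 f ->
  n%:R * h = 1 -> m%:R * k = T ->
  int3 T f = \sum_(j < m) \sum_(i < n) int2 (j%:R * k) (j.+1%:R * k)
    (fun x t => rint (i%:R * h) (i.+1%:R * h) (fun y => f x y t)).
Proof.
move=> cf nh <-; rewrite /int3 /int2 rint_grid; last by ctst.
apply: eq_bigr => j _.
transitivity (rint (j%:R * k) (j.+1%:R * k) (fun t => rint 0 1 (fun x =>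
    rint 0 (n%:R * h) (fun y => f x y t)))); first by rewrite nh.
elim: n {nh} => [|n IH].
  rewrite big_ord0 (@eq_rint _ _ (fun=> 0)) ?rint_cst ?mul0r// => t.
  by rewrite (@eq_rint _ _ (fun=> 0)) ?rint_cst ?mul0r// => x; rewrite rint_xx.
rewrite big_ord_recr /= -IH -rintD; [|ctst..].
apply: eq_rint => t; rewrite -rintD; [|ctst..].
by apply: eq_rint => x; rewrite rint_chasles//; ctst.
Qed.

Lemma nat_approx (X : R) : 1 <= X -> exists2 n : nat, (0 < n)%N &
  X^-1 <= n%:R^-1 <= 2 * X^-1.
Proof.
move=> X1; have X0 : 0 < X by apply: lt_le_trans X1.
have /andP[h0 h1] := truncn_itv (ltW X0); set n := Num.truncn X in h0 h1.
have n0 : (0 < n)%N.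
  rewrite lt0n; apply/eqP => n0; move: h1; rewrite n0 => h1.
  by move: (lt_le_trans h1 X1); rewrite ltxx.
exists n => //; have n0' : 0 < n%:R :> R by rewrite ltr0n.
rewrite lef_pV2 ?posrE// h0 /= -[2]invrK -invfM lef_pV2 ?posrE ?divr_gt0//; last first.
  by rewrite mulr_gt0// invr_gt0.
have : 1 <= n%:R :> R by rewrite ler1n.
by move: h1; rewrite -natr1 => h1 n1; rewrite mulrC ler_pdivrMr//; lra.
Qed.

Lemma Cbox_ge0 (c : R) : 0 < c -> 0 <= Cbox c.
Proof.
move=> c0; have i0 : 0 <= 28 / c by rewrite divr_ge0// ltW.
have i1 : 0 <= 96 / c by rewrite divr_ge0// ltW.
have i2 := mulr_ge0 i1 (addr_ge0 (ler0n R 5) i0).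
have i3 := mulr_ge0 (ler0n R 2) (addr_ge0 (ler0n R 216) i2).
exact: mulr_ge0 (ler0n R 64) (addr_ge0 i3 (ler0n R 8)).
Qed.

(** For [T = kappa ^- N.+1] one has exactly [sigma ^+ N.+3 = T * sigma ^+ 2 * (kappa * sigma) ^+
    N.+1]: duration of a box times the smallest oscillation of [b] on a cell. The factor [K] in the
    cell height compensates for [c]. *)
Lemma travel_time N (kappa sigma T c K d e a : R) :
  0 < kappa -> 0 < sigma -> 0 < c -> 1 <= K -> 1 <= c * K -> T = kappa ^- N.+1 ->
  sigma ^+ 2 <= e -> K * kappa * sigma <= d ->
  c * d ^+ N.+1 <= a -> sigma ^+ N.+3 <= T * e * a.
Proof.
move=> k0 s0 c0 K1 cK TE elo dlo ca.
have K0 : 0 < K by apply: lt_le_trans K1.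
have T0 : 0 < T by rewrite TE invr_gt0 exprn_gt0.
have ks0 : 0 < K * kappa * sigma by rewrite !mulr_gt0.
have d0 : 0 < d by apply: lt_le_trans dlo.
have ks : (kappa * sigma) ^+ N.+1 <= a.
  apply: le_trans ca; apply: (@le_trans _ _ (c * (K * kappa * sigma) ^+ N.+1)).
    have -> : c * (K * kappa * sigma) ^+ N.+1 = c * K ^+ N.+1 * (kappa * sigma) ^+ N.+1.
      by rewrite -mulrA exprMn mulrA.
    rewrite ler_peMl//; first by rewrite exprn_ge0// mulr_ge0// ltW.
    by rewrite exprS mulrA; apply: mulr_ege1 => //; exact: exprn_ege1.
  rewrite ler_wpM2l//; first exact: ltW.
  by rewrite lerXn2r// nnegrE ltW.
have -> : sigma ^+ N.+3 = T * sigma ^+ 2 * (kappa * sigma) ^+ N.+1.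
  rewrite exprMn TE -addn2 exprD.
  have : kappa ^+ N.+1 != 0 by rewrite expf_neq0// gt_eqF.
  by move: (kappa ^+ N.+1) (sigma ^+ N.+1) => p q p0; field.
apply: ler_pM => //; [by rewrite mulr_ge0 ?sqr_ge0// ltW|by rewrite exprn_ge0// mulr_ge0// ltW|].
by rewrite ler_wpM2l// ltW.
Qed.

(** Both terms reduce to [sigma ^+ 2 * T] through [T * kappa ^+ N.+3 = kappa ^+ 2]: the first from
    [h] of order [kappa * sigma], the second from [k / h] of order [T * sigma / kappa]. *)
Lemma scale_balance N (kappa sigma T K h k I1 I2 A2 G2 : R) :
  0 < kappa -> 0 < sigma -> 1 <= K -> T = kappa ^- N.+1 ->
  K * kappa * sigma <= h -> h <= 2 * (K * kappa * sigma) ->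
  0 <= k -> k <= 2 * T * sigma ^+ 2 -> 0 <= I1 -> 0 <= I2 ->
  kappa ^+ N.+3 * I1 <= A2 -> I2 <= kappa ^+ N.+3 * G2 ->
  h ^+ 2 * I1 + k ^+ 2 / h ^+ 2 * I2 <= 4 * K ^+ 2 * (sigma ^+ 2 * T * (A2 + G2)).
Proof.
move=> k0 s0 K1 TE hlo hhi kk0 khi I1_ge0 I2_ge0 HA HG.
have K0 : 0 < K by apply: lt_le_trans K1.
have T0 : 0 < T by rewrite TE invr_gt0 exprn_gt0.
have ks0 : 0 < K * kappa * sigma by rewrite !mulr_gt0.
have h0 : 0 < h by apply: lt_le_trans hlo.
have TK : T * kappa ^+ N.+3 = kappa ^+ 2.
  by rewrite TE -addn2 exprD mulrA mulVf ?mul1r// gt_eqF// exprn_gt0.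
have J1 : kappa ^+ 2 * I1 <= T * A2 by rewrite -TK -mulrA ler_wpM2l// ltW.
have J2 : T * I2 <= kappa ^+ 2 * G2 by rewrite -TK -mulrA ler_wpM2l// ltW.
have G2_ge0 : 0 <= G2.
  by rewrite -(pmulr_rge0 _ (exprn_gt0 2 k0)); apply: le_trans J2; rewrite mulr_ge0// ltW.
rewrite !mulrDr; apply: lerD.
  have h2 : h ^+ 2 <= (2 * (K * kappa * sigma)) ^+ 2.
    by rewrite ler_sqr ?nnegrE//; [exact: ltW|apply: ltW; rewrite mulr_gt0].
  apply: (le_trans (ler_wpM2r I1_ge0 h2)).
  have -> : (2 * (K * kappa * sigma)) ^+ 2 * I1 = 4 * K ^+ 2 * sigma ^+ 2 * (kappa ^+ 2 * I1).
    by ring.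
  have -> : 4 * K ^+ 2 * (sigma ^+ 2 * T * A2) = 4 * K ^+ 2 * sigma ^+ 2 * (T * A2) by ring.
  apply: ler_wpM2l J1; exact: mulr_ge0 (mulr_ge0 (ler0n _ 4) (sqr_ge0 _)) (sqr_ge0 _).
have kh : k / h <= 2 * T * sigma / (K * kappa).
  rewrite ler_pdivrMr// mulrAC ler_pdivlMr ?mulr_gt0//.
  apply: (@le_trans _ _ (2 * T * sigma ^+ 2 * (K * kappa))).
    by rewrite ler_wpM2r// mulr_ge0// ltW.
  have -> : 2 * T * sigma ^+ 2 * (K * kappa) = 2 * T * sigma * (K * kappa * sigma) by ring.
  by rewrite ler_wpM2l// !mulr_ge0// ltW.
have kh2 : (k / h) ^+ 2 <= (2 * T * sigma / (K * kappa)) ^+ 2.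
  rewrite ler_sqr ?nnegrE//; first by rewrite divr_ge0// ltW.
  by rewrite divr_ge0// !mulr_ge0// ltW.
rewrite -expr_div_n; apply: (le_trans (ler_wpM2r I2_ge0 kh2)).
have -> : (2 * T * sigma / (K * kappa)) ^+ 2 * I2 =
    4 * T * sigma ^+ 2 / (K ^+ 2 * kappa ^+ 2) * (T * I2).
  by field; rewrite !gt_eqF.
have c1 : 0 <= 4 * T * sigma ^+ 2 / (K ^+ 2 * kappa ^+ 2).
  exact: divr_ge0 (mulr_ge0 (mulr_ge0 (ler0n _ 4) (ltW T0)) (sqr_ge0 _))
    (mulr_ge0 (sqr_ge0 _) (sqr_ge0 _)).
apply: (le_trans (ler_wpM2l c1 J2)).
have -> : 4 * T * sigma ^+ 2 / (K ^+ 2 * kappa ^+ 2) * (kappa ^+ 2 * G2) =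
    (K ^- 2) * (4 * (sigma ^+ 2 * T * G2)) by field; rewrite !gt_eqF.
have -> : 4 * K ^+ 2 * (sigma ^+ 2 * T * G2) = K ^+ 2 * (4 * (sigma ^+ 2 * T * G2)) by ring.
have c2 : 0 <= 4 * (sigma ^+ 2 * T * G2).
  exact: mulr_ge0 (ler0n _ 4) (mulr_ge0 (mulr_ge0 (sqr_ge0 _) (ltW T0)) G2_ge0).
apply: ler_wpM2r c2 _ _ _.
apply: (@le_trans _ _ 1); first by rewrite invf_le1 ?exprn_ege1// exprn_gt0.
by rewrite exprn_ege1.
Qed.

Variables (N : nat) (b b1 : R -> R) (c : R).
Hypotheses (cb1 : cts b1) (db : forall y, hasd b y (b1 y)) (c0 : 0 < c)
  (cells : forall y0 y1, 0 <= y0 -> y0 < y1 -> y1 <= 1 -> y1 - y0 <= c ->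
    good_cell b b1 N c y0 y1).
Let K := Num.max 1 c^-1.

(** The two smallness conditions on [kappa] allow a mesh that divides [[0, 1]] evenly, within a
    factor two of [K * kappa * sigma], and at most [c]. [box_estimate] is then summed over the grid
    with the same [r] in every box. *)
Lemma increment_estimate (kappa sigma T A2 G2 : R) (u ux uy ut H : R -> R -> R -> R) :
  0 < kappa -> kappa <= (2 * K)^-1 -> kappa <= c / (2 * K) ->
  0 < sigma <= 1 -> T = kappa ^- N.+1 ->
  cts3 u -> cts3 ux -> cts3 uy -> cts3 ut -> cts3 H ->
  (forall x y t, u (x + 1) y t = u x y t) ->
  (forall x y t, uy (x + 1) y t = uy x y t) ->
  (forall x y t, H (x + 1) y t = H x y t) ->
  (forall x y t, hasd (fun x => u x y t) x (ux x y t)) ->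
  (forall x y t, hasd (fun y => u x y t) y (uy x y t)) ->
  (forall x y t, hasd (fun t => u x y t) t (ut x y t)) ->
  (forall x y t, hasd (fun y => H x y t) y (ut x y t + b y * ux x y t)) ->
  kappa ^+ N.+3 * int3 T (fun x y t => uy x y t ^+ 2) <= A2 ->
  int3 T (fun x y t => H x y t ^+ 2) <= kappa ^+ N.+3 * G2 ->
  int3 T (fun x y t => (u (x + sigma ^+ N.+3) y t - u x y t) ^+ 2) <=
  Cbox c * (4 * K ^+ 2) * (sigma ^+ 2 * T * (A2 + G2)).
Proof.
move=> k0 k1 k2 /andP[s0 s1] TE cu cux cuy cut cH pu puy pH dux duy dut dH HA HG.
have cb : cts b := hasd_cont db.
have K1 : 1 <= K by rewrite /K le_max lexx.
have K0 : 0 < K by apply: lt_le_trans K1.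
have cK : 1 <= c * K.
  by rewrite -(divff (lt0r_neq0 c0)) ler_wpM2l ?(ltW c0)// /K le_max lexx orbT.
have T0 : 0 < T by rewrite TE invr_gt0 exprn_gt0.
have ks0 : 0 < K * kappa * sigma by rewrite !mulr_gt0.
have kK : 2 * (K * kappa) <= 1.
  by rewrite mulrA mulrC -ler_pdivlMr ?mul1r// mulr_gt0.
have kc : 2 * (K * kappa) <= c.
  by rewrite mulrA mulrC -ler_pdivlMr// mulr_gt0.
have ks1 : K * kappa * sigma <= 1.
  have Kk0 := ltW (mulr_gt0 K0 k0).
  apply: le_trans kK; apply: (@le_trans _ _ (K * kappa)); first exact: ler_piMr.
  by apply: ler_peMl => //; rewrite ler1n.
have [n n0 /andP[dlo dhi]] : exists2 n : nat, (0 < n)%N &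
    K * kappa * sigma <= n%:R^-1 <= 2 * (K * kappa * sigma).
  have [|n n0] := @nat_approx (K * kappa * sigma)^-1; first by rewrite invf_ge1.
  by rewrite invrK; exists n.
have [m m0 /andP[tlo thi]] : exists2 m : nat, (0 < m)%N &
    sigma ^+ 2 <= m%:R^-1 <= 2 * sigma ^+ 2.
  have [|m m0] := @nat_approx (sigma ^+ 2)^-1.
    by rewrite invf_ge1 ?exprn_gt0// exprn_ile1// ltW.
  by rewrite invrK; exists m.
have n0' : 0 < n%:R :> R by rewrite ltr0n.
have m0' : 0 < m%:R :> R by rewrite ltr0n.
pose h : R := n%:R^-1; pose k : R := T / m%:R.
have h0 : 0 < h by rewrite invr_gt0.
have kk0 : 0 < k by rewrite divr_gt0.
have hc : h <= c.
  apply: (le_trans dhi); apply: le_trans kc; rewrite ler_wpM2l//.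
  by rewrite ler_piMr// mulr_ge0// ltW.
have nh : n%:R * h = 1 by rewrite /h divff// gt_eqF.
have mk : m%:R * k = T by rewrite /k mulrCA divff ?mulr1// gt_eqF.
have step (q : R) i : i.+1%:R * q - i%:R * q = q by rewrite -natr1; ring.
have C0 : 0 <= Cbox c := Cbox_ge0 c0.
set r := sigma ^+ N.+3; have r0 : 0 < r by rewrite exprn_gt0.
apply: (@le_trans _ _ (Cbox c * (h ^+ 2 * int3 T (fun x y t => uy x y t ^+ 2) +
    k ^+ 2 / h ^+ 2 * int3 T (fun x y t => H x y t ^+ 2)))).
  have cd : cts3 (fun x y t => (u (x + r) y t - u x y t) ^+ 2) by ctst.
  have cuy2 : cts3 (fun x y t => uy x y t ^+ 2) by ctst.
  have cH2 : cts3 (fun x y t => H x y t ^+ 2) by ctst.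
  rewrite (int3_grid cd nh mk) (int3_grid cuy2 nh mk) (int3_grid cH2 nh mk).
  rewrite !mulr_sumr -big_split mulr_sumr; apply: ler_sum => j _.
  rewrite !mulr_sumr -big_split mulr_sumr; apply: ler_sum => i _ /=.
  set y0 := i%:R * h; set y1 := i.+1%:R * h.
  have y01E : y1 - y0 = h by exact: step.
  have y01 : y0 < y1 by rewrite -subr_gt0 y01E.
  have t01E : j.+1%:R * k - j%:R * k = k by exact: step.
  have t01 : j%:R * k < j.+1%:R * k by rewrite -subr_gt0 t01E.
  have [a [a0 Ba b1a Bc ca]] : good_cell b b1 N c y0 y1.
    apply: cells => //; last by rewrite y01E.
      by rewrite mulr_ge0// ltW.
    by rewrite -nh ler_wpM2r ?(ltW h0)// ler_nat.
  have := @box_estimate R y0 y1 (j%:R * k) (j.+1%:R * k) y01 t01 u ux uy ut H b b1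
    cu cux cuy cut cH cb cb1 pu puy pH dux duy dut dH db r a c r0 a0 c0 Ba b1a Bc.
  rewrite y01E t01E; apply; move: ca; rewrite y01E => ca.
  exact: (travel_time k0 s0 c0 K1 cK TE tlo dlo ca).
set I1 := int3 T (fun x y t => uy x y t ^+ 2); set I2 := int3 T (fun x y t => H x y t ^+ 2).
have I1_ge0 : 0 <= I1 by apply: int3_ge0 => //; [ctst|move=> x y t; exact: sqr_ge0].
have I2_ge0 : 0 <= I2 by apply: int3_ge0 => //; [ctst|move=> x y t; exact: sqr_ge0].
rewrite -[leRHS]mulrA; apply: (ler_wpM2l C0).
move: HA HG; rewrite -/I1 -/I2; move: I1 I2 I1_ge0 I2_ge0 => I1 I2 I1_ge0 I2_ge0 HA HG.
apply: (scale_balance (N := N) (kappa := kappa)) => //; first exact: ltW.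
by rewrite /k [2 * T]mulrC -mulrA ler_wpM2l// ltW.
Qed.

End Grid.

(** * From increments at small scales to the x-mean and to all scales *)

Section Oscillation.
Context {R : realType}.

Lemma le_int3 T (f g : R -> R -> R -> R) : 0 < T -> cts3 f -> cts3 g ->
  (forall x y t, f x y t <= g x y t) -> int3 T f <= int3 T g.
Proof.
move=> T0 cf cg fg; apply: le_int2; [exact: ltW|ctst..|move=> x t _].
by apply: le_rint => //; ctst.
Qed.

Lemma cts_comp4 {X : topologicalType} (F : R -> R -> R -> R -> R) (f g h k : X -> R) :
  cts (fun p : R * R * R * R => F p.1.1.1 p.1.1.2 p.1.2 p.2) ->
  cts f -> cts g -> cts h -> cts k -> cts (fun x => F (f x) (g x) (h x) (k x)).
Proof.
move=> cF cf cg ch ck x.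
pose F' (p : R * R * R) z := F p.1.1 p.1.2 p.2 z.
have := @continuous2_cvg X (R * R * R)%type R R (nbhs x) (nbhs_filter x)
  (fun x => (f x, g x, h x)) k F' (f x, g x, h x) (k x) (cF (f x, g x, h x, k x)).
by apply; [exact: (cvg_pair (cvg_pair (cf x) (cg x)) (ch x))|exact: ck].
Qed.

Lemma int3_rint_swap T (F : R -> R -> R -> R -> R) :
  cts (fun p : R * R * R * R => F p.1.1.1 p.1.1.2 p.1.2 p.2) ->
  int3 T (fun x y t => rint 0 1 (fun z => F z x y t)) =
  rint 0 1 (fun z => int3 T (F z)).
Proof.
move=> cF.
transitivity (rint 0 T (fun t => rint 0 1 (fun z => rint 0 1 (fun x => rint 0 1 (F z x ^~ t))))).
  apply: eq_rint => t; transitivity (rint 0 1 (fun x => rint 0 1 (fun z => rint 0 1 (F z x ^~ t)))).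
    apply: eq_rint => x; apply: (@rint_swap _ (fun y z => F z x y t)).
    by apply: (cts_comp4 cF); ctst.
  apply: (@rint_swap _ (fun x z => rint 0 1 (F z x ^~ t))); ctst.
  by apply: (cts_comp4 cF); ctst.
apply: (@rint_swap _ (fun t z => rint 0 1 (fun x => rint 0 1 (F z x ^~ t)))); ctst.
by apply: (cts_comp4 cF); ctst.
Qed.

Variables (T B : R) (n : nat) (u : R -> R -> R -> R).
Hypotheses (T0 : 0 < T) (cu : cts3 u) (pu : forall x y t, u (x + 1) y t = u x y t)
  (uB : forall sigma, 0 < sigma <= 1 ->
    int3 T (fun x y t => (u (x + sigma ^+ n.+1) y t - u x y t) ^+ 2) <= B * sigma ^+ 2).

Lemma mean_oscillation :
  int3 T (fun x y t => (u x y t - rint 0 1 (fun z => u z y t)) ^+ 2) <= B.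
Proof.
have B1 z : 0 <= z <= 1 ->
    int3 T (fun x y t => (u (x + z) y t - u x y t) ^+ 2) <= B.
  move=> /andP[]; rewrite le_eqVlt => /predU1P[<- _|z0 z1].
    have := @uB 1; rewrite ltr01 lexx !expr1n mulr1 => /(_ isT); apply: le_trans.
    rewrite (@eq_int3 _ _ _ (fun _ _ _ => 0)).
      apply: le_int3 => //; [ctst..|move=> x y t; exact: sqr_ge0].
    by move=> x y t; rewrite addr0 subrr expr0n.
  (* Every shift [z] in []0, 1]] is [s ^+ n.+1] for a scale [s] in []0, 1]]. *)
  pose s := z `^ (n.+1%:R^-1).
  have s0 : 0 < s by exact: powR_gt0.
  have sE : s ^+ n.+1 = z.
    by rewrite -powR_mulrn ?ltW// -powRrM mulVf ?powRr1 ?ltW// pnatr_eq0.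
  have s1 : s <= 1.
    by rewrite -(@ler_pXn2r _ n.+1) ?nnegrE//; [rewrite sE expr1n|exact: ltW].
  have := @uB s; rewrite s0 s1 sE => /(_ isT) /le_trans; apply.
  have B0 : 0 <= B.
    have := @uB 1; rewrite ltr01 lexx !expr1n mulr1 => /(_ isT); apply: le_trans.
    by apply: int3_ge0 => //; [ctst|move=> x y t; exact: sqr_ge0].
  by rewrite ler_piMr// exprn_ile1// ltW.
apply: (@le_trans _ _ (int3 T (fun x y t =>
    rint 0 1 (fun z => (u (x + z) y t - u x y t) ^+ 2)))).
  apply: le_int3 => //; [ctst..|move=> x y t].
  have cux : cts (fun z => u z y t) by ctst.
  have cuz : cts (fun z => u (x + z) y t - u x y t) by ctst.
  have -> : u x y t - rint 0 1 (fun z => u z y t) =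
      - rint 0 1 (fun z => u (x + z) y t - u x y t).
    rewrite rintB; [|ctst..].
    rewrite rint_cst (_ : rint 0 1 (fun z => u (x + z) y t) = rint 0 1 (fun z => u z y t)).
      by ring.
    rewrite -[RHS](periodic_rint_shift x cux); last by move=> z; exact: pu.
    by apply: eq_rint => z; rewrite addrC.
  rewrite sqrrN; have := rint_sqr_le (ler01) cuz.
  by rewrite subr0 mul1r.
rewrite (@int3_rint_swap _ (fun z x y t => (u (x + z) y t - u x y t) ^+ 2)); last by ctst.
have -> : B = rint 0 1 (fun=> B) by rewrite rint_cst; ring.
by apply: le_rint => //; [rewrite /int3 /int2; ctst|ctst].
Qed.

(** Increments in [x] do not see the [x]-mean, so for [sigma > 1] they cost at most four times the
    squared norm of [u - <u>], and [sigma ^+ 2 >= 1]. *)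
Lemma increment_all_scales sigma : 0 < sigma ->
  int3 T (fun x y t => (u (x + sigma ^+ n.+1) y t - u x y t) ^+ 2) <= 4 * B * sigma ^+ 2.
Proof.
move=> s0; have B0 : 0 <= B.
  apply: le_trans mean_oscillation.
  by apply: int3_ge0 => //; [ctst|move=> x y t; exact: sqr_ge0].
have [s1|s1] := leP sigma 1.
  apply: (le_trans (uB _)); first by rewrite s0 s1.
  by rewrite ler_wpM2r ?sqr_ge0// ler_peMl// ler1n.
apply: (@le_trans _ _ (4 * B)); last first.
  by rewrite ler_peMr ?mulr_ge0// exprn_ege1// ltW.
pose m y t := rint 0 1 (fun z => u z y t).
pose v x y t := u x y t - m y t.
have cm : cts2 m by rewrite /m; ctst.
have cv : cts3 v by rewrite /v; ctst.
set r := sigma ^+ n.+1.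
have E : 4 * int3 T (fun x y t => v x y t ^+ 2) =
    int3 T (fun x y t => 2 * v (x + r) y t ^+ 2 + 2 * v x y t ^+ 2).
  have -> : int3 T (fun x y t => 2 * v (x + r) y t ^+ 2 + 2 * v x y t ^+ 2) =
      int3 T (fun x y t => 2 * v (x + r) y t ^+ 2) + int3 T (fun x y t => 2 * v x y t ^+ 2).
    by apply: int3D; ctst.
  rewrite int3Z; last by ctst.
  rewrite int3Z; last by ctst.
  have -> : int3 T (fun x y t => v (x + r) y t ^+ 2) = int3 T (fun x y t => v x y t ^+ 2).
    apply: (@int2_shift _ 0 T (fun x t => rint 0 1 (fun y => v x y t ^+ 2)) r).
      by ctst.
    by move=> x t; apply: eq_rint => y; rewrite /v pu.
  by move: (int3 T _) => z; ring.
apply: (@le_trans _ _ (4 * int3 T (fun x y t => v x y t ^+ 2))); last first.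
  by rewrite ler_wpM2l//; exact: mean_oscillation.
rewrite E; apply: le_int3 => //; [ctst..|move=> x y t].
have -> : u (x + r) y t - u x y t = v (x + r) y t - v x y t by rewrite /v; ring.
rewrite -subr_ge0.
suff -> : 2 * v (x + r) y t ^+ 2 + 2 * v x y t ^+ 2 - (v (x + r) y t - v x y t) ^+ 2 =
  (v (x + r) y t + v x y t) ^+ 2 by exact: sqr_ge0.
by ring.
Qed.

End Oscillation.

(** * Partial derivatives and slices of smooth functions of three variables *)

Section Slices.
Context {R : realType}.
Implicit Types f u : R * R * R -> R.

Lemma hasd_line f (l : R -> R * R * R) v x : (forall h, l (h + x) = h *: v + l x) ->
  differentiable f (l x) -> hasd (fun z => f (l z)) x ('D_v f (l x)).
Proof.
move=> lE df; have E : (fun h : R => h^-1 *: (((fun z => f (l z)) \o shift x) (h *: (1 : R)) - f (l x))) =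
    (fun h : R => h^-1 *: ((f \o shift (l x)) (h *: v) - f (l x))).
  by apply/funext => h /=; rewrite -lE /GRing.scale/= mulr1.
have D := @diff_derivable _ _ _ f (l x) v df.
split.
  by rewrite /derivable /= E; exact: D.
by rewrite /derive E.
Qed.

Lemma hasd_dx f x y t : smooth3 f -> hasd (fun z => f (z, y, t)) x (dx f (x, y, t)).
Proof.
move=> sf; apply: (@hasd_line f (fun z => (z, y, t))); last exact: (sf [::]).
by move=> h; rewrite -[RHS]/(h * 1 + x, h * 0 + y, h * 0 + t) mulr1 mulr0 !add0r.
Qed.

Lemma hasd_dy f x y t : smooth3 f -> hasd (fun z => f (x, z, t)) y (dy f (x, y, t)).
Proof.
move=> sf; apply: (@hasd_line f (fun z => (x, z, t))); last exact: (sf [::]).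
by move=> h; rewrite -[RHS]/(h * 0 + x, h * 1 + y, h * 0 + t) mulr1 mulr0 !add0r.
Qed.

Lemma hasd_dt f x y t : smooth3 f -> hasd (fun z => f (x, y, z)) t (dt f (x, y, t)).
Proof.
move=> sf; apply: (@hasd_line f (fun z => (x, y, z))); last exact: (sf [::]).
by move=> h; rewrite -[RHS]/(h * 0 + x, h * 0 + y, h * 1 + t) mulr1 mulr0 !add0r.
Qed.

Lemma smooth3_deriv f v : smooth3 f -> smooth3 ('D_v f).
Proof.
by move=> sf l p; have := sf (rcons l v) p; rewrite foldr_rcons.
Qed.

Lemma smooth3_cts f : smooth3 f -> cts3 (fun x y t => f (x, y, t)).
Proof.
move=> sf; rewrite /cts3 (_ : (fun p => _) = f); last by apply/funext => -[[x y] t].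
by move=> p; exact: differentiable_continuous (sf [::] p).
Qed.

Lemma smooth3_slice f x t : smooth3 f -> smooth1 (fun y => f (x, y, t)).
Proof.
move=> sf; apply: (smooth1_coind
  (P := fun h => exists2 g, smooth3 g & h = fun y => g (x, y, t))); last by exists f.
move=> _ [g sg ->]; exists (fun y => dy g (x, y, t)); first by move=> y; exact: hasd_dy.
by exists (dy g) => //; exact: smooth3_deriv.
Qed.

Lemma derive_x_periodic f v : (forall x y t, f (x + 1, y, t) = f (x, y, t)) ->
  forall x y t, 'D_v f (x + 1, y, t) = 'D_v f (x, y, t).
Proof.
move=> pf x y t.
suff E : (fun h : R => h^-1 *: ((f \o shift (x + 1, y, t)) (h *: v) - f (x + 1, y, t))) =
    (fun h : R => h^-1 *: ((f \o shift (x, y, t)) (h *: v) - f (x, y, t))).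
  by rewrite /derive E.
apply/funext => h /=; rewrite pf; congr (_ *: (_ - _)).
case: v => [[v1 v2] v3].
by rewrite -[LHS]/(f (h * v1 + (x + 1), h * v2 + y, h * v3 + t)) addrA pf.
Qed.

End Slices.

(** * The squared estimate in terms of the dual norm *)

Section Estimate.
Context {R : realType}.
Variables (N : nat) (b : R -> R) (c : R).
Hypotheses (sb : smooth1 b) (c0 : 0 < c)
  (cells : forall y0 y1, 0 <= y0 -> y0 < y1 -> y1 <= 1 -> y1 - y0 <= c ->
    good_cell b (derive1 b) N c y0 y1).
Let K := Num.max 1 c^-1.

Lemma int3_estimate s (kappa T G : R) (u : R * R * R -> R) :
  0 < kappa -> kappa <= (2 * K)^-1 -> kappa <= c / (2 * K) -> T = kappa ^- N.+1 ->
  smooth3 u -> (forall x y t, u (x + 1, y, t) = u (x, y, t)) ->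
  (Ydual s (kappa ^+ N.+3) T (X0 b u) <= G%:E)%E ->
  let B := Cbox c * (4 * K ^+ 2) *
    (T * (kappa ^+ N.+3 * int3 T (fun x y t => dy u (x, y, t) ^+ 2) + G ^+ 2)) in
  [/\ 0 <= G,
    int3 T (fun x y t => (u (x, y, t) - rint 0 1 (fun z => u (z, y, t))) ^+ 2) <= B &
    forall sigma, 0 < sigma ->
    int3 T (fun x y t => (u (x + sigma ^+ N.+3, y, t) - u (x, y, t)) ^+ 2) <=
    4 * B * sigma ^+ 2].
Proof.
move=> k0 k1 k2 TE su pu YG.
have T0 : 0 < T by rewrite TE invr_gt0 exprn_gt0.
have nu0 : 0 < kappa ^+ N.+3 by rewrite exprn_gt0.
have sx := smooth3_deriv (1, 0, 0) su; rewrite -/(dx u) in sx.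
have sy := smooth3_deriv (0, 1, 0) su; rewrite -/(dy u) in sy.
have st := smooth3_deriv (0, 0, 1) su; rewrite -/(dt u) in st.
have db y : hasd b y (derive1 b y) by exact: smooth1_hasd1.
have cb : cts b := hasd_cont db.
have cb1 : cts (derive1 b) by rewrite -derive1n1; exact: smooth1_cts.
pose u3 x y t := u (x, y, t); pose ux x y t := dx u (x, y, t).
pose uy x y t := dy u (x, y, t); pose ut x y t := dt u (x, y, t).
have cu : cts3 u3 by exact: smooth3_cts.
have cux : cts3 ux by exact: smooth3_cts.
have cuy : cts3 uy by exact: smooth3_cts.
have cut : cts3 ut by exact: smooth3_cts.
pose g x y t := ut x y t + b y * ux x y t.
have cg : cts3 g by rewrite /g; ctst.
(* The subtracted constant gives [H] zero mean in [y], so that multiples of [H] may serve as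
   derivatives of test functions. *)
pose H x y t := rint 0 y (g x ^~ t) - rint 0 1 (fun z => rint 0 z (g x ^~ t)).
have cH : cts3 H by rewrite /H; ctst.
have dH x y t : hasd (fun y => H x y t) y (g x y t).
  rewrite -[g x y t]subr0; apply: hasdB (hasd_cst _ _).
  by apply: (@hasd_rint _ (g x ^~ t)); ctst.
have sg x t : smooth1 (g x ^~ t).
  apply: smooth_gen_smooth.

  exact: (@SG_add _ (ut x ^~ t) (fun y => b y * ux x y t)
    (SG_smooth (smooth3_slice st))
    (@SG_mul _ b (ux x ^~ t) (SG_smooth sb) (SG_smooth (smooth3_slice sx)))).
have sH x t : smooth1 (H x ^~ t) by exact: hasd_smooth1 (sg x t).
have mH x t : rint 0 1 (H x ^~ t) = 0.
  rewrite /H rintB; [|ctst..].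
  by rewrite rint_cst subr0 mulr1 subrr.
have pux x y t : ux (x + 1) y t = ux x y t by exact: derive_x_periodic.
have put x y t : ut (x + 1) y t = ut x y t by exact: derive_x_periodic.
have puy x y t : uy (x + 1) y t = uy x y t by exact: derive_x_periodic.
have pg x y t : g (x + 1) y t = g x y t by rewrite /g put pux.
have pH x y t : H (x + 1) y t = H x y t.
  have E : (g (x + 1))^~ t = (g x)^~ t by apply/funext => z; exact: pg.
  by rewrite /H E.
have [G0 HG] := @primitive_le_Ydual R s (kappa ^+ N.+3) T G (X0 b u) H nu0 T0 cg cH sH mH dH YG.
set B := Cbox c * _ * _.
have uB sigma : 0 < sigma <= 1 ->
    int3 T (fun x y t => (u3 (x + sigma ^+ N.+3) y t - u3 x y t) ^+ 2) <= B * sigma ^+ 2.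
  move=> s01.
  have := @increment_estimate R N b (derive1 b) c cb1 db c0 cells kappa sigma T
    _ (G ^+ 2) u3 ux uy ut H k0 k1 k2 s01 TE cu cux cuy cut cH pu puy pH
    (fun x y t => hasd_dx x y t su) (fun x y t => hasd_dy x y t su)
    (fun x y t => hasd_dt x y t su) dH (lexx _) HG.
  by move/le_trans; apply; rewrite /B [leRHS]mulrAC -!mulrA.
split; first exact: G0.
  (* The exponent in that section is [n.+1], whence [n = N.+2]. *)
  exact: (@mean_oscillation _ T _ N.+2 u3 T0 cu pu uB).
exact: (@increment_all_scales _ T _ N.+2 u3 T0 cu pu uB).
Qed.

End Estimate.

Lemma sqrt_sum_sqr_le (R : realType) (x y : R) : 0 <= x -> 0 <= y ->
  Num.sqrt (x ^+ 2 + y ^+ 2) <= x + y.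
Proof.
move=> x0 y0; rewrite -[leRHS](ger0_norm (addr_ge0 x0 y0)) -sqrtr_sqr.
rewrite ler_wsqrtr// sqrrD lerD2r lerDl mulrn_wge0//; exact: mulr_ge0.
Qed.

Theorem theorem4p6 (R : realType) (D : ydomain) (b : R -> R) (M : nat)
    (yc : 'I_M -> R) (Nc : 'I_M -> nat)
    (hb : smooth_profile D b) (hcrit : is_critical_data D b yc Nc) :
  let N := (\max_(i < M) Nc i)%N in
  exists nu0 C : R, [/\ 0 < nu0, 0 < C &
    forall nu : R, 0 < nu <= nu0 ->
    let T := nu `^ (- (N.+1%:R / N.+3%:R)) in
    forall s : setting, ydomain_of s = D ->
    forall u : R * R * R -> R, admissible s T u ->
    ((nu `^ (N.+1%:R / (2 * N.+3%:R)))%:E *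
       (L2norm (lebesgue3 R) (spacetime T) (fun p => u p - xmean u p)%R
        + Qnorm (N.+3%:R^-1) T u)
     <= C%:E * (Ydual s nu T (X0 b u) + Ynorm nu T (dy u)))%E].
Proof.
move=> N; have [sb _] := hb.
have db y : hasd b y (derive1 b y) by exact: smooth1_hasd1.
have cb : cts b := hasd_cont db.
have cb1 : cts (derive1 b) by rewrite -derive1n1; exact: smooth1_cts.
have [c c0 cells] := cells_good cb1 db (profile_nondegenerate hb hcrit).
rewrite -/N in cells.
pose K := Num.max 1 c^-1; have K0 : 0 < K by rewrite lt_max ltr01.
pose k0 := Num.min (2 * K)^-1 (c / (2 * K)).
have K2 : 0 < 2 * K by exact: mulr_gt0.
have k00 : 0 < k0 by rewrite lt_min invr_gt0 K2 divr_gt0.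
pose C0 := Cbox c * (4 * K ^+ 2).
have C00 : 0 <= C0.
  exact: mulr_ge0 (Cbox_ge0 c0) (mulr_ge0 (ler0n _ 4) (sqr_ge0 _)).
(* The [3] is one from the [L^2] norm and two, the root of [4], from the increments; the [1] ensures
   positivity. *)
have C1 : 0 < 3 * Num.sqrt C0 + 1.
  exact: ltr_wpDl (mulr_ge0 (ler0n _ 3) (sqrtr_ge0 _)) ltr01.
exists (k0 ^+ N.+3), (3 * Num.sqrt C0 + 1); split.
- exact: exprn_gt0.
- exact: C1.
move=> nu /andP[nu0 nuk] T s sD u [su pu _ _].
pose kappa := nu `^ (N.+3%:R^-1).
have kp : 0 < kappa by exact: powR_gt0.
have kE : kappa ^+ N.+3 = nu.
  by rewrite -powR_mulrn ?ltW// -powRrM mulVf ?powRr1 ?ltW// pnatr_eq0.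
have kk : kappa <= k0.
  by rewrite -(@ler_pXn2r _ N.+3) ?nnegrE// ?kE// ltW.
have TE : T = kappa ^- N.+1.
  by rewrite -powR_mulrn ?ltW// -powRrM -powRN; congr (_ `^ _); rewrite mulrC.
have T0 : 0 < T by exact: powR_gt0.
set w := nu `^ (N.+1%:R / _); have w0 : 0 < w by exact: powR_gt0.
(* The square of the prefactor exactly cancels the factor [T] in the squared estimate. *)
have wT : w ^+ 2 * T = 1.
  rewrite -powR_mulrn ?ltW// -powRrM -powRD; last first.
    by apply/implyP => _; rewrite gt_eqF.
  rewrite (_ : _ + _ = 0) ?powRr0//; field.
  by rewrite gt_eqF// ltr0Sn.
set I1 := int3 T (fun x y t => dy u (x, y, t) ^+ 2).
have cy : cts3 (fun x y t => dy u (x, y, t)) by exact: smooth3_cts (smooth3_deriv _ su).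
pose u3 x y t := u (x, y, t); have cu : cts3 u3 by exact: smooth3_cts.
have I1_ge0 : 0 <= I1 by apply: int3_ge0 => //; [ctst|move=> x y t; exact: sqr_ge0].
have AE : Ynorm nu T (dy u) = (Num.sqrt (nu * I1))%:E.
  rewrite /Ynorm L2norm_spacetime// -EFinM (sqrtrM _ (ltW nu0)); exact: erefl.
have est G : (Ydual s nu T (X0 b u) <= G%:E)%E -> 0 <= G /\
    (w%:E * (L2norm (lebesgue3 R) (spacetime T) (fun p => u p - xmean u p)%R
        + Qnorm (N.+3%:R^-1) T u) <=
     (3 * Num.sqrt C0 + 1)%:E * (G%:E + (Num.sqrt (nu * I1))%:E))%E.
  move=> YG; have := @int3_estimate R N b c sb c0 cells s kappa T G u kp.
  rewrite -/K kE => /(_ _ _ TE su pu YG)[].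
    by apply: le_trans kk _; rewrite ge_min lexx.
    by apply: le_trans kk _; rewrite ge_min lexx orbT.
  rewrite -/C0 -/I1; set B := C0 * _ => G0 osc incr; split => //.
  have B0 : 0 <= B.
    exact: mulr_ge0 C00 (mulr_ge0 (ltW T0) (addr_ge0 (mulr_ge0 (ltW nu0) I1_ge0) (sqr_ge0 _))).
  have cm : cts3 (fun x y t => u (x, y, t) - rint 0 1 (fun z => u (z, y, t))).
    rewrite -[X in cts3 X]/(fun x y t => u3 x y t - rint 0 1 (fun z => u3 z y t)).
    by ctst.
  have mE : xmean u = fun p => rint 0 1 (fun z => u (z, p.1.2, p.2)).
    apply/funext => p; rewrite /xmean Rintegral_oo_rint//.
    by rewrite -[X in cts X]/(fun z => u3 z p.1.2 p.2); ctst.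
  have L_le : (L2norm (lebesgue3 R) (spacetime T) (fun p => u p - xmean u p)%R
      <= (Num.sqrt B)%:E)%E.
    rewrite mE L2norm_spacetime//.
    by rewrite lee_fin; apply: ler_wsqrtr; exact: osc.
  have Q_le : (Qnorm (N.+3%:R^-1) T u <= (2 * Num.sqrt B)%:E)%E.
    apply: ge_ereal_sup => _ [sigma s0 ->].
    rewrite invrK (powR_mulrn _ (ltW s0)) L2norm_spacetime//; last first.
      by rewrite -[X in cts3 X]/(fun x y t => u3 (x + sigma ^+ N.+3) y t - u3 x y t); ctst.
    rewrite -EFinM lee_fin ler_pdivrMl//.
    have -> : sigma * (2 * Num.sqrt B) = Num.sqrt (4 * B * sigma ^+ 2).
      rewrite (_ : 4 * B * sigma ^+ 2 = (2 * sigma) ^+ 2 * B); last by ring.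
      rewrite (sqrtrM _ (sqr_ge0 (2 * sigma))) sqrtr_sqr ger0_norm; first by ring.
      by rewrite mulr_ge0// ltW.
    by apply: ler_wsqrtr; exact: incr.
  have LQ := leeD L_le Q_le.
  apply: (@le_trans _ _ (w%:E * ((Num.sqrt B)%:E + (2 * Num.sqrt B)%:E))%E).
    by apply: lee_wpmul2l LQ; rewrite lee_fin ltW.
  rewrite -!EFinD -!EFinM lee_fin.
  have -> : w * (Num.sqrt B + 2 * Num.sqrt B) = 3 * Num.sqrt C0 * Num.sqrt (nu * I1 + G ^+ 2).
    have -> : w * (Num.sqrt B + 2 * Num.sqrt B) = 3 * (w * Num.sqrt B) by ring.
    rewrite -mulrA -sqrtrM//; congr (_ * _).
    rewrite -[w in LHS](ger0_norm (ltW w0)) -sqrtr_sqr -sqrtrM ?sqr_ge0//.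
    by congr Num.sqrt; rewrite /B mulrCA [w ^+ 2 * _]mulrA wT mul1r.
  set A := Num.sqrt (nu * I1).
  have -> : nu * I1 = A ^+ 2 by rewrite sqr_sqrtr// mulr_ge0// ltW.
  have A0 : 0 <= A by exact: sqrtr_ge0.
  have s0 : 0 <= 3 * Num.sqrt C0 by rewrite mulr_ge0// sqrtr_ge0.
  rewrite [A ^+ 2 + _]addrC; apply: ler_pM => //; first by rewrite lerDl.
  exact: sqrt_sum_sqr_le.
(* An infinite dual norm makes the right side infinite; the value [-oo] is excluded by [est] at
   [-1], which would give [0 <= -1]. *)
case YE : (Ydual s nu T (X0 b u)) => [G| |].
- by have [|_] := est G; rewrite ?YE// AE.
- rewrite AE addye// gt0_muley ?leey// lte_fin.
- have [|] := est (-1); first by rewrite YE leNye.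
  by rewrite ler0N1.
Qed.
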